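(* Let $r$ be a real rational function with non-constant numerator for which there are disks $D_1,\ldots,D_L$ as described in the context, and let $J\in\mathbb R^{p\times p}$ be a signature matrix. Let $\mathfrak P$ be a reproducing kernel Pontryagin space of $\mathbb C^p$-valued functions analytic in $r^{-1}(A(r))$. Then the following are equivalent. (1) For all $\alpha,\beta\in\Omega(r)\cap A(r)$ with $\alpha\neq\overline\beta$, the operators $R^{(r)}_\alpha$ and $R^{(r)}_\beta$ map $\mathfrak P$ into itself and, for all $f,g\in\mathfrak P$, $$[R^{(r)}_\alpha f,g]_{\mathfrak P}-[f,R^{(r)}_\beta g]_{\mathfrak P}-(\alpha-\overline\beta)[R^{(r)}_\alpha f,R^{(r)}_\beta g]_{\mathfrak P}=i(\alpha-\overline\beta)\sum_{i,j=1}^N\frac{g(v_j)^*}{\overline{r'(v_j)}}\,J\,\frac{f(u_i)}{r'(u_i)}\,\frac{1}{u_i-\overline{v_j}},$$ where $u_1,\ldots,u_N$ are the roots of $r(u)=\alpha$ and $v_1,\ldots,v_N$ are the roots of $r(v)=\beta$ (the symbol $i$ in front of the sum and in $-i$ below being the imaginary unit). (2) The reproducing kernel of $\mathfrak P$ is of the form $$(Z_r(z)\otimes I_p)\,\frac{X(J,r)^{-1}-\Theta(r(z))\,X(J,r)\,\Theta(r(w))^*}{-i(r(z)-\overline{r(w)})}\,(Z_r(w)\otimes I_p)^*,$$ where $\Theta$ is a $\mathbb C^{Np\times Np}$-valued function analytic in a neighborhood of the origin.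
   Context: Setting: $r=P/Q$ with $P,Q$ coprime polynomials, $\deg P\ge\deg Q$, $N=\deg P$. Real means $r(z)=\overline{r(\overline z)}$. A signature matrix is a matrix $J$ with $J=J^*=J^{-1}$. $\mathfrak L(r)$ is the $N$-dimensional linear span of the functions $z\mapsto\frac{r(z)-r(a)}{z-a}$, $a$ a point of analyticity of $r$; $e_1,\ldots,e_N$ is a fixed basis of $\mathfrak L(r)$ consisting of real rational functions, and $Z_r(z)=(e_1(z)\ \cdots\ e_N(z))$. $\Omega(r)$ is the set of $\alpha\in\mathbb C$ for which $r(z)=\alpha$ has $N$ pairwise different roots $w_1,\ldots,w_N$. For $\alpha\in\Omega(r)$ and $f$ analytic in a neighborhood of these roots, $$(R^{(r)}_\alpha f)(z)=\frac{f(z)}{r(z)-\alpha}-\sum_{n=1}^N\frac{f(w_n)}{r'(w_n)(z-w_n)},\quad r(z)\ne\alpha,$$ extended analytically across the removable singularities $w_1,\ldots,w_N$. Associated symmetric matrix: $X(J,r)=\sum_{n=1}^N\frac{(Z_r(w_n)\otimes I_p)^tJ(Z_r(w_n)\otimes I_p)}{r'(w_n)}\in\mathbb R^{Np\times Np}$, where $w_1,\ldots,w_N$ are the roots of $r(z)=\alpha$ for any $\alpha\in\Omega(r)$; it is real symmetric, invertible and independent of $\alpha\in\Omega(r)$. Disks: $D_1,\ldots,D_L$ are pairwise disjoint open disks around the distinct zeros of $r$; neither the $D_\ell$ nor their boundaries contain poles of $r$, and, with $\rho=\min_{s\in\bigcup_\ell\partial D_\ell}|r(s)|$, one has $\{z:|r(z)|<\rho\}\subset\bigcup_\ell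 D_\ell$. A choice of such disks is fixed, and $A(r)=\mathbb C\setminus\bigcup_{\ell=1}^L r(\partial D_\ell)$. Convention: the functions considered on $r^{-1}(A(r))$ are those of the form $f(z)=(Z_r(z)\otimes I_p)F(r(z))$ with $F$ a $\mathbb C^{Np}$-valued function analytic in $A(r)$. $[\cdot,\cdot]_{\mathfrak P}$ is the indefinite inner product of $\mathfrak P$. *)

(* Defs.v *)
From mathcomp Require Import all_boot all_order all_algebra.
From mathcomp Require Import all_classical all_reals all_analysis.
From mathcomp Require Import complex mxtens.

Set Implicit Arguments.
Unset Strict Implicit.
Unset Printing Implicit Defensive.

Import Order.TTheory GRing.Theory Num.Theory.
Import numFieldNormedType.Exports.

Local Open Scope classical_set_scope.
Local Open Scope ring_scope.

(* The complex plane is R[i]; its norm topology is carried by the alias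
   R[i]^o, which only appears in the three definitions below. *)
Definition cderivable (R : realType) (h : R[i] -> R[i]) (z : R[i]) : Prop :=
  derivable (h : R[i]^o -> R[i]^o) z 1.

Definition cderiv (R : realType) (h : R[i] -> R[i]) (z : R[i]) : R[i] :=
  derive1 (h : R[i]^o -> R[i]^o) z.

Definition clim (R : realType) (h : R[i] -> R[i]) (z : R[i]) : R[i] :=
  lim ((h : R[i]^o -> R[i]^o) y @[y --> (z : R[i]^o)^']).

(* Analyticity on an open set (resp. near a point) is complex
   differentiability at each of its points, entry by entry. *)
Definition analytic_on (R : realType) (m n : nat)
    (F : R[i] -> 'M[R[i]]_(m, n)) (U : set R[i]) : Prop :=
  forall z, U z -> forall i j, cderivable (fun y => F y i j) z.

Definition analytic_near (R : realType) (m n : nat)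
    (F : R[i] -> 'M[R[i]]_(m, n)) (a : R[i]) : Prop :=
  \forall z \near (a : R[i]^o),
    forall i j, cderivable (fun y => F y i j) z.

Definition adjmx (R : realType) (m n : nat) (M : 'M[R[i]]_(m, n)) :
    'M[R[i]]_(n, m) :=
  map_mx Num.conj M^T.

Definition signature_mx (R : realType) (p : nat) (J : 'M[R]_p) : Prop :=
  [/\ J = J^T, J \in unitmx & J = invmx J].

(* A function on a subset D of the plane is represented by the function on
   the whole plane that agrees with it on D and vanishes off D, so that
   equality of representatives is equality of functions on D. *)
Definition on_domain (T : Type) (V : nmodType) (D : set T) (f : T -> V) :
    T -> V :=
  patch (fun=> 0) D f.

Definition analytic_pts (R : realType) (Q : {poly R[i]}) : set R[i] :=
  [set z | Q.[z] != 0].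

(* Vanishes at the poles, since x / 0 = 0. *)
Definition ratf (R : realType) (P Q : {poly R[i]}) (z : R[i]) : R[i] :=
  P.[z] / Q.[z].

Definition real_fun (R : realType) (h : R[i] -> R[i]) : Prop :=
  forall z, h z = (h z^*)^*.

Definition solutions (R : realType) (P Q : {poly R[i]}) (a : R[i]) :
    set R[i] :=
  [set z | analytic_pts Q z /\ ratf P Q z = a].

(* deg P = (size P).-1 *)
Definition Omega (R : realType) (P Q : {poly R[i]}) : set R[i] :=
  [set a | (solutions P Q a #= `I_(size P).-1)%card].

(* z |-> (r z - r a) / (z - a), continued by r' a at z = a *)
Definition diff_quot (R : realType) (P Q : {poly R[i]}) (a : R[i]) :
    R[i] -> R[i] :=
  on_domain (analytic_pts Q) (fun z =>
    if z == a then cderiv (ratf P Q) a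
    else (ratf P Q z - ratf P Q a) / (z - a)).

Definition Lspace (R : realType) (P Q : {poly R[i]}) : set (R[i] -> R[i]) :=
  [set h | exists (m : nat) (a c : 'I_m -> R[i]),
    (forall k, analytic_pts Q (a k)) /\
    forall z, h z = \sum_(k < m) c k * diff_quot P Q (a k) z].

Definition real_basis (R : realType) (P Q : {poly R[i]}) (N : nat)
    (e : 'I_N -> R[i] -> R[i]) : Prop :=
  [/\ forall k, Lspace P Q (e k),
      forall c : 'I_N -> R[i],
        (forall z, \sum_k c k * e k z = 0) -> forall k, c k = 0,
      forall h, Lspace P Q h ->
        exists c : 'I_N -> R[i], forall z, h z = \sum_k c k * e k z
    & forall k, real_fun (e k)].

(* Z_r(z) (x) I_p; the cast identifies 1 * p rows with p rows. *)
Definition ZI (R : realType) (N p : nat) (e : 'I_N -> R[i] -> R[i])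
    (z : R[i]) : 'M[R[i]]_(p, N * p) :=
  castmx (mul1n p, erefl (N * p)%N)
    (tensmx (\row_(k < N) e k z) (1%:M : 'M[R[i]]_p)).

Definition cmx (R : realType) (m n : nat) (M : 'M[R]_(m, n)) :
    'M[R[i]]_(m, n) :=
  map_mx (real_complex R) M.

(* X(J, r), computed from the roots of r(z) = a. *)
Definition assoc_mx (R : realType) (P Q : {poly R[i]}) (N p : nat)
    (e : 'I_N -> R[i] -> R[i]) (J : 'M[R]_p) (a : R[i]) :
    'M[R[i]]_(N * p) :=
  \sum_(w \in solutions P Q a)
    ((cderiv (ratf P Q) w)^-1 *: ((ZI p e w)^T *m cmx J *m ZI p e w)).

Definition disk (R : realType) (c : R[i]) (s : R) : set R[i] :=
  [set z | `|z - c| < (s%:C)%C].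

Definition circle (R : realType) (c : R[i]) (s : R) : set R[i] :=
  [set z | `|z - c| = (s%:C)%C].

Record zero_disks (R : realType) (P Q : {poly R[i]}) (L : nat)
    (zeta : 'I_L -> R[i]) (s : 'I_L -> R) (rho : R) : Prop := ZeroDisks {
  zd_inj : injective zeta;
  zd_zeros : forall z, root P z <-> exists l, z = zeta l;
  zd_radius : forall l, 0 < s l;
  zd_disjoint : trivIset setT (fun l => disk (zeta l) (s l));
  zd_poles : forall l z,
    disk (zeta l) (s l) z \/ circle (zeta l) (s l) z -> Q.[z] != 0;
  zd_min_attained : exists l z,
    circle (zeta l) (s l) z /\ `|ratf P Q z| = (rho%:C)%C;
  zd_min_le : forall l z,
    circle (zeta l) (s l) z -> (rho%:C)%C <= `|ratf P Q z|;
  zd_sublevel : forall z, analytic_pts Q z -> `|ratf P Q z| < (rho%:C)%C ->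
    exists l, disk (zeta l) (s l) z }.

Definition Aset (R : realType) (P Q : {poly R[i]}) (L : nat)
    (zeta : 'I_L -> R[i]) (s : 'I_L -> R) : set R[i] :=
  ~` \bigcup_l (ratf P Q @` circle (zeta l) (s l)).

Definition preimA (R : realType) (P Q : {poly R[i]}) (A : set R[i]) :
    set R[i] :=
  [set z | analytic_pts Q z /\ A (ratf P Q z)].

Definition admissible_fun (R : realType) (P Q : {poly R[i]}) (N p : nat)
    (e : 'I_N -> R[i] -> R[i]) (A : set R[i]) (f : R[i] -> 'cV[R[i]]_p) :
    Prop :=
  exists F : R[i] -> 'cV[R[i]]_(N * p),
    analytic_on F A /\
    f = on_domain (preimA P Q A) (fun z => ZI p e z *m F (ratf P Q z)).

Definition resolvent_formula (R : realType) (P Q : {poly R[i]}) (p : nat)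
    (a : R[i]) (f : R[i] -> 'cV[R[i]]_p) (z : R[i]) : 'cV[R[i]]_p :=
  (ratf P Q z - a)^-1 *: f z
  - \sum_(w \in solutions P Q a)
      ((cderiv (ratf P Q) w * (z - w))^-1 *: f w).

(* R_a f; its value at a root of r(z) = a is that of the analytic
   continuation, i.e. the limit of the formula. *)
Definition Rop (R : realType) (P Q : {poly R[i]}) (A : set R[i]) (p : nat)
    (a : R[i]) (f : R[i] -> 'cV[R[i]]_p) : R[i] -> 'cV[R[i]]_p :=
  on_domain (preimA P Q A) (fun z =>
    if ratf P Q z == a
    then \col_k clim (fun y => resolvent_formula P Q a f y k 0) z
    else resolvent_formula P Q a f z).

Definition subspace (R : realType) (V : lmodType R[i]) (H : set V) : Prop :=
  H 0 /\ forall (c : R[i]) u v, H u -> H v -> H (c *: u + v).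

Definition sesquilinear_on (R : realType) (V : lmodType R[i]) (H : set V)
    (ip : V -> V -> R[i]) : Prop :=
  (forall (c : R[i]) u v w, H u -> H v -> H w ->
     ip (c *: u + v) w = c * ip u w + ip v w) /\
  (forall u v, H u -> H v -> ip v u = (ip u v)^*).

Definition hilbert (R : realType) (V : lmodType R[i]) (H : set V)
    (ip : V -> V -> R[i]) : Prop :=
  [/\ subspace H, sesquilinear_on H ip,
      (forall u, H u -> u != 0 -> 0 < ip u u)
    & forall u : nat -> V, (forall n, H (u n)) ->
        (forall eps : R[i], 0 < eps -> exists n0 : nat, forall m n,
           (n0 <= m)%N -> (n0 <= n)%N -> ip (u m - u n) (u m - u n) < eps) ->
        exists2 l, H l & forall eps : R[i], 0 < eps -> exists n0 : nat,
          forall n, (n0 <= n)%N -> ip (u n - l) (u n - l) < eps].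

Definition finite_dim (R : realType) (V : lmodType R[i]) (H : set V) : Prop :=
  exists (n : nat) (b : 'I_n -> V), forall u, H u ->
    exists c : 'I_n -> R[i], u = \sum_k c k *: b k.

(* Finite negative index. *)
Definition pontryagin (R : realType) (V : lmodType R[i]) (H : set V)
    (ip : V -> V -> R[i]) : Prop :=
  [/\ subspace H, sesquilinear_on H ip
    & exists Hp Hm : set V,
      [/\ Hp `<=` H /\ Hm `<=` H,
          forall u, H u -> exists up um, [/\ Hp up, Hm um & u = up + um],
          forall up um, Hp up -> Hm um -> ip up um = 0,
          hilbert Hp ip
        & hilbert Hm (fun u v => - ip u v) /\ finite_dim Hm]].

Definition reproducing_kernel (R : realType) (p : nat) (D : set R[i])
    (H : set (R[i] -> 'cV[R[i]]_p))
    (ip : (R[i] -> 'cV[R[i]]_p) -> (R[i] -> 'cV[R[i]]_p) -> R[i])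
    (K : R[i] -> R[i] -> 'M[R[i]]_p) : Prop :=
  forall (w : R[i]) (c : 'cV[R[i]]_p), D w ->
    H (on_domain D (fun z => K z w *m c)) /\
    forall f, H f ->
      ip f (on_domain D (fun z => K z w *m c)) = (adjmx c *m f w) 0 0.

(* Main.v *)
From HB Require Import structures.
Require Import Defs.
From mathcomp Require Import all_boot all_order all_algebra.
From mathcomp Require Import all_classical all_reals all_analysis.
From mathcomp Require Import complex mxtens.
From mathcomp Require Import ring lra.
Import Order.TTheory GRing.Theory Num.Theory.
Import numFieldNormedType.Exports.
Local Open Scope classical_set_scope.
Local Open Scope ring_scope.

Set Implicit Arguments.
Unset Strict Implicit.
Unset Printing Implicit Defensive.

(** Why the theorem holds.  A function f = (Z_r (x) I) F(r) and the vectors F(a)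
    determine each other: the basis functions are ratios T / Q with deg T < N,
    so they are independent on the N roots of r = a for a in Omega, and F(a) is
    recovered by interpolation (vdm_unit, evl_spec, evl_uniq).  Lagrange
    interpolation (ZI_lagrange) turns R_a into the backward shift
    F |-> (F - F(a)) / (z - a), with Z_r (x) I factored out
    (resolvent_formulaE), and the double sum of condition (1) into
    (a - b^* )^-1 G(b)^* X F(a) (rhs_sum).  In terms of F, the statement is
    therefore about the ordinary backward shift on the open set
    B = Omega /\ A, which contains real points as close to 0 as desired.

    From (1) to (2).  Fix a real b in B and any a in B other than b.  The vector
    f - (a - b) R_b f has R_a-image R_b f and value F(b) at a, so (1) for the
    pair (a, b) yields
      [R_b f, g] - [f, R_b g] = i G(b)^* X F(b)       (real_identity).
    With g the kernel function at w, this expresses the kernel function at w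
    through the one at b (kernel_vector); eliminating the values of R_b gives
    (2) with Theta(l) = X^-1 + i (l - b) M(l), where (Z_r (x) I) M(r) is the
    kernel function at b (kernel_of_resolvent).

    From (2) to (1).  The form of the kernel gives R_a in closed form on kernel
    functions, and the identity of (1) holds for these (isR_k, Rid_k).  The
    question is whether R_a is defined on the whole space; everything is
    measured in a Hilbert norm q attached to a fundamental decomposition.
    - When a and a^* lie in B and a is not real, the identity at the pair (a, a)
      controls the indefinite square of R_a f.  The negative part, to be added,
      is finite-dimensional, and is seen through finitely many vectors of the
      kernel span, whose pairings with R_a f are known.  The result is a bound
      O(1 / |Im a|) on R_a (R_bound), which therefore extends from the dense
      span of the kernel functions (R_extend).
    - At a real point b this bound is lost.  For f and g in the kernel span,
      [R_z f, g] is holomorphic in z near b, and on the circle |z - b|^2 = e the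
      factor (z - b)^2 - e has modulus 2 |z - b| |Im z|, which compensates the
      growth of R_z.  The maximum principle then bounds [R_b f, g] by the norms
      of f and g (R_real_span), so that R_b is bounded on a dense subspace.
    - The set A need not be symmetric.  At any other nonreal a in B, the
      resolvent identity reduces the existence of R_a to the surjectivity of
      R_b - (a - b)^-1 for a real b.  Composed with the fundamental symmetry,
      R_b is symmetric up to finite rank, and the Fredholm alternative applies
      (R_nonreal_all).
    The identity at an arbitrary pair (a, c) then follows from the one at b by
    the substitution f |-> f + (a - b) R_a f, the inverse of the one used
    above (Rid_all). *)


(** * Complex differentiability *)

(** The squared modulus, as a real number.  It is locked because rewriting with
    distributivity would otherwise look through it. *)
HB.lock Definition nsq (R : realType) (x : R[i]) : R :=
  complex.Re x ^+ 2 + complex.Im x ^+ 2.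

Section ComplexTopology.
Variable R : realType.
Local Notation C := (R[i]).

Lemma nsq_def (x : C) : nsq x = complex.Re x ^+ 2 + complex.Im x ^+ 2.
Proof. by rewrite nsq.unlock. Qed.

Lemma conj_realC (t : R) : ((t%:C)%C)^* = (t%:C)%C :> C.
Proof. exact: conjc_real. Qed.

Lemma nsqE (x : C) : ((nsq x)%:C)%C = x * x^*.
Proof. by rewrite nsq_def add_Re2_Im2 sqr_normc. Qed.

Lemma nsq_ge0 (x : C) : 0 <= nsq x.
Proof. by rewrite nsq_def addr_ge0 ?sqr_ge0. Qed.

Lemma nsqM (x y : C) : nsq (x * y) = nsq x * nsq y.
Proof. by case: x y => [a b] [c d]; rewrite !nsq_def /=; ring. Qed.

Lemma nsqN (x : C) : nsq (- x) = nsq x.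
Proof. by case: x => [a b]; rewrite !nsq_def /=; ring. Qed.

Lemma nsq_conj (x : C) : nsq x^* = nsq x.
Proof. by case: x => [a b]; rewrite !nsq_def /=; ring. Qed.

Lemma nsq0 : nsq (0 : C) = 0.
Proof. by rewrite !nsq_def /= !expr0n addr0. Qed.

Lemma nsq1 : nsq (1 : C) = 1.
Proof. by rewrite !nsq_def /= !expr0n expr1n addr0. Qed.

Lemma nsq_eq0 (x : C) : (nsq x == 0) = (x == 0).
Proof.
case: x => [a b]; rewrite !nsq_def /= paddr_eq0 ?sqr_ge0 // !sqrf_eq0.
by rewrite eq_complex.
Qed.

Lemma nsq_gt0 (x : C) : (0 < nsq x) = (x != 0).
Proof. by rewrite lt_def nsq_eq0 nsq_ge0 andbT. Qed.

Lemma nsqV (x : C) : nsq x^-1 = (nsq x)^-1.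
Proof.
have [->|x0] := eqVneq x 0; first by rewrite invr0 nsq0 invr0.
have h : nsq x * nsq x^-1 = 1 by rewrite -nsqM divff // nsq1.
have nx : nsq x != 0 by rewrite nsq_eq0.
by apply: (mulfI nx); rewrite h divff.
Qed.

Lemma nsq_real (a : R) : nsq (a%:C)%C = a ^+ 2.
Proof. by rewrite !nsq_def /= expr0n addr0. Qed.

Lemma nsqD_le (x y : C) : nsq (x + y) <= 2 * (nsq x + nsq y).
Proof.
case: x y => [a b] [c d]; rewrite !nsq_def /=.
by have := sqr_ge0 (a - c); have := sqr_ge0 (b - d); nra.
Qed.

Lemma nsq_sum_le (I : Type) (r : seq I) (F : I -> C) :
  nsq (\sum_(i <- r) F i) <= 2 ^+ size r * \sum_(i <- r) nsq (F i).
Proof.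
elim: r => [|x r ih]; first by rewrite !big_nil nsq0 mulr0.
rewrite !big_cons /= exprS; apply: le_trans (nsqD_le _ _) _.
have s0 : 0 <= \sum_(i <- r) nsq (F i) by apply: sumr_ge0 => i _; exact: nsq_ge0.
have p1 : 1 <= 2 ^+ size r :> R by rewrite exprn_ege1 // ler1n.
have := nsq_ge0 (F x); move: ih p1 s0.
set a := nsq (\sum_(_ <- _) _); set t := 2 ^+ _; set b := \sum_(_ <- _) _.
set c := nsq _; move=> ih p1 s0 c0.
have : c <= t * c by rewrite ler_peMl.
by nra.
Qed.

Lemma Re_sqr_le (x : C) : complex.Re x ^+ 2 <= nsq x.
Proof. by rewrite !nsq_def lerDl sqr_ge0. Qed.

Lemma Im_sqr_le (x : C) : complex.Im x ^+ 2 <= nsq x.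
Proof. by rewrite !nsq_def lerDr sqr_ge0. Qed.

Lemma normE (x : C) : `|x| = ((Num.sqrt (nsq x))%:C)%C.
Proof. by rewrite normc_def nsq_def. Qed.

Lemma norm_nsq_lt (x : C) (e : R) : 0 < e ->
  (`|x| < (e%:C)%C) = (nsq x < e ^+ 2).
Proof.
move=> e0; by rewrite normE ltcR -{1}(gtr0_norm e0) -sqrtr_sqr ltr_sqrt ?exprn_gt0.
Qed.

Lemma gt0_real (e : C) : 0 < e -> exists2 d : R, 0 < d & e = (d%:C)%C.
Proof.
case: e => a b; rewrite ltcE /= => /andP[/eqP -> a0]; by exists a.
Qed.

Lemma nbhs_nsq (z : C) (P : C -> Prop) :
  (\forall y \near (z : C^o), P y) <->
  exists2 e : R, 0 < e & forall y, nsq (y - z) < e -> P y.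
Proof.
split.
  move=> /nbhs_ballP [e /= e0 he]; have [d d0 ed] := gt0_real e0.
  exists (d ^+ 2); first exact: exprn_gt0.
  move=> y hy; apply: he; rewrite -ball_normE /= ed distrC norm_nsq_lt //.
move=> [e e0 he]; apply/nbhs_ballP; exists (((Num.sqrt e)%:C)%C) => /=.
  by rewrite ltcR sqrtr_gt0.
move=> y; rewrite -ball_normE /= distrC norm_nsq_lt ?sqrtr_gt0 // sqr_sqrtr ?ltW //.
exact: he.
Qed.

(** Continuity at a point, for the norm topology.  It is wrapped in a record so
    that unification never unfolds it down to filters. *)
Record ccont (h : C -> C) (z : C) : Prop := Ccont {
  ccont_cvg : (h : C^o -> C^o) y @[y --> (z : C^o)] --> (h z : C^o) }.

Lemma ccontP (h : C -> C) z : ccont h z <->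
  forall e : R, 0 < e -> \forall y \near (z : C^o), nsq (h y - h z) < e.
Proof.
split=> [[hc] e e0|H].
  by apply: (hc (fun y => nsq (y - h z) < e)); apply/nbhs_nsq; exists e.
split=> A /nbhs_nsq[e e0 he].
have := H _ e0; apply: filterS => y; exact: he.
Qed.

Lemma ccont_cst c z : ccont (fun=> c) z.
Proof. by apply/ccontP => e e0; apply/nbhs_nsq; exists 1 => // y _; rewrite subrr nsq0. Qed.

Lemma ccont_id z : ccont id z.
Proof. by apply/ccontP => e e0; apply/nbhs_nsq; exists e. Qed.

Lemma ccontD f g z : ccont f z -> ccont g z -> ccont (fun y => f y + g y) z.
Proof.
move=> /ccontP hf /ccontP hg; apply/ccontP => e e0.
have e4 : 0 < e / 4 by rewrite divr_gt0.
apply: filterS2 (hf _ e4) (hg _ e4) => y h1 h2.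
have -> : f y + g y - (f z + g z) = (f y - f z) + (g y - g z) by ring.
by apply: le_lt_trans (nsqD_le _ _) _; lra.
Qed.

Lemma ccontN f z : ccont f z -> ccont (fun y => - f y) z.
Proof.
move=> /ccontP hf; apply/ccontP => e e0; apply: filterS (hf _ e0) => y.
by rewrite -opprD nsqN.
Qed.

Lemma ccontB f g z : ccont f z -> ccont g z -> ccont (fun y => f y - g y) z.
Proof. by move=> hf hg; apply: ccontD => //; apply: ccontN. Qed.

Lemma ccontM f g z : ccont f z -> ccont g z -> ccont (fun y => f y * g y) z.
Proof.
move=> /ccontP hf /ccontP hg; apply/ccontP => e e0.
have F0 := nsq_ge0 (f z); have G0 := nsq_ge0 (g z).
set F := nsq (f z) in F0; set G := nsq (g z) in G0.
have K0 : 0 < 8 * (1 + F + G) by rewrite mulr_gt0 // -addrA ltr_pwDl // addr_ge0.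
pose d := Num.min 1 (e / (8 * (1 + F + G))).
have d0 : 0 < d by rewrite lt_min ltr01 divr_gt0.
apply: filterS2 (hf _ d0) (hg _ d0) => y h1 h2.
have -> : f y * g y - f z * g z =
  ((f y - f z) * (g y - g z) + (f y - f z) * g z) + f z * (g y - g z) by ring.
apply: le_lt_trans (nsqD_le _ _) _.
have := nsqD_le ((f y - f z) * (g y - g z)) ((f y - f z) * g z).
rewrite !nsqM -/F -/G; set S := nsq (_ + _); set A := nsq (f y - f z) in h1 *.
set B := nsq (g y - g z) in h2 *.
have A0 : 0 <= A := nsq_ge0 _; have B0 : 0 <= B := nsq_ge0 _.
have d1 : d <= 1 by rewrite ge_min lexx.
have de : d * (8 * (1 + F + G)) <= e by rewrite -ler_pdivlMr // ge_min lexx orbT.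
have : A * B <= d by apply: (le_trans (y := d * B)); [rewrite ler_wpM2r // ltW|rewrite ler_piMr ?ltW // (lt_le_trans h2)].
have : A * G <= d * G by rewrite ler_wpM2r // ltW.
have : F * B <= d * F by rewrite mulrC ler_wpM2r // ltW.
have : 0 <= d * F by rewrite mulr_ge0 // ltW.
have : 0 <= d * G by rewrite mulr_ge0 // ltW.
by move: de; rewrite !mulrDr; clearbody S; lra.
Qed.

Lemma ccontV f z : f z != 0 -> ccont f z -> ccont (fun y => (f y)^-1) z.
Proof.
rewrite -nsq_gt0 => F0 /ccontP hf; apply/ccontP => e e0.
set F := nsq (f z) in F0.
pose d := Num.min (F / 4) (e * (F / 4 * F)).
have d0 : 0 < d by rewrite lt_min !(mulr_gt0, invr_gt0).
apply: filterS (hf _ d0) => y; rewrite lt_min => /andP[h1 h2].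
have fy : F / 4 <= nsq (f y).
  have : F <= 2 * (nsq (f y) + nsq (f y - f z)).
    by rewrite -[nsq (f y - _)]nsqN /F -{1}(subrK (f y) (f z)) opprB addrC nsqD_le.
  lra.
have fy0 : 0 < nsq (f y) by apply: lt_le_trans fy; rewrite divr_gt0.
have -> : (f y)^-1 - (f z)^-1 = - (f y - f z) / (f y * f z).
  by field; rewrite -nsq_gt0 F0 -nsq_gt0 fy0.
rewrite nsqM nsqN nsqV nsqM ltr_pdivrMr ?mulr_gt0 //.
apply: lt_le_trans h2 _; rewrite ler_pM2l // ler_pM2r //.
Qed.

Lemma ccont_comp f g z : ccont f z -> ccont g (f z) -> ccont (fun y => g (f y)) z.
Proof.
move=> [hf] /ccontP hg; apply/ccontP => e e0.
exact: (hf (fun y => nsq (g y - g (f z)) < e) (hg _ e0)).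
Qed.

Lemma ccont_sum (I : Type) (r : seq I) (f : I -> C -> C) z :
  (forall i, ccont (f i) z) -> ccont (fun y => \sum_(i <- r) f i y) z.
Proof.
move=> H; elim: r => [|x r ih].
  rewrite (_ : (fun _ => _) = fun=> 0); first exact: ccont_cst.
  by apply/funext => y; rewrite big_nil.
rewrite (_ : (fun _ => _) = fun y => f x y + \sum_(i <- r) f i y).
  exact: ccontD.
by apply/funext => y; rewrite big_cons.
Qed.

Lemma ccont_conj z : ccont Num.conj z.
Proof.
apply/ccontP => e e0; apply/nbhs_nsq; exists e => // y.
by rewrite -rmorphB nsq_conj.
Qed.

Lemma ccont_horner (p : {poly C}) z : ccont (fun y => p.[y]) z.
Proof.
elim/poly_ind: p => [|p c ih].
  rewrite (_ : (fun _ => _) = fun=> 0); first exact: ccont_cst.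
  by apply/funext => y; rewrite horner0.
rewrite (_ : (fun _ => _) = fun y => p.[y] * y + c).
  apply: (@ccontD (fun y => p.[y] * y) (fun=> c)); last exact: ccont_cst.
  by apply: ccontM => //; apply: ccont_id.
by apply/funext => y; rewrite !hornerE.
Qed.

Lemma near_neq (c z : C) : z != c -> \forall y \near (z : C^o), y != c.
Proof.
move=> zc; apply/nbhs_nsq; exists (nsq (c - z)).
  by rewrite nsq_gt0 subr_eq0 eq_sym.
by move=> y; apply: contraTneq => ->; rewrite ltxx.
Qed.

Lemma ccont_neq (h : C -> C) z c : ccont h z -> h z != c ->
  \forall y \near (z : C^o), h y != c.
Proof. by move=> [hc] hz; apply: (hc (fun y => y != c)); exact: near_neq. Qed.

Lemma ccont_eq_lim (f g : C -> C) z : ccont f z -> ccont g z ->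
  (forall d : R, 0 < d -> exists2 y, nsq (y - z) < d & f y = g y) -> f z = g z.
Proof.
move=> hf hg H; apply/eqP; rewrite -subr_eq0; apply/negPn/negP => h0.
have /nbhs_nsq[d d0 hd] := ccont_neq (ccontB hf hg) h0.
by have [y yz fg] := H _ d0; move: (hd _ yz); rewrite fg subrr eqxx.
Qed.

Lemma ccont_eq_near (f g : C -> C) z : ccont f z ->
  (\forall y \near (z : C^o), f y = g y) -> ccont g z.
Proof.
move=> /ccontP hf /[dup] /nbhs_nsq[d d0 hd] fg; apply/ccontP => e e0.
have fgz : f z = g z by apply: hd; rewrite subrr nsq0.
apply: filterS2 (hf _ e0) fg => y h1 h2; by rewrite -fgz -h2.
Qed.

(** Caratheodory's form of complex differentiability: no limit of quotients
    appears, so the rules of calculus become identities between the slopes q. *)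
Variant has_cderiv (h : C -> C) (z d : C) : Prop :=
  HasCderiv q of ccont q z & q z = d & forall y, h y = h z + (y - z) * q y.

Variant cdiff (h : C -> C) (z : C) : Prop := Cdiff d of has_cderiv h z d.

Lemma has_cderivP (h : C -> C) z d :
  has_cderiv h z d <->
  ((fun y : C^o => y^-1 *: (h (y + z) - h z : C^o)) @ (0 : C^o)^' --> (d : C^o)).
Proof.
split.
  move=> [q qc qz hq]; rewrite -qz.
  apply: (@cvg_trans _ ((fun y : C^o => (q (y + z) : C^o)) @ (0:C^o)^')).
    apply: near_eq_cvg; rewrite /= /dnbhs; near=> y.
    have y0 : y != 0 by near: y; exact: withinT.
    by rewrite hq [h z + _]addrC !addrK /GRing.scale /= mulrA mulVf // mul1r.
  apply: cvg_within_filter.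
  have h0 : ccont (fun y => q (y + z)) 0.
    apply: ccont_comp; first by apply: ccontD; [exact: ccont_id|exact: ccont_cst].
    by rewrite add0r.
  by have [] := h0; rewrite add0r.
move=> H; exists (fun y => if y == z then d else (h y - h z) / (y - z)).
- apply/ccontP => e e0; rewrite eqxx.
  have /H : nbhs (d : C^o) (fun y => nsq (y - d) < e) by apply/nbhs_nsq; exists e.
  rewrite /= /dnbhs /within /= => /nbhs_nsq [r r0 hr].
  apply/nbhs_nsq; exists r => // y yz.
  have [_|ny] := eqVneq y z; first by rewrite subrr nsq0.
  have := hr (y - z); rewrite subr0 subr_eq0 => /(_ yz ny).
  by rewrite /= [y - z + z](@subrK C) /GRing.scale /= mulrC.
- by rewrite eqxx.
- move=> y; have [->|ny] := eqVneq y z; first by rewrite subrr mul0r addr0.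
  by rewrite mulrC divfK ?subr_eq0 // addrC subrK.
Unshelve. all: by end_near. Qed.

Lemma has_cderiv_cderiv h z d : has_cderiv h z d -> cderiv h z = d.
Proof.
move=> /has_cderivP H; rewrite /cderiv /derive1.
by apply: (@cvg_lim C^o _ _ _ _ _ _ H); apply: norm_hausdorff.
Qed.

Lemma cdiffP h z : cderivable h z <-> cdiff h z.
Proof.
split.
  move=> H; apply: (@Cdiff _ _ (cderiv h z)); apply/has_cderivP.
  rewrite /cderiv derive1E /derive.
  apply: (@cvg_trans _ ((fun h0 : C^o => h0^-1 *: (((h : C^o -> C^o) \o shift (z : C^o)) (h0 *: (1 : C^o)) - (h : C^o -> C^o) z)) @ (0:C^o)^')); last exact: H.
  apply: near_eq_cvg; near=> y => /=.
  by rewrite [y%:A](mulr1).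
move=> [d /has_cderivP H]; apply/cvg_ex; exists (d : C^o).
apply: cvg_trans H; apply: near_eq_cvg; near=> y => /=.
by rewrite [y%:A](mulr1).
Unshelve. all: by end_near. Qed.

Lemma cdiff_ccont (h : C -> C) z : cdiff h z -> ccont h z.
Proof.
move=> [_ [q qc _ hq]].
have -> : h = fun y => h z + (y - z) * q y by apply/funext.
apply: ccontD; first exact: ccont_cst.
by apply: ccontM => //; apply: ccontB; [exact: ccont_id|exact: ccont_cst].
Qed.

Lemma cdiff_cst (c z : C) : cdiff (fun=> c) z.
Proof.
apply: (@Cdiff _ _ 0); exists (fun=> 0) => //.
  exact: ccont_cst.
by move=> y; rewrite mulr0 addr0.
Qed.

Lemma cdiff_id (z : C) : cdiff id z.
Proof.
apply: (@Cdiff _ _ 1); exists (fun=> 1) => //.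
  exact: ccont_cst.
by move=> y; rewrite mulr1 addrC subrK.
Qed.

Lemma cdiffD (f g : C -> C) z :
  cdiff f z -> cdiff g z -> cdiff (fun y => f y + g y) z.
Proof.
move=> [_ [p pc _ hp]] [_ [q qc _ hq]].
apply: (@Cdiff _ _ (p z + q z)).
exists (fun y => p y + q y) => //; first exact: ccontD.
by move=> y; rewrite hp hq; ring.
Qed.

Lemma has_cderivM (f g : C -> C) z a b :
  has_cderiv f z a -> has_cderiv g z b ->
  has_cderiv (fun y => f y * g y) z (a * g z + f z * b).
Proof.
move=> fa gb; have gc := cdiff_ccont (Cdiff gb).
have [p pc pz hp] := fa; have [q qc qz hq] := gb.
exists (fun y => p y * g y + f z * q y).
- apply: ccontD; first exact: ccontM.
  by apply: (@ccontM (fun=> f z)) => //; exact: ccont_cst.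
- by rewrite pz qz.
- by move=> y; rewrite hp [in LHS]hq [in RHS](hq y); ring.
Qed.

Lemma cdiffM (f g : C -> C) z :
  cdiff f z -> cdiff g z -> cdiff (fun y => f y * g y) z.
Proof.
move=> [a hf] [b hg].
exact: Cdiff (has_cderivM hf hg).
Qed.

Lemma cdiffB (f g : C -> C) z :
  cdiff f z -> cdiff g z -> cdiff (fun y => f y - g y) z.
Proof.
move=> hf hg; apply: cdiffD => //.
rewrite (_ : (fun y => - g y) = fun y => -1 * g y).
  by apply: cdiffM => //; exact: cdiff_cst.
by apply/funext => y; rewrite mulN1r.
Qed.

Lemma cdiff_sum (I : Type) (r : seq I) (f : I -> C -> C) z :
  (forall i, cdiff (f i) z) -> cdiff (fun y => \sum_(i <- r) f i y) z.
Proof.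
move=> H; elim: r => [|x r ih].
  rewrite (_ : (fun _ => _) = fun=> 0); first exact: cdiff_cst.
  by apply/funext => y; rewrite big_nil.
rewrite (_ : (fun _ => _) = fun y => f x y + \sum_(i <- r) f i y).
  exact: cdiffD.
by apply/funext => y; rewrite big_cons.
Qed.

Lemma has_cderivV f z d : f z != 0 -> has_cderiv f z d ->
  has_cderiv (fun y => (f y)^-1) z (- d / f z ^+ 2).
Proof.
move=> f0 fd; have fc := cdiff_ccont (Cdiff fd).
have [q qc qz hq] := fd.
pose q' y := if f y == 0 then - (f z)^-1 / (y - z) else - q y / (f y * f z).
exists q'; last 2 first.
- by rewrite /q' (negPf f0) qz expr2.
- move=> y; rewrite /q'; have [fy0|fy0] := eqVneq (f y) 0.
    have yz : y - z != 0.
      by rewrite subr_eq0; apply: contraNneq f0 => <-; apply/eqP.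
    by rewrite fy0 invr0; field; rewrite f0 yz.
  have e : (y - z) * q y = f y - f z by rewrite [f y]hq; ring.
  rewrite mulrA mulrN e; field; by rewrite fy0 f0.
have hc : ccont (fun y => - q y / (f y * f z)) z.
  apply: ccontM; first exact: ccontN.
  by apply: ccontV; [rewrite mulf_neq0|apply: ccontM => //; exact: ccont_cst].
apply: ccont_eq_near hc _; apply: filterS (ccont_neq fc f0) => y fy.
by rewrite /q' (negPf fy).
Qed.

Lemma cdiffV (f : C -> C) z : f z != 0 -> cdiff f z ->
  cdiff (fun y => (f y)^-1) z.
Proof.
move=> f0 [d fd].
exact: Cdiff (has_cderivV f0 fd).
Qed.

Lemma cdiff_near (h g : C -> C) z : cdiff h z ->
  (\forall y \near (z : C^o), h y = g y) -> cdiff g z.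
Proof.
move=> [l [q qc qz hq]] /[dup] /nbhs_nsq[d d0 hd] hg.
have hz : h z = g z by apply: hd; rewrite subrr nsq0.
pose q' y := if h y == g y then q y else (g y - g z) / (y - z).
apply: (@Cdiff _ _ (q z)); exists q'.
- by apply: ccont_eq_near qc _; apply: filterS hg => y hy; rewrite /q' hy eqxx.
- by rewrite /q' hz eqxx.
- move=> y; rewrite /q'; have [<-|ny] := eqVneq (h y) (g y); first by rewrite -hz.
  have yz : y - z != 0 by rewrite subr_eq0; apply: contraNneq ny => ->; apply/eqP.
  by field.
Qed.

Lemma has_cderiv_horner (p : {poly C}) z : has_cderiv (fun y => p.[y]) z p^`().[z].
Proof.
have /factor_theorem[q hq] : root (p - p.[z]%:P) z.
  by rewrite rootE !hornerE subrr.
have pe : p = q * ('X - z%:P) + p.[z]%:P by rewrite -hq subrK.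
exists (fun y => q.[y]).
- exact: ccont_horner.
- by rewrite {1}pe derivD derivM derivB derivX !derivC subr0 mulr1 addr0 !hornerE subrr mulr0 add0r.
- move=> y; rewrite {1}pe !hornerE; ring.
Qed.

End ComplexTopology.

(** * The maximum principle *)

Section MaxPrinciple.
Variable R : realType.
Local Notation C := (R[i]).

Lemma nsq_continuous (z : C) : {for z, continuous (fun y : C^o => nsq (y : C) : R)}.
Proof.
have key (f : C -> R) : (forall y, (f z - f y) ^+ 2 <= nsq (y - z)) ->
    {for z, continuous (f : C^o -> R)}.
  move=> hf A /nbhs_ballP[e /= e0 he]; apply/nbhs_nsq; exists (e ^+ 2).
    exact: exprn_gt0.
  move=> y hy; apply: he; rewrite /ball /=.
  rewrite -ltr_sqr ?nnegrE ?normr_ge0 ?(ltW e0) // real_normK ?num_real //.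
  exact: le_lt_trans hy.
have ReC : {for z, continuous (fun y : C^o => complex.Re (y : C) : R)}.
  by apply: key => y; case: (z) (y) => [a b] [c d]; rewrite nsq_def /= -sqrrN opprB lerDl sqr_ge0.
have ImC : {for z, continuous (fun y : C^o => complex.Im (y : C) : R)}.
  by apply: key => y; case: (z) (y) => [a b] [c d]; rewrite nsq_def /= -sqrrN opprB lerDr sqr_ge0.
rewrite (_ : (fun y : C^o => _) =
  (fun y : C^o => complex.Re (y : C) * complex.Re (y : C) + complex.Im (y : C) * complex.Im (y : C))); last first.
  by apply/funext => y; rewrite nsq_def !expr2.
exact: (cvgD (cvgM ReC ReC) (cvgM ImC ImC)).
Qed.

Lemma nsq_comp_continuous (h : C -> C) z : ccont h z ->
  {for z, continuous (fun y : C^o => nsq (h y) : R)}.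
Proof.
move=> [hc] A hA; exact: (hc (fun y => A (nsq y)) (@nsq_continuous (h z) A hA)).
Qed.

Lemma nsq_sub_continuous (b z : C) :
  {for z, continuous (fun y : C^o => nsq ((y : C) - b) : R)}.
Proof.
apply: (@nsq_comp_continuous (fun y => y - b) z).
by apply: ccontB; [exact: ccont_id|exact: ccont_cst].
Qed.

Lemma closed_disc (b : C) (e : R) : closed [set z : C^o | nsq ((z : C) - b) <= e].
Proof.
apply: (@closed_comp C^o R (fun z => nsq ((z : C) - b)) [set x | x <= e]).
  by move=> z _; exact: (@nsq_sub_continuous b z).
exact: closed_le.
Qed.

Lemma closed_circle (b : C) (e : R) : closed [set z : C^o | nsq ((z : C) - b) = e].
Proof.
apply: (@closed_comp C^o R (fun z => nsq ((z : C) - b)) [set x | x = e]).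
  by move=> z _; exact: (@nsq_sub_continuous b z).
exact: closed_eq.
Qed.

Lemma square_compact (M : R) :
  compact [set z : C^o | `|complex.Re (z : C)| <= M /\ `|complex.Im (z : C)| <= M].
Proof.
have -> : [set z : C^o | `|complex.Re (z : C)| <= M /\ `|complex.Im (z : C)| <= M] =
    (fun x : R * R => (Complex x.1 x.2 : C^o)) @` (`[- M, M] `*` `[- M, M]).
  apply/seteqP; split => [[a b] /= [ha hb]|_ [[a b] /= [ha hb] <-] /=].
    by exists (a, b) => //=; split; rewrite in_itv /= -ler_norml.
  by move: ha hb; rewrite !in_itv /= -!ler_norml.
apply: continuous_compact; last exact: compact_setX (@segment_compact _ _ _) (@segment_compact _ _ _).
apply: continuous_subspaceT => -[a b] A /nbhs_nsq[e e0 he] /=.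
have e2 : 0 < Num.sqrt (e / 2) by rewrite sqrtr_gt0 divr_gt0.
exists (ball a (Num.sqrt (e / 2)), ball b (Num.sqrt (e / 2))) => /=.
  by split; exact: nbhsx_ballx.
move=> [c d] /= []; rewrite /ball /= => hc hd; apply: he.
rewrite !nsq_def /= [ltRHS](splitr e) -(@sqr_sqrtr _ (e / 2)) ?divr_ge0 ?(ltW e0) //.
by apply: ltrD; rewrite -real_normK ?num_real // ltr_sqr ?nnegrE ?(ltW e2) // distrC.
Qed.

Lemma disc_compact (b : C) (e : R) : compact [set z : C^o | nsq ((z : C) - b) <= e].
Proof.
pose M := 1 + e + nsq b + nsq b + e.
apply: (subclosed_compact _ (@square_compact M)); first exact: closed_disc.
move=> z /= hz.
have hn : nsq z <= 2 * (e + nsq b).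
  rewrite -(subrK b z); apply: le_trans (nsqD_le _ _) _.
  by rewrite ler_pM2l ?ltr0n // lerD2r.
have b0 := nsq_ge0 b; have e0 : 0 <= e := le_trans (nsq_ge0 _) hz.
have key (x : R) : x ^+ 2 <= nsq z -> `|x| <= M.
  move=> hx; rewrite ler_norml /M; apply/andP; split; nra.
by split; apply: key; [exact: Re_sqr_le|exact: Im_sqr_le].
Qed.

Lemma circle_compact (b : C) (e : R) : compact [set z : C^o | nsq ((z : C) - b) = e].
Proof.
apply: (subclosed_compact _ (@disc_compact b e)); first exact: closed_circle.
by move=> z /= ->.
Qed.

Lemma compact_nsq_bounded (K : set C) (h : C -> C) :
  compact (K : set C^o) -> (forall z, K z -> ccont h z) ->
  exists M : R, forall z, K z -> nsq (h z) <= M.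
Proof.
move=> cK hc.
have [K0|/set0P/negP/negPn/eqP K0] := pselect (K !=set0); last first.
  by exists 0 => z; rewrite K0.
have [|c _ hcm] := @compact_EVT_max C^o R (fun z => nsq (h z)) K K0 cK.
  apply: continuous_in_subspaceT => z; rewrite inE => /hc.
  exact: (@nsq_comp_continuous h z).
by exists (nsq (h c)) => z Kz; apply: hcm; rewrite inE.
Qed.

(** Second-order differentiability in the sense of Peano.  It is all that the
    maximum principle requires, and it comes for free for values of resolvents,
    whose difference quotients are again values of resolvents. *)
Definition cderiv2 (phi : C -> C) (z : C) :=
  exists q : C -> C, cdiff q z /\
    \forall y \near (z : C^o), phi y = phi z + (y - z) * q y.

Lemma cderiv2_cdiff phi z : cderiv2 phi z -> cdiff phi z.
Proof.
move=> [q [qd hq]].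
apply: (@cdiff_near _ (fun y => phi z + (y - z) * q y)); last first.
  by apply: filterS hq => y ->.
apply: cdiffD; first exact: cdiff_cst.
apply: cdiffM => //; apply: cdiffB; first exact: cdiff_id.
exact: cdiff_cst.
Qed.

Lemma cderiv2_cst c z : cderiv2 (fun=> c) z.
Proof.
exists (fun=> 0); split; first exact: cdiff_cst.
by apply/nbhs_nsq; exists 1 => // y _; rewrite mulr0 addr0.
Qed.

Lemma cderiv2_id z : cderiv2 id z.
Proof.
exists (fun=> 1); split; first exact: cdiff_cst.
by apply/nbhs_nsq; exists 1 => // y _; rewrite mulr1 addrC subrK.
Qed.

Lemma cderiv2D f g z : cderiv2 f z -> cderiv2 g z -> cderiv2 (fun y => f y + g y) z.
Proof.
move=> [p [pd hp]] [q [qd hq]]; exists (fun y => p y + q y); split.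
  exact: cdiffD.
by apply: filterS2 hp hq => y -> ->; ring.
Qed.

Lemma cderiv2M f g z : cderiv2 f z -> cderiv2 g z -> cderiv2 (fun y => f y * g y) z.
Proof.
move=> cf cg; have [p [pd hp]] := cf; have [q [qd hq]] := cg.
exists (fun y => p y * g y + f z * q y); split.
  apply: cdiffD; apply: cdiffM => //; last exact: cdiff_cst.
  exact: cderiv2_cdiff.
by apply: filterS2 hp hq => y hpy hqy; rewrite hpy [in LHS]hqy [in RHS]hqy; ring.
Qed.

Lemma cderiv2_inv_sub c z : z != c -> cderiv2 (fun y => (c - y)^-1) z.
Proof.
move=> zc; have cz : c - z != 0 by rewrite subr_eq0 eq_sym.
exists (fun y => (c - y)^-1 / (c - z)); split.
  apply: cdiffM; last exact: cdiff_cst.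
  apply: (@cdiffV _ (fun y => c - y)) => //.
  by apply: cdiffB; [exact: cdiff_cst|exact: cdiff_id].
apply: filterS (near_neq zc) => y yc.
have cy : c - y != 0 by rewrite subr_eq0 eq_sym.
by field; rewrite cy cz.
Qed.

(** The function |psi|^2 + eta |z - b|^2 has no local maximum: summed over the
    four increments t, - t, i t, - i t, the mixed terms of the Taylor expansion
    of psi cancel, and what remains is positive, of order eta t^2. *)
Lemma four_point (psi : C -> C) (b z : C) (eta d : R) :
  cderiv2 psi z -> 0 < eta -> 0 < d ->
  exists2 y, nsq (y - z) < d &
    nsq (psi z) + eta * nsq (z - b) < nsq (psi y) + eta * nsq (y - b).
Proof.
move=> [q [qd /nbhs_nsq[d1 d10 hq]]] eta0 d0.
have [q0 [p /ccontP pc pz hp]] := qd.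
pose M := 4 * (nsq (psi z) + nsq (q z) + nsq (p z)) + 1.
have M0 : 0 < M by rewrite /M ltr_pwDr // mulr_ge0 // !addr_ge0 ?nsq_ge0.
pose kap := eta / (4 * M).
have kap0 : 0 < kap by rewrite divr_gt0 // mulr_gt0.
have ke0 : 0 < kap * eta / 4 by rewrite divr_gt0 // mulr_gt0.
have /nbhs_nsq[d2 d20 hr] := pc _ ke0.
pose t2 := Num.min (Num.min (d / 2) (d1 / 2)) (Num.min (d2 / 2) 1).
have t20 : 0 < t2 by rewrite !lt_min ltr01 !divr_gt0.
have [t2d t2d1 t2d2 t21] : [/\ t2 < d, t2 < d1, t2 < d2 & t2 <= 1].
  have hm : t2 <= t2 by [].
  rewrite {2}/t2 !le_min in hm; have /andP[/andP[h1 h2] /andP[h3 h4]] := hm.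
  by split=> //; lra.
pose t := Num.sqrt t2.
have tt : t ^+ 2 = t2 by rewrite sqr_sqrtr // ltW.
(* a Taylor expansion of order two, whose remainder is absorbed by eta *)
have step (h : C) : nsq h = t2 ->
  nsq (psi z + h * q z + h ^+ 2 * p z) - t2 * eta / 2 <= nsq (psi (z + h)).
  move=> hh.
  have hz : z + h - z = h by rewrite addrC addKr.
  rewrite (hq (z + h)); last by rewrite hz hh.
  rewrite (hp (z + h)) hz.
  set r := p (z + h) - p z.
  have rr : nsq r < kap * eta / 4 by apply: hr; rewrite hz hh.
  have -> : psi z + h * (q z + h * p (z + h)) =
      (psi z + h * q z + h ^+ 2 * p z) + h ^+ 2 * r by rewrite /r; ring.
  set a := psi z + _ + _.
  have h2n x : nsq (h ^+ 2 * x) = t2 ^+ 2 * nsq x by rewrite expr2 !nsqM hh -expr2.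
  have aM : nsq a <= M.
    apply: le_trans (nsqD_le _ _) _; rewrite h2n.
    have := nsqD_le (psi z) (h * q z); rewrite [nsq (h * _)]nsqM hh.
    have := nsq_ge0 (psi z); have := nsq_ge0 (q z); have := nsq_ge0 (p z).
    rewrite /M; set A := nsq (psi z); set B := nsq (q z); set D := nsq (p z).
    move=> D0 B0 A0 h1.
    have : t2 * B <= B by rewrite ler_piMl.
    have : t2 ^+ 2 * D <= D by rewrite ler_piMl // exprn_ile1 // ltW.
    by move: h1; lra.
  have ab : nsq (a + h ^+ 2 * r) = nsq a + t2 ^+ 2 * nsq r
      + 2 * (complex.Re a * complex.Re (h ^+ 2 * r) + complex.Im a * complex.Im (h ^+ 2 * r)).
    rewrite -h2n.
    by case: (a) (h ^+ 2 * r) => [a1 a2] [b1 b2]; rewrite !nsq_def /=; ring.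
  rewrite ab.
  have bb : nsq (h ^+ 2 * r) = t2 ^+ 2 * nsq r by rewrite h2n.
  have amgm (u v : R) : - (t2 * kap * u ^+ 2 + v ^+ 2 / (t2 * kap)) <= 2 * (u * v).
    have k0 : 0 < t2 * kap by rewrite mulr_gt0.
    rewrite -subr_ge0 opprK.
    have -> : 2 * (u * v) + (t2 * kap * u ^+ 2 + v ^+ 2 / (t2 * kap)) =
      (t2 * kap * u + v) ^+ 2 / (t2 * kap) by field; rewrite ?gt_eqF.
    by rewrite divr_ge0 ?sqr_ge0 ?ltW.
  have h1 := amgm (complex.Re a) (complex.Re (h ^+ 2 * r)).
  have h2 := amgm (complex.Im a) (complex.Im (h ^+ 2 * r)).
  have h3 : t2 * kap * nsq a + nsq (h ^+ 2 * r) / (t2 * kap) <= t2 * eta / 2.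
    have -> : nsq (h ^+ 2 * r) / (t2 * kap) = t2 * (nsq r / kap).
      by rewrite bb; field; rewrite ?gt_eqF.
    have h4 : nsq r / kap <= eta / 4.
      by rewrite ler_pdivrMr // mulrC mulrA ltW.
    have h5 : kap * nsq a <= eta / 4.
      have -> : eta / 4 = kap * M by rewrite /kap; field; rewrite ?gt_eqF.
      by rewrite ler_pM2l.
    have : t2 * (nsq r / kap) <= t2 * (eta / 4) by rewrite ler_pM2l.
    have : t2 * (kap * nsq a) <= t2 * (eta / 4) by rewrite ler_pM2l.
    by rewrite !mulrA; lra.
  have h6 : 0 <= t2 ^+ 2 * nsq r by rewrite mulr_ge0 ?sqr_ge0 ?nsq_ge0.
  rewrite (nsq_def a) (nsq_def (h ^+ 2 * r)) in h3.
  clear -h1 h2 h3 h6; lra.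
apply/exists2P/not_existsP => H.
have {}H h : nsq h = t2 ->
    nsq (psi (z + h)) + eta * nsq (z + h - b) <= nsq (psi z) + eta * nsq (z - b).
  move=> hh; rewrite leNgt; apply/negP => hlt; apply: (H (z + h)); split => //.
  by rewrite addrC addKr hh.
have n1 : nsq (t%:C)%C = t2 by rewrite nsq_real.
have n2 : nsq (- (t%:C)%C) = t2 by rewrite nsqN.
have n3 : nsq (Complex 0 t) = t2 by rewrite !nsq_def /= expr0n add0r.
have n4 : nsq (- Complex 0 t) = t2 by rewrite nsqN.
have := H _ n1; have := H _ n2; have := H _ n3; have := H _ n4.
have := step _ n1; have := step _ n2; have := step _ n3; have := step _ n4.
(* the four values of h^2 cancel in pairs *)
have S1 : nsq (psi z + (t%:C)%C * q z + (t%:C)%C ^+ 2 * p z)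
  + nsq (psi z + - (t%:C)%C * q z + (- (t%:C)%C) ^+ 2 * p z)
  + nsq (psi z + Complex 0 t * q z + Complex 0 t ^+ 2 * p z)
  + nsq (psi z + - Complex 0 t * q z + (- Complex 0 t) ^+ 2 * p z)
  = 4 * (nsq (psi z) + t2 * nsq (q z) + t2 ^+ 2 * nsq (p z)).
  rewrite -tt; case: (psi z) (q z) (p z) => [a1 a2] [b1 b2] [c1 c2].
  by rewrite !expr2 !nsq_def /=; ring.
have S2 : nsq (z + (t%:C)%C - b) + nsq (z + - (t%:C)%C - b)
  + nsq (z + Complex 0 t - b) + nsq (z + - Complex 0 t - b)
  = 4 * nsq (z - b) + 4 * t2.
  by rewrite -tt; case: (z) (b) => [a1 a2] [b1 b2]; rewrite !nsq_def /=; ring.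
have S3 : 0 <= t2 * nsq (q z) by rewrite mulr_ge0 ?nsq_ge0 ?ltW.
have S4 : 0 <= t2 ^+ 2 * nsq (p z) by rewrite mulr_ge0 ?nsq_ge0 ?sqr_ge0.
have S5 : 0 < eta * t2 by rewrite mulr_gt0.
have : eta * (nsq (z + (t%:C)%C - b) + nsq (z + - (t%:C)%C - b)
  + nsq (z + Complex 0 t - b) + nsq (z + - Complex 0 t - b))
  = eta * (4 * nsq (z - b) + 4 * t2) by rewrite S2.
rewrite [t2 * eta]mulrC !mulrDr; move: S1 S3 S4 S5; clear.
lra.
Qed.

(** A violation of the bound at the centre would survive the addition of
    eta |z - b|^2 for a small eta, and the maximum of the perturbed function over
    the disc would be attained inside, against four_point. *)
Theorem max_principle (psi : C -> C) (b : C) (e M : R) :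
  0 < e ->
  (forall z, nsq (z - b) <= e -> cderiv2 psi z) ->
  (forall z, nsq (z - b) = e -> nsq (psi z) <= M) ->
  nsq (psi b) <= M.
Proof.
move=> e0 h2 hM; rewrite leNgt; apply/negP => Mlt.
pose eta := (nsq (psi b) - M) / (2 * e).
have eta0 : 0 < eta by rewrite divr_gt0 ?subr_gt0 // mulr_gt0.
pose u (z : C^o) : R := nsq (psi z) + eta * nsq ((z : C) - b).
have [||c Kc hc] := @compact_EVT_max C^o R u _ _ (@disc_compact b e).
- by exists b => /=; rewrite subrr nsq0 ltW.
- apply: continuous_in_subspaceT => z; rewrite inE /= => /h2 /cderiv2_cdiff zc.
  have h1 := @nsq_comp_continuous psi z (cdiff_ccont zc).
  have h3 : {for z, continuous (fun y : C^o => eta * nsq ((y : C) - b))}.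
    exact: (cvgM (cvg_cst _) (@nsq_sub_continuous b z)).
  exact: (cvgD h1 h3).
move: Kc; rewrite inE /= => Kc.
have ub : u b <= u c by apply: hc; rewrite inE /= subrr nsq0 ltW.
have ce : nsq (c - b) < e.
  rewrite lt_neqAle Kc andbT; apply: contraTneq ub => ce.
  rewrite -ltNge /u ce subrr nsq0 mulr0 addr0.
  have := hM _ ce.
  have -> : eta * e = (nsq (psi b) - M) / 2 by rewrite /eta; field; rewrite gt_eqF.
  by lra.
have nc : \forall y \near (c : C^o), nsq (y - b) < e.
  have cc := @nsq_sub_continuous b c.
  exact: (cc (fun y => y < e) (@open_nbhs_nbhs _ _ _ (conj (@open_lt _ e) ce))).
move/nbhs_nsq: nc => [d d0 hd].
have [y yd uy] := four_point b (h2 _ (ltW ce)) eta0 d0.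
have /hc : y \in [set z : C^o | nsq ((z : C) - b) <= e].
  by rewrite inE /=; exact: ltW (hd _ yd).
by rewrite leNgt /u uy.
Qed.

End MaxPrinciple.

(** * Hermitian forms and Hilbert spaces *)

Section Sesquilinear.
Variables (R : realType) (V : lmodType R[i]) (H : set V) (ip : V -> V -> R[i]).
Local Notation C := (R[i]).
Hypotheses (subH : Defs.subspace H) (sesq : sesquilinear_on H ip).

Lemma sub0 : H 0. Proof. by have [] := subH. Qed.
Lemma subDZ (c : C) u v : H u -> H v -> H (c *: u + v).
Proof. by have [_ h] := subH; exact: h. Qed.
Lemma subZ (c : C) u : H u -> H (c *: u).
Proof. by move=> hu; rewrite -[_ *: _]addr0; apply: subDZ => //; exact: sub0. Qed.
Lemma subD u v : H u -> H v -> H (u + v).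
Proof. by move=> hu hv; rewrite -[u]scale1r; exact: subDZ. Qed.
Lemma subN u : H u -> H (- u).
Proof. by move=> hu; rewrite -scaleN1r; exact: subZ. Qed.
Lemma subB u v : H u -> H v -> H (u - v).
Proof. by move=> hu hv; apply: subD => //; exact: subN. Qed.
Lemma sub_sum (I : eqType) (r : seq I) (F : I -> V) :
  (forall i, i \in r -> H (F i)) -> H (\sum_(i <- r) F i).
Proof.
by move=> hF; rewrite big_seq; apply: big_ind => //; [exact: sub0|exact: subD].
Qed.

Lemma ipDZl (c : C) u v w : H u -> H v -> H w -> ip (c *: u + v) w = c * ip u w + ip v w.
Proof. by move=> hu hv hw; have [h _] := sesq; exact: h. Qed.
Lemma ipC u v : H u -> H v -> ip v u = (ip u v)^*.
Proof. by move=> hu hv; have [_ h] := sesq; exact: h. Qed.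
Lemma ipDl u v w : H u -> H v -> H w -> ip (u + v) w = ip u w + ip v w.
Proof. by move=> hu hv hw; rewrite -{1}[u]scale1r ipDZl // mul1r. Qed.
Lemma ip0l w : H w -> ip 0 w = 0.
Proof.
move=> hw; apply: (@addrI _ (ip 0 w)); rewrite addr0 -ipDl ?addr0 //; exact: sub0.
Qed.
Lemma ipZl (c : C) u w : H u -> H w -> ip (c *: u) w = c * ip u w.
Proof. by move=> hu hw; rewrite -[_ *: _]addr0 ipDZl ?ip0l ?addr0 //; exact: sub0. Qed.
Lemma ipNl u w : H u -> H w -> ip (- u) w = - ip u w.
Proof. by move=> hu hw; rewrite -scaleN1r ipZl // mulN1r. Qed.
Lemma ipBl u v w : H u -> H v -> H w -> ip (u - v) w = ip u w - ip v w.
Proof. by move=> hu hv hw; rewrite ipDl ?ipNl //; exact: subN. Qed.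
Lemma ipDr u v w : H u -> H v -> H w -> ip w (u + v) = ip w u + ip w v.
Proof.
move=> hu hv hw; rewrite ipC ?ipDl //; last exact: subD.
by rewrite rmorphD /= -!ipC.
Qed.
Lemma ipZr (c : C) u w : H u -> H w -> ip w (c *: u) = c^* * ip w u.
Proof.
move=> hu hw; rewrite ipC ?ipZl //; last exact: subZ.
by rewrite rmorphM /= -!ipC.
Qed.
Lemma ipDZr (c : C) u v w : H u -> H v -> H w -> ip w (c *: u + v) = c^* * ip w u + ip w v.
Proof. by move=> hu hv hw; rewrite ipDr ?ipZr //; exact: subZ. Qed.
Lemma ip0r w : H w -> ip w 0 = 0.
Proof. by move=> hw; rewrite ipC ?ip0l ?rmorph0 //; exact: sub0. Qed.
Lemma ipNr u w : H u -> H w -> ip w (- u) = - ip w u.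
Proof. by move=> hu hw; rewrite -scaleN1r ipZr // rmorphN rmorph1 mulN1r. Qed.
Lemma ipBr u v w : H u -> H v -> H w -> ip w (u - v) = ip w u - ip w v.
Proof. by move=> hu hv hw; rewrite ipDr ?ipNr //; exact: subN. Qed.
Lemma ip_suml (I : eqType) (r : seq I) (F : I -> V) w :
  (forall i, i \in r -> H (F i)) -> H w ->
  ip (\sum_(i <- r) F i) w = \sum_(i <- r) ip (F i) w.
Proof.
move=> hF hw; elim: r hF => [|x r ih] hF; first by rewrite !big_nil ip0l.
have hx : H (F x) by apply: hF; rewrite inE eqxx.
have hr i : i \in r -> H (F i) by move=> ir; apply: hF; rewrite inE ir orbT.
by rewrite !big_cons ipDl ?ih //; exact: sub_sum.
Qed.
Lemma ip_sumr (I : eqType) (r : seq I) (F : I -> V) w :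
  (forall i, i \in r -> H (F i)) -> H w ->
  ip w (\sum_(i <- r) F i) = \sum_(i <- r) ip w (F i).
Proof.
move=> hF hw; rewrite ipC ?ip_suml //; last exact: sub_sum.
rewrite rmorph_sum /= big_seq [RHS]big_seq; apply: eq_bigr => i /hF hi.
by rewrite -ipC.
Qed.

Lemma ip_real u : H u -> (ip u u)^* = ip u u.
Proof. by move=> hu; rewrite -ipC. Qed.

Definition qf (u : V) : R := complex.Re (ip u u).

Lemma qfE u : H u -> ip u u = ((qf u)%:C)%C.
Proof.
move=> hu; have := ip_real hu; rewrite /qf; case: (ip u u) => a b [] /= hb.
have b0 : b = 0 by lra.
by rewrite b0.
Qed.

Lemma qfZ (c : C) u : H u -> qf (c *: u) = nsq c * qf u.
Proof.
move=> hu; apply: (@complexI R); rewrite -qfE; last exact: subZ.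
rewrite ipZl ?ipZr //; last exact: subZ.
by rewrite mulrA -nsqE qfE // -rmorphM.
Qed.

Lemma qfN u : H u -> qf (- u) = qf u.
Proof. by move=> hu; rewrite -scaleN1r qfZ // nsqN nsq1 mul1r. Qed.

Lemma qf0 : qf 0 = 0.
Proof. by rewrite /qf ip0l //; exact: sub0. Qed.

Lemma parallelogram u v : H u -> H v -> qf (u + v) + qf (u - v) = 2 * (qf u + qf v).
Proof.
move=> hu hv; have huD := subD hu hv; have huB := subB hu hv.
rewrite mulr_natl mulr2n; apply: (@complexI R); rewrite !rmorphD /= -!qfE //.
rewrite ipDl ?ipBl // !ipDr ?ipNr //; last 2 first.
- exact: subN.
- exact: subN.
ring.
Qed.

Lemma qfB u v : H u -> H v -> qf (u - v) = qf u - 2 * complex.Re (ip u v) + qf v.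
Proof.
move=> hu hv; have huv := subB hu hv; rewrite /qf ipBl ?ipBr // [ip v u]ipC //.
by case: (ip u u) (ip u v) (ip v v) => [? ?] [? ?] [? ?] /=; ring.
Qed.

End Sesquilinear.

Section Hilbert.
Variables (R : realType) (V : lmodType R[i]) (H : set V) (hip : V -> V -> R[i]).
Local Notation C := (R[i]).
Hypothesis hilb : hilbert H hip.
Let subH : Defs.subspace H. Proof. by case: hilb. Qed.
Let sesq : sesquilinear_on H hip. Proof. by case: hilb. Qed.
Local Notation q := (qf hip).

Lemma qf_ge0 u : H u -> 0 <= q u.
Proof.
move=> hu; have [->|u0] := eqVneq u 0; first by rewrite (qf0 subH sesq).
case: hilb => _ _ /(_ u hu u0) + _; rewrite (qfE sesq hu) ltcR; exact: ltW.
Qed.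

Lemma qf_eq0 u : H u -> q u = 0 -> u = 0.
Proof.
move=> hu qu; apply/eqP/negPn/negP => u0.
case: hilb => _ _ /(_ u hu u0) + _; by rewrite (qfE sesq hu) qu ltxx.
Qed.

Lemma cauchy_schwarz u v : H u -> H v -> nsq (hip u v) <= q u * q v.
Proof.
move=> hu hv; have [v0|v0] := eqVneq (q v) 0.
  by rewrite (qf_eq0 hv v0) (ip0r subH sesq) // nsq0 (qf0 subH sesq) mulr0.
have qv : 0 < q v by rewrite lt_def v0 qf_ge0.
pose w := ((q v)%:C)%C *: u - hip u v *: v.
have hZ c x : H x -> H (c *: x) by exact: subZ.
have hw : H w by apply: subB => //; apply: hZ.
have : 0 <= q w by exact: qf_ge0.
suff -> : q w = q v * (q u * q v - nsq (hip u v)) by rewrite pmulr_rge0 // subr_ge0.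
apply: (@complexI R); rewrite -(qfE sesq) // !(rmorphM, rmorphB) /= nsqE /w.
rewrite (ipBl subH sesq) //; try exact: hZ.
rewrite !(ipBr subH sesq) //; try exact: hZ.
rewrite !(ipZl subH sesq) //; try exact: hZ.
rewrite !(ipZr subH sesq) // (ipC sesq hu hv) -!(qfE sesq) // (ip_real sesq hv); ring.
Qed.

Lemma qfD_le u v : H u -> H v -> q (u + v) <= 2 * (q u + q v).
Proof.
move=> hu hv; rewrite -(parallelogram subH sesq hu hv) lerDl.
by apply: qf_ge0; exact: subB.
Qed.

Lemma hilbert_complete (u : nat -> V) : (forall n, H (u n)) ->
  (forall e : R, 0 < e -> exists n0, forall m n, (n0 <= m)%N -> (n0 <= n)%N ->
     q (u m - u n) < e) ->
  exists2 l, H l & forall e : R, 0 < e -> exists n0, forall n, (n0 <= n)%N ->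
     q (u n - l) < e.
Proof.
move=> hu hc; case: hilb => _ _ _ /(_ u hu)[|l hl hlim].
  move=> e /gt0_real[d d0 ->]; have [n0 hn0] := hc _ d0; exists n0 => m n hm hn.
  by rewrite (qfE sesq) ?ltcR; [exact: hn0|exact: subB].
exists l => // e e0; have [|n0 hn0] := hlim ((e%:C)%C); first by rewrite ltcR.
exists n0 => n /hn0; rewrite (qfE sesq) ?ltcR //; exact: subB.
Qed.

Lemma inv_nat_small (e : R) : 0 < e -> exists n0, forall n, (n0 <= n)%N -> n.+1%:R^-1 < e.
Proof.
move=> e0; have [n0 hn0] : exists n0 : nat, e^-1 < n0.+1%:R.
  by exists (Num.trunc e^-1); have := truncnS_gt e^-1.
exists n0 => n hn; rewrite invf_plt ?posrE ?ltr0n //.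
by apply: lt_le_trans hn0 _; rewrite ler_nat.
Qed.

Lemma small_eq0 (x : R) : 0 <= x -> (forall e, 0 < e -> x <= e) -> x = 0.
Proof.
move=> x0 hx; apply/eqP; rewrite eq_le x0 andbT leNgt; apply/negP => xp.
have x2 : 0 < x / 2 by rewrite divr_gt0.
by have := hx _ x2; lra.
Qed.

(** A minimizing sequence for the distance from x to D is a Cauchy sequence by
    the parallelogram law, and x minus its limit is orthogonal to D. *)
Theorem dense_of_orthogonal (D : set V) : Defs.subspace D -> D `<=` H ->
  (forall v, H v -> (forall d, D d -> hip v d = 0) -> v = 0) ->
  forall x e, H x -> 0 < e -> exists2 d, D d & q (x - d) < e.
Proof.
move=> subD' DH orth x e hx e0.
have hxd d : D d -> H (x - d) by move=> /DH hd; exact: subB.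
pose S := [set q (x - d) | d in D].
have infS : has_inf S.
  split; first by exists (q (x - 0)), 0 => //; exact: sub0 subD'.
  by exists 0 => _ [d /hxd hd <-]; exact: qf_ge0.
pose dl := inf S.
have dl_le d : D d -> dl <= q (x - d).
  by move=> Dd; apply: ge_inf; [case: infS|exists d].
have eps_gt0 (n : nat) : 0 < n.+1%:R^-1 :> R by rewrite invr_gt0 ltr0n.
have /choice[d hd] : forall n : nat, exists d, D d /\ q (x - d) < dl + n.+1%:R^-1.
  move=> n.
  have [_ [d Dd <-] hd] := inf_adherent (eps_gt0 n) infS.
  by exists d.
have Dd n : D (d n) by case: (hd n).
have qd n : q (x - d n) < dl + n.+1%:R^-1 by case: (hd n).
have Hd n : H (d n) by apply: DH.
have cau m n : q (d m - d n) <= 2 * (m.+1%:R^-1 + n.+1%:R^-1).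
  have hm := hxd _ (Dd m); have hn := hxd _ (Dd n).
  have := parallelogram subH sesq hm hn.
  have -> : x - d m - (x - d n) = - (d m - d n) by rewrite opprB opprB addrC addrA addrNK addrC.
  rewrite (qfN subH sesq); last exact: subB.
  have -> : x - d m + (x - d n) = 2 *: (x - (2^-1 *: d m + 2^-1 *: d n)).
    rewrite scalerBr scalerDr !scalerA divff ?pnatr_eq0 // !scale1r.
    by rewrite scaler_nat mulr2n opprD addrACA.
  have hD : D (2^-1 *: d m + 2^-1 *: d n) by apply: subDZ => //; exact: subZ.
  rewrite (qfZ subH sesq); last exact: hxd.
  have -> : nsq (2 : C) = 4 by rewrite nsq_def /=; ring.
  have := dl_le _ hD; have := qd m; have := qd n.
  move: (m.+1%:R^-1) (n.+1%:R^-1) => a b; lra.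
have [|l hl hlim] := hilbert_complete Hd.
  move=> e1 e10; have e4 : 0 < e1 / 5 by rewrite divr_gt0.
  have [n0 hn0] := inv_nat_small e4.
  exists n0 => m n /hn0 hm /hn0 hn; apply: le_lt_trans (cau m n) _.
  by move: hm hn; move: (m.+1%:R^-1) (n.+1%:R^-1) => a b; lra.
have hxl : H (x - l) by exact: subB.
have {}orth : x - l = 0.
  apply: orth => // v Dv; have hv := DH _ Dv.
  apply/eqP; rewrite -nsq_eq0; apply/eqP; apply: small_eq0; first exact: nsq_ge0.
  move=> e1 e10.
  have qv0 : 0 <= q v by exact: qf_ge0.
  have qv1 : 0 < q v + 1 by rewrite ltr_wpDl.
  (* the optimality of the distance bounds the component of x - d n along v *)
  have key n : nsq (hip (x - d n) v) <= n.+1%:R^-1 * (q v + 1).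
    have hw := hxd _ (Dd n); set w := x - d n in hw *.
    set h := hip w v; set t := (q v + 1)^-1.
    have t0 : 0 < t by rewrite invr_gt0.
    pose c := ((t%:C)%C * h).
    have hcv : H (c *: v) by exact: subZ.
    have Dn : D (c *: v + d n) by exact: subDZ.
    have := dl_le _ Dn.
    have -> : x - (c *: v + d n) = w - c *: v by rewrite opprD addrCA addrC /w.
    have -> : q (w - c *: v) = q w - 2 * t * nsq h + t ^+ 2 * nsq h * q v.
      rewrite (qfB subH sesq) // (qfZ subH sesq) // (ipZr subH sesq) // -/h.
      have -> : c^* * h = ((t * nsq h)%:C)%C.
        by rewrite /c rmorphM /= conj_realC rmorphM /= nsqE [h * _]mulrC mulrA.
      by rewrite /c nsqM nsq_real /=; ring.
    have := qd n; rewrite -/w; move: (n.+1%:R^-1) => a h1 h2.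
    have h3 : 2 * t * nsq h - t ^+ 2 * nsq h * q v <= a by lra.
    have h4 : t * nsq h <= a.
      apply: le_trans h3.
      have : t * q v <= 1 by rewrite /t mulrC ler_pdivrMr // mul1r lerDl ler01.
      have : 0 <= t * nsq h by rewrite mulr_ge0 ?nsq_ge0 // ltW.
      by nra.
    by rewrite -ler_pdivrMr // mulrC.
  have e2 : 0 < e1 / 4 / (q v + 1) by rewrite !divr_gt0.
  have [n1 hn1] := inv_nat_small e2; have [n2 hn2] := hlim _ e2.
  pose n := maxn n1 n2.
  have {}hn1 := hn1 n (leq_maxl _ _); have {}hn2 := hn2 n (leq_maxr _ _).
  have hdl : H (d n - l) by exact: subB.
  have -> : x - l = (x - d n) + (d n - l) by rewrite addrA subrK.
  rewrite (ipDl sesq) //; last exact: hxd.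
  apply: le_trans (nsqD_le _ _) _.
  have h1 := key n; have h2 := cauchy_schwarz hdl hv; move: h1 hn1; move: (n.+1%:R^-1) => a h1 hn1.
  have h3 : a * (q v + 1) <= e1 / 4 by rewrite -ler_pdivlMr // ltW.
  have h4 : q (d n - l) * (q v + 1) <= e1 / 4 by rewrite -ler_pdivlMr // ltW.
  have h5 : 0 <= q (d n - l) by exact: qf_ge0.
  by nra.
have [n0 hn0] := hlim _ e0; exists (d n0) => //.
have <- : l = x by apply/esym/eqP; rewrite -subr_eq0 orth.
by rewrite -(qfN subH sesq) ?opprB; [exact: hn0|exact: subB].
Qed.

(** The converse of the Cauchy-Schwarz inequality, tested on a dense set only. *)
Lemma dense_ip_bound (D : set V) (u : V) (M : R) : D `<=` H -> H u -> 0 <= M ->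
  (forall x e, H x -> 0 < e -> exists2 d, D d & q (x - d) < e) ->
  (forall d, D d -> nsq (hip u d) <= M * q d) -> q u <= M.
Proof.
move=> DH hu M0 dense hb; rewrite leNgt; apply/negP => Mu.
have u0 : 0 < q u by exact: le_lt_trans Mu.
(* compare with an element of D close to u *)
have key (s : R) : 0 < s -> s < 1 -> q u * (1 - s) ^+ 2 <= M * (1 + s) ^+ 2.
  move=> s0 s1.
  have [d Dd hd] := dense u (s ^+ 2 * q u) hu (mulr_gt0 (exprn_gt0 2 s0) u0).
  have hdH := DH _ Dd; have hud : H (u - d) by exact: subB.
  have h1 := hb _ Dd.
  have h2 := cauchy_schwarz hu hud.
  have e1 : hip u d = hip u u - hip u (u - d).
    by rewrite (ipBr subH sesq) // opprB addrC subrK.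
  have e2 : q d = q u - 2 * complex.Re (hip u (u - d)) + q (u - d).
    have -> : q d = q (u - (u - d)) by rewrite opprB addrC subrK.
    by rewrite (qfB subH sesq).
  set z := hip u (u - d) in h2 e1 e2.
  have hz : nsq z <= (s * q u) ^+ 2.
    apply: le_trans h2 _; rewrite exprMn expr2 [q u ^+ 2]expr2 mulrCA ler_pM2l //.
    by rewrite -expr2 ltW.
  have hre : `|complex.Re z| <= s * q u.
    rewrite -ler_sqr ?nnegrE ?mulr_ge0 ?(ltW s0) ?(ltW u0) // real_normK ?num_real //.
    exact: le_trans (Re_sqr_le _) hz.
  move: hre; rewrite ler_norml => /andP[r1 r2].
  have l1 : (q u * (1 - s)) ^+ 2 <= nsq (hip u d).
    rewrite e1 (qfE sesq hu) nsq_def; apply: le_trans (_ : (q u - complex.Re z) ^+ 2 <= _).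
      rewrite ler_sqr ?nnegrE; first by lra.
        by rewrite mulr_ge0 ?ltW // subr_gt0.
      by apply: le_trans (_ : q u * (1 - s) <= _); [rewrite mulr_ge0 ?ltW // subr_gt0|lra].
    by case: (z) => a b /=; rewrite lerDl sqr_ge0.
  have l2 : q d <= q u * (1 + s) ^+ 2.
    by rewrite e2; nra.
  have l3 : M * q d <= M * (q u * (1 + s) ^+ 2) by rewrite ler_wpM2l.
  have := le_trans l1 (le_trans h1 l3).
  by rewrite exprMn [q u ^+ 2]expr2 -mulrA [M * (q u * _)]mulrCA ler_pM2l.
have [s [s0 s1 hs]] : exists s : R, [/\ 0 < s, s < 1 & M * (1 + s) ^+ 2 < q u * (1 - s) ^+ 2].
  pose s := (q u - M) / (8 * q u).
  have e1 : s * (8 * q u) = q u - M by rewrite /s divfK // gt_eqF // mulr_gt0.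
  have s0 : 0 < s by rewrite divr_gt0 ?subr_gt0 // mulr_gt0.
  have s1 : s < 1 / 2.
    by rewrite ltr_pdivrMr ?mulr_gt0 //; lra.
  exists s; split => //; first by lra.
  have : M * s <= q u * s by rewrite ler_pM2r // ltW.
  have : M * s ^+ 2 <= q u * s ^+ 2 by rewrite ler_pM2r ?exprn_gt0 // ltW.
  have : 0 < q u * s by rewrite mulr_gt0.
  by move: e1; rewrite !expr2; nra.
by have := key s s0 s1; rewrite leNgt hs.
Qed.

(** A symmetric operator defined on the whole of a Hilbert space has no
    spectrum off the real axis: T - g is bounded below by |Im g|, and its range
    is dense because a vector orthogonal to it is an eigenvector for g^*.  The
    limit of approximate solutions is a solution by symmetry, without any
    recourse to the closed graph theorem. *)
Theorem symmetric_resolvent (T : V -> V) (g : C) :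
  (forall u, H u -> H (T u)) ->
  (forall c u v, H u -> H v -> T (c *: u + v) = c *: T u + T v) ->
  (forall u v, H u -> H v -> hip (T u) v = hip u (T v)) ->
  complex.Im g != 0 ->
  forall y, H y -> exists2 x, H x & T x - g *: x = y.
Proof.
move=> TH Tlin Tsym g0 y hy.
have HT x (hx : H x) c : H (T x - c *: x) by apply: subB; [|exact: TH|exact: subZ].
pose D := [set z | exists2 x, H x & z = T x - g *: x].
have DH : D `<=` H by move=> _ [x hx ->]; exact: HT.
have T0 : T 0 = 0.
  have := Tlin 1 0 0 (sub0 subH) (sub0 subH); rewrite scaler0 addr0 scale1r => e.
  by apply: (@addrI _ (T 0)); rewrite addr0 -e.
have subDD : Defs.subspace D.
  split; first by exists 0; [exact: sub0|rewrite T0 scaler0 subr0].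
  move=> c _ _ [u hu ->] [v hv ->]; exists (c *: u + v); first exact: subDZ.
  by rewrite Tlin // !scalerDr opprD scalerN !scalerA [g * c]mulrC addrACA.
have adj u v c : H u -> H v -> hip (T u - c *: u) v = hip u (T v - c^* *: v).
  move=> hu hv; rewrite (ipBl subH sesq) ?(ipBr subH sesq) //; try exact: subZ; try exact: TH.
  by rewrite Tsym // (ipZl subH sesq) ?(ipZr subH sesq) // conjCK.
have orth v : H v -> (forall d, D d -> hip v d = 0) -> v = 0.
  move=> hv hd.
  have hw := HT _ hv (g^*).
  have w0 : T v - g^* *: v = 0.
    apply: qf_eq0 => //; rewrite /qf adj // conjCK hd //.
    by exists (T v - g^* *: v).
  have Tv : T v = g^* *: v by apply/eqP; rewrite -subr_eq0 w0.
  have := Tsym _ _ hv hv; rewrite Tv (ipZl subH sesq) // (ipZr subH sesq) // conjCK (qfE sesq hv).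
  move=> e; apply: qf_eq0 => //; move: e g0; case: (g) => a b /= [] _.
  move=> e b0; have : b * q v = 0 by lra.
  by move/eqP; rewrite mulf_eq0 (negPf b0) => /eqP.
have dense := dense_of_orthogonal subDD DH orth.
have Ig0 : 0 < complex.Im g ^+ 2 by rewrite lt_def sqrf_eq0 g0 sqr_ge0.
have low x : H x -> complex.Im g ^+ 2 * q x <= q (T x - g *: x).
  move=> hx; have [x0|x0] := eqVneq (q x) 0.
    by rewrite x0 mulr0; apply: qf_ge0; exact: HT.
  have qx : 0 < q x by rewrite lt_def x0 qf_ge0.
  rewrite -(ler_pM2r qx); apply: le_trans (cauchy_schwarz (HT _ hx g) hx).
  rewrite (ipBl subH sesq) ?(ipZl subH sesq) //; try exact: subZ; try exact: TH.
  have rT : complex.Im (hip (T x) x) = 0.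
    have := ipC sesq (TH _ hx) hx; rewrite -(Tsym x x) //.
    by case: (hip (T x) x) => a b [] /=; lra.
  rewrite (qfE sesq hx); move: rT; case: (hip (T x) x) (g) => a b [c d] /= ->.
  rewrite nsq_def /=; have := sqr_ge0 (a - c * q x); nra.
have eps_gt0 (n : nat) : 0 < n.+1%:R^-1 :> R by rewrite invr_gt0 ltr0n.
have /choice[x hx] : forall n : nat, exists x, H x /\ q (y - (T x - g *: x)) < n.+1%:R^-1.
  move=> n.
  by have [_ [x hx ->] hq] := dense _ _ hy (eps_gt0 n); exists x.
have Hx n : H (x n) by case: (hx n).
have qx n : q (y - (T (x n) - g *: x n)) < n.+1%:R^-1 by case: (hx n).
have Hyx n : H (y - (T (x n) - g *: x n)) by apply: subB => //; exact: HT.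
have TB u v : H u -> H v -> T (u - v) = T u - T v.
  by move=> hu hv; rewrite addrC -scaleN1r Tlin // scaleN1r addrC.
have [|l hl hlim] := hilbert_complete Hx.
  move=> e e0.
  have e5 : 0 < complex.Im g ^+ 2 * e / 5 by rewrite divr_gt0 // mulr_gt0.
  have [n0 hn0] := inv_nat_small e5.
  exists n0 => m n /hn0 hm /hn0 hn.
  rewrite -(ltr_pM2l Ig0); apply: le_lt_trans (low _ _) _; first exact: subB.
  have -> : T (x m - x n) - g *: (x m - x n) =
    (y - (T (x n) - g *: x n)) - (y - (T (x m) - g *: x m)).
    rewrite [- (y - _)]opprB [RHS]addrC [RHS]addrA subrK TB // scalerBr !opprB.
    by rewrite addrACA [- T (x n) - _]addrC addrACA.
  apply: le_lt_trans (qfD_le _ _) _ => //; first exact: subN.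
  rewrite (qfN subH sesq) //; move: hm hn (qx m) (qx n).
  by move: (m.+1%:R^-1) (n.+1%:R^-1) => a b; lra.
exists l => //; apply/eqP; rewrite -subr_eq0; apply/eqP.
have hw : H (T l - g *: l - y) by apply: subB => //; exact: HT.
set w := T l - g *: l - y in hw *.
apply: qf_eq0 => //; apply/eqP; rewrite -sqrf_eq0; apply/eqP.
apply: small_eq0; first exact: sqr_ge0.
move=> e e0.
have hw' : H (T w - g^* *: w) by exact: HT.
pose M := q w + q (T w - g^* *: w) + 1.
have qw0 := qf_ge0 hw; have qw0' := qf_ge0 hw'.
have M0 : 0 < M by rewrite ltr_pwDr // addr_ge0.
have e4 : 0 < e / (4 * M) by rewrite divr_gt0 // mulr_gt0.
have [n1 hn1] := hlim _ e4; have [n2 hn2] := inv_nat_small e4.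
pose n := maxn n1 n2.
have {}hn1 := hn1 n (leq_maxl _ _); have {}hn2 := hn2 n (leq_maxr _ _).
have hxl : H (x n - l) by exact: subB.
have we : w = - (T (x n - l) - g *: (x n - l)) - (y - (T (x n) - g *: x n)).
  rewrite TB // scalerBr /w.
  have -> : T (x n) - T l - (g *: x n - g *: l) = (T (x n) - g *: x n) - (T l - g *: l).
    by rewrite !opprD !opprK addrACA.
  by move: (T l - g *: l) (T (x n) - g *: x n) => B A; rewrite !opprB addrA subrK.
have -> : q w ^+ 2 = nsq (hip w w) by rewrite (qfE sesq hw) nsq_real.
rewrite {1}we (ipBl subH sesq) //; last by apply: subN => //; exact: HT.
rewrite (ipNl subH sesq) //; last exact: HT.
rewrite adj //; apply: le_trans (nsqD_le _ _) _; rewrite !nsqN.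
have h1 := cauchy_schwarz hxl hw'; have h2 := cauchy_schwarz (Hyx n) hw.
have h3 : q (x n - l) * M <= e / 4.
  by rewrite -ler_pdivlMr // -mulrA -invfM ltW.
have h4 : q (y - (T (x n) - g *: x n)) * M <= e / 4.
  by rewrite -ler_pdivlMr // -mulrA -invfM ltW // (lt_trans (qx n)).
have h5 := qf_ge0 hxl; have h6 := qf_ge0 (Hyx n).
have h7 : q (x n - l) * q (T w - g^* *: w) <= q (x n - l) * M.
  by rewrite ler_wpM2l // /M; lra.
have h8 : q (y - (T (x n) - g *: x n)) * q w <= q (y - (T (x n) - g *: x n)) * M.
  by rewrite ler_wpM2l // /M; lra.
lra.
Qed.

End Hilbert.

(** * Fundamental decompositions *)

Section Pontryagin.
Variables (R : realType) (V : lmodType R[i]).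
Local Notation C := (R[i]).

(** Gram-Schmidt orthogonalization: an orthonormal basis is extracted from a
    finite spanning family, one generator at a time. *)
Lemma finite_frame (n : nat) (b : 'I_n -> V) (E : set V) (f : V -> V -> C) :
  Defs.subspace E -> sesquilinear_on E f ->
  (forall u, E u -> u != 0 -> 0 < f u u) ->
  (forall u, E u -> exists c : 'I_n -> C, u = \sum_k c k *: b k) ->
  exists s : seq V, (forall x, x \in s -> E x) /\
    forall u, E u -> u = \sum_(x <- s) f u x *: x.
Proof.
elim: n b E => [|n ih] b E sE sf pos span.
  exists [::]; split => // u /span[c ->].
  by rewrite big_nil big_ord0.
pose E' := [set v | E v /\ exists c : 'I_n -> C, v = \sum_k c k *: b (widen_ord (leqnSn n) k)].
have sE' : Defs.subspace E'.
  split.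
    split; first exact: sub0 sE.
    by exists (fun=> 0); rewrite big1 // => k _; rewrite scale0r.
  move=> c u v [hu [cu eu]] [hv [cv ev]]; split; first exact: (subDZ sE).
  exists (fun k => c * cu k + cv k); rewrite eu ev scaler_sumr -big_split /=.
  by apply: eq_bigr => k _; rewrite scalerDl scalerA.
have sf' : sesquilinear_on E' f.
  case: sf => s1 s2; split; first by move=> c u v w [hu _] [hv _] [hw _]; exact: s1.
  by move=> u v [hu _] [hv _]; exact: s2.
have [||s' [hs' fr]] := ih (fun k => b (widen_ord (leqnSn n) k)) E' sE' sf'.
- by move=> u [hu _]; exact: pos.
- by move=> u [_]; exact.
have Es' x : x \in s' -> E x by move=> /hs' [].
have [allE|] := pselect (forall u, E u -> E' u).
  by exists s'; split => // u /allE; exact: fr.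
move=> /existsNP[u /not_implyP[hu nu]].
pose p := \sum_(x <- s') f u x *: x.
have hp' : E' p by apply: (sub_sum sE') => x /hs' hx; exact: (subZ sE').
have hp : E p by case: hp'.
pose e := u - p.
have he : E e by exact: (subB sE).
have orth v : E' v -> f e v = 0.
  move=> hv'; have hv : E v by case: hv'.
  have ev := fr _ hv'.
  rewrite /e (ipBl sE sf) // [X in f u X]ev /p.
  rewrite (ip_sumr sE sf) //; last by move=> x /Es' hx; exact: (subZ sE).
  rewrite (ip_suml sE sf) //; last by move=> x /Es' hx; exact: (subZ sE).
  rewrite -sumrB big_seq big1 // => x /Es' hx.
  by rewrite (ipZl sE sf) // (ipZr sE sf) // -(ipC sf) // mulrC subrr.
have e0 : e != 0.
  apply/eqP => e0; apply: nu; suff -> : u = p by [].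
  by apply/eqP; rewrite -subr_eq0 -/e e0.
have fe := pos _ he e0.
have [d d0 de] := gt0_real fe.
pose t : C := (((Num.sqrt d)^-1)%:C)%C.
have te : t * t^* * f e e = 1.
  rewrite /t conj_realC de -!rmorphM /= -invfM -expr2 sqr_sqrtr ?ltW // mulVf //.
  by rewrite gt_eqF.
exists (t *: e :: s'); split.
  by move=> x; rewrite inE => /orP[/eqP ->|/Es' //]; exact: (subZ sE).
move=> w hw; rewrite big_cons.
have [cu eu] := span _ hu; have [cw ew] := span _ hw.
have cn : cu ord_max != 0.
  apply/eqP => c0; apply: nu; split => //.
  exists (fun k => cu (widen_ord (leqnSn n) k)).
  by rewrite {1}eu big_ord_recr /= c0 scale0r addr0.
pose r := cw ord_max / cu ord_max.
have hv : E' (w - r *: u).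
  split; first by apply: (subB sE) => //; exact: (subZ sE).
  exists (fun k => cw (widen_ord (leqnSn n) k) - r * cu (widen_ord (leqnSn n) k)).
  rewrite {1}ew {1}eu scaler_sumr -sumrB big_ord_recr /=.
  rewrite [r *: (_ ord_max *: _)]scalerA /r divfK // subrr addr0.
  by apply: eq_bigr => k _; rewrite scalerBl scalerA.
pose v := (w - r *: u) + r *: p.
have hv' : E' v by apply: (subD sE') => //; exact: (subZ sE').
have hvE : E v by case: hv'.
have ew' : w = r *: e + v.
  by rewrite /v /e scalerBr addrCA !subrK.
have fwe : f w (t *: e) = r * t^* * f e e.
  rewrite (ipZr sE sf) // {1}ew' (ipDZl sf) //.
  by rewrite (ipC sf he hvE) (orth v) // conjC0 addr0 mulrA [t^* * r]mulrC.
rewrite fwe scalerA.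
have -> : r * t^* * f e e * t = r by rewrite -[RHS]mulr1 -te; ring.
rewrite {1}ew'; congr (_ + _); rewrite [LHS](fr _ hv').
rewrite big_seq [RHS]big_seq; apply: eq_bigr => x hx; congr (_ *: _).
have hx' := hs' _ hx; have hxE := Es' _ hx.
by rewrite {1}ew' (ipDZl sf) // (orth x) // mulr0 add0r.
Qed.

(** J is the symmetry of a fundamental decomposition.  The list s is an
    orthonormal basis of the negative part for the opposite form, so phneg says
    that J differs from the identity by a finite-rank operator given by the
    indefinite form itself. *)
Record pontryagin_hilbert (H : set V) (ip : V -> V -> C) (J : V -> V) (s : seq V) : Prop := {
  phJ : forall u, H u -> H (J u);
  phJlin : forall c u v, H u -> H v -> J (c *: u + v) = c *: J u + J v;
  phJK : forall u, H u -> J (J u) = u;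
  phJsym : forall u v, H u -> H v -> ip (J u) v = ip u (J v);
  phhilb : hilbert H (fun u v => ip u (J v));
  phs : forall x, x \in s -> H x /\ J x = - x;
  phneg : forall u, H u -> J u = u + 2 *: \sum_(x <- s) ip u x *: x;
}.

Theorem pontryagin_hilbertP (H : set V) (ip : V -> V -> C) :
  pontryagin H ip -> exists J s, pontryagin_hilbert H ip J s.
Proof.
move=> [sH sf [Hp [Hm [[HpH HmH] dec orth hilp [hilm [n [b hb]]]]]]].
have sHp : Defs.subspace Hp by case: hilp.
have sHm : Defs.subspace Hm by case: hilm.
have sfm : sesquilinear_on Hm (fun u v => - ip u v) by case: hilm.
have sfp : sesquilinear_on Hp ip by case: hilp.
have [|s [hs fr]] := finite_frame sHm sfm _ hb.
  by case: hilm.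
(* the sign comes from the negative form on Hm *)
pose pm u : V := - \sum_(x <- s) ip u x *: x.
have hsH x : x \in s -> H x by move=> /hs /HmH.
have pmH u : Hm (pm u).
  by apply: (subN sHm); apply: (sub_sum sHm) => x /hs hx; exact: (subZ sHm).
have pmp u : Hp u -> pm u = 0.
  move=> hu; rewrite /pm big_seq big1 ?oppr0 // => x /hs hx.
  by rewrite orth // scale0r.
have pmm u : Hm u -> pm u = u.
  move=> hu; rewrite {2}(fr _ hu) /pm -sumrN; apply: eq_bigr => x _.
  by rewrite scaleNr.
have pml c u v : H u -> H v -> pm (c *: u + v) = c *: pm u + pm v.
  move=> hu hv; rewrite /pm scalerN -opprD scaler_sumr -big_split /=.
  congr (- _); rewrite big_seq [RHS]big_seq; apply: eq_bigr => x /hsH hx.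
  by rewrite (ipDZl sf) // scalerDl scalerA.
have pmE u : pm u = - \sum_(x <- s) ip u x *: x by [].
clearbody pm.
have pmD u v : H u -> H v -> pm (u + v) = pm u + pm v.
  by move=> hu hv; rewrite -{1}[u]scale1r pml // scale1r.
have ppH u : H u -> Hp (u - pm u).
  move=> /dec[up [um [hup hum ->]]].
  have h1 := HpH _ hup; have h2 := HmH _ hum.
  by rewrite pmD // (pmp up) // (pmm um) // add0r addrK.
pose J u := u - 2 *: pm u.
have hpmH u : H (pm u) by apply: HmH.
have JH u : H u -> H (J u) by move=> hu; apply: (subB sH) => //; exact: (subZ sH).
have Jlin c u v : H u -> H v -> J (c *: u + v) = c *: J u + J v.
  move=> hu hv; rewrite /J pml // scalerDr opprD scalerBr addrACA.
  by rewrite !scalerA [2 * c]mulrC.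
have Jp u : Hp u -> J u = u by move=> hu; rewrite /J pmp // scaler0 subr0.
have Jm u : Hm u -> J u = - u.
  by move=> hu; rewrite /J pmm // scaler_nat mulr2n opprD addrA subrr add0r.
have JD u v : H u -> H v -> J (u + v) = J u + J v.
  by move=> hu hv; rewrite -{1}[u]scale1r Jlin // scale1r.
have orth' um up : Hm um -> Hp up -> ip um up = 0.
  by move=> hum hup; rewrite (ipC sf) ?orth ?rmorph0 //; [exact: HpH|exact: HmH].
have ipd u v : H u -> H v -> ip u v = ip (u - pm u) (v - pm v) + ip (pm u) (pm v).
  move=> hu hv; have hpu := ppH _ hu; have hpv := ppH _ hv.
  have hu' := HpH _ hpu; have hv' := HpH _ hpv.
  have -> : ip u v = ip ((u - pm u) + pm u) ((v - pm v) + pm v) by rewrite !subrK.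
  have hs'' := subD sH hv' (hpmH v).
  rewrite (ipDl sf hu' (hpmH u) hs'') (ipDr sH sf hv' (hpmH v) hu') (ipDr sH sf hv' (hpmH v) (hpmH u)).
  by rewrite (orth (u - pm u) (pm v)) // (orth' (pm u) (v - pm v)) // addr0 add0r.
have hipd u v : H u -> H v -> ip u (J v) = ip (u - pm u) (v - pm v) - ip (pm u) (pm v).
  move=> hu hv; have hpu := ppH _ hu; have hpv := ppH _ hv.
  have -> : J v = (v - pm v) - pm v.
    by rewrite /J scaler_nat mulr2n opprD addrA.
  have hu' := HpH _ hpu; have hv' := HpH _ hpv.
  rewrite (ipBr sH sf) //.
  have -> : ip u (v - pm v) - ip u (pm v) =
    ip ((u - pm u) + pm u) (v - pm v) - ip ((u - pm u) + pm u) (pm v) by rewrite !subrK.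
  rewrite (ipDl sf hu' (hpmH u) hv') (ipDl sf hu' (hpmH u) (hpmH v)).
  by rewrite (orth (u - pm u) (pm v)) // (orth' (pm u) (v - pm v)) // addr0 add0r.
have Jsym u v : H u -> H v -> ip (J u) v = ip u (J v).
  move=> hu hv; rewrite (ipC sf) //; last exact: JH.
  by rewrite hipd // rmorphB /= hipd // -!(ipC sf) //; exact: HpH (ppH _ _).
have JK u : H u -> J (J u) = u.
  move=> hu; have hpu := ppH _ hu.
  have Ju : J u = (u - pm u) - pm u by rewrite /J scaler_nat mulr2n opprD addrA.
  have hm := subN sHm (pmH u).
  rewrite {1}Ju (JD _ _ (HpH _ hpu) (HmH _ hm)) (Jp _ hpu) (Jm _ hm).
  by rewrite opprK subrK.
have sesqh : sesquilinear_on H (fun u v => ip u (J v)).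
  split; first by move=> c u v w hu hv hw; rewrite (ipDZl sf) //; exact: JH.
  by move=> u v hu hv; rewrite -Jsym // (ipC sf) //; exact: JH.
have [_ _ posp comp] := hilp; have [_ _ posm comm] := hilm.
have hil : hilbert H (fun u v => ip u (J v)).
  have gep x : Hp x -> 0 <= ip x x.
    move=> hx; have [->|x0] := eqVneq x 0; last by rewrite ltW // posp.
    by rewrite (ip0l sHp sfp) //; exact: sub0 sHp.
  have gem x : Hm x -> 0 <= - ip x x.
    move=> hx; have [->|x0] := eqVneq x 0; last by rewrite ltW // posm.
    by rewrite (ip0l sH sf) ?oppr0 //; exact: sub0 sH.
  split=> //.
    move=> u hu u0; rewrite hipd //.
    have [p0|p0] := eqVneq (u - pm u) 0.
      have pu : pm u = u by apply/esym/eqP; rewrite -subr_eq0 p0.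
      apply: ltr_wpDl; first exact: gep (ppH _ hu).
      by apply: posm; rewrite ?pu // -pu.
    by apply: ltr_pwDl; [exact: posp (ppH _ hu) p0|exact: gem].
  move=> u hu cau.
  have pmB x y : H x -> H y -> pm (x - y) = pm x - pm y.
    by move=> hx hy; rewrite addrC -scaleN1r pml // scaleN1r addrC.
  have [||lp hlp limp] := comp (fun n => u n - pm (u n)).
  - by move=> k; apply: ppH.
  - move=> e /cau[n0 hn0]; exists n0 => m k hm hk.
    apply: le_lt_trans (hn0 _ _ hm hk).
    have hmk : H (u m - u k) by exact: (subB sH).
    rewrite hipd // pmB //.
    have -> : u m - u k - (pm (u m) - pm (u k)) = u m - pm (u m) - (u k - pm (u k)).
      by rewrite !opprD !opprK addrACA.
    by rewrite lerDl -pmB // gem.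
  have [||lm hlm limm] := comm (fun n => pm (u n)).
  - by move=> k; apply: pmH.
  - move=> e /cau[n0 hn0]; exists n0 => m k hm hk.
    apply: le_lt_trans (hn0 _ _ hm hk).
    have hmk : H (u m - u k) by exact: (subB sH).
    by rewrite hipd // -pmB // lerDr; exact: gep (ppH _ hmk).
  have hlH : H (lp + lm) by apply: (subD sH); [exact: HpH|exact: HmH].
  exists (lp + lm) => // e e0.
  have e2 : 0 < e / 2 by rewrite divr_gt0.
  have [n1 hn1] := limp _ e2; have [n2 hn2] := limm _ e2.
  exists (maxn n1 n2) => k; rewrite geq_max => /andP[/hn1 h1 /hn2 h2].
  have hkl : H (u k - (lp + lm)) by exact: (subB sH).
  have plm : pm (lp + lm) = lm.
    have h3 := HpH _ hlp; have h4 := HmH _ hlm.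
    by rewrite pmD // (pmp lp) // (pmm lm) // add0r.
  rewrite hipd // pmB // plm.
  have -> : u k - (lp + lm) - (pm (u k) - lm) = u k - pm (u k) - lp.
    by rewrite opprD [- (pm _ - _)]opprB [u k + (_ - _)]addrA subrKA addrAC.
  by rewrite [e]splitr ltrD.
exists J, s; split => //.
- by move=> x hx; split; [exact: hsH|apply: Jm; exact: hs].
- by move=> u hu; rewrite /J pmE scalerN opprK.
Qed.

End Pontryagin.

(** * Matrices over the complex numbers *)

Section Adjoint.
Variable R : realType.
Local Notation C := (R[i]).

Lemma conj_fixP (a : C) : a^* = a <-> complex.Im a = 0.
Proof.
case: a => x y; split => [[]|/= ->]; first by move=> /= h; lra.
exact: conj_realC.
Qed.

Lemma adjmxE m n (A : 'M[C]_(m, n)) i j : adjmx A i j = (A j i)^*.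
Proof. by rewrite !mxE. Qed.

Lemma adjmxM m n p (A : 'M[C]_(m, n)) (B : 'M[C]_(n, p)) :
  adjmx (A *m B) = adjmx B *m adjmx A.
Proof. by rewrite /adjmx trmx_mul map_mxM. Qed.

Lemma adjmxK m n (A : 'M[C]_(m, n)) : adjmx (adjmx A) = A.
Proof. by apply/matrixP => i j; rewrite !adjmxE conjCK. Qed.

Lemma adjmxD m n (A B : 'M[C]_(m, n)) : adjmx (A + B) = adjmx A + adjmx B.
Proof. by apply/matrixP => i j; rewrite !(adjmxE, mxE) rmorphD. Qed.

Lemma adjmxB m n (A B : 'M[C]_(m, n)) : adjmx (A - B) = adjmx A - adjmx B.
Proof. by apply/matrixP => i j; rewrite !(adjmxE, mxE) rmorphB. Qed.

Lemma adjmxZ m n c (A : 'M[C]_(m, n)) : adjmx (c *: A) = c^* *: adjmx A.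
Proof. by apply/matrixP => i j; rewrite !(adjmxE, mxE) rmorphM. Qed.

Lemma adjmx1 n : adjmx (1%:M : 'M[C]_n) = 1%:M.
Proof. by rewrite /adjmx trmx1 map_mx1. Qed.

Lemma adjmx_inv n (A : 'M[C]_n) : A \in unitmx -> adjmx (invmx A) = invmx (adjmx A).
Proof.
move=> AU; have h : adjmx (invmx A) *m adjmx A = 1%:M.
  by rewrite -adjmxM mulmxV // adjmx1.
have [_ uA] := mulmx1_unit h.
by rewrite -[LHS](mulmxK uA) h mul1mx.
Qed.

Definition dot n (c v : 'cV[C]_n) : C := (adjmx c *m v) 0 0.

Lemma dotE n (c v : 'cV[C]_n) : dot c v = \sum_j (c j 0)^* * v j 0.
Proof. by rewrite /dot mxE; apply: eq_bigr => j _; rewrite adjmxE. Qed.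

Lemma dotBr n (c u v : 'cV[C]_n) : dot c (u - v) = dot c u - dot c v.
Proof. by rewrite /dot mulmxBr !mxE. Qed.

Lemma dotZr n a (c u : 'cV[C]_n) : dot c (a *: u) = a * dot c u.
Proof. by rewrite /dot -scalemxAr mxE. Qed.

Lemma dotDl n (c d v : 'cV[C]_n) : dot (c + d) v = dot c v + dot d v.
Proof. by rewrite /dot adjmxD mulmxDl mxE. Qed.

Lemma dotBl n (c d v : 'cV[C]_n) : dot (c - d) v = dot c v - dot d v.
Proof. by rewrite /dot adjmxB mulmxBl !mxE. Qed.

Lemma dotZl n a (c v : 'cV[C]_n) : dot (a *: c) v = a^* * dot c v.
Proof. by rewrite /dot adjmxZ -scalemxAl mxE. Qed.

Lemma dotC n (c v : 'cV[C]_n) : dot v c = (dot c v)^*.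
Proof.
rewrite !dotE rmorph_sum; apply: eq_bigr => j _.
by rewrite /= rmorphM /= conjCK mulrC.
Qed.

Lemma dot0r n (c : 'cV[C]_n) : dot c 0 = 0.
Proof. by rewrite /dot mulmx0 mxE. Qed.

Lemma dot_mxr n (c v : 'cV[C]_n) (A : 'M[C]_n) : dot c (A *m v) = dot (adjmx A *m c) v.
Proof. by rewrite /dot adjmxM adjmxK mulmxA. Qed.

Lemma dot_delta n (j : 'I_n) (v : 'cV[C]_n) : dot (delta_mx j 0) v = v j 0.
Proof.
rewrite dotE (bigD1 j) //= big1 ?addr0; first by rewrite mxE !eqxx /= conjC1 mul1r.
by move=> i ij; rewrite mxE (negPf ij) /= conjC0 mul0r.
Qed.

Definition nsqv n (v : 'cV[C]_n) : R := \sum_j nsq (v j 0).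

Lemma nsqv_ge0 n (v : 'cV[C]_n) : 0 <= nsqv v.
Proof. by apply: sumr_ge0 => j _; exact: nsq_ge0. Qed.

Lemma nsq_dot_le n (c v : 'cV[C]_n) : nsq (dot c v) <= 2 ^+ n * nsqv c * nsqv v.
Proof.
rewrite dotE; apply: le_trans (nsq_sum_le _ _) _.
rewrite /index_enum -enumT size_enum_ord -mulrA ler_pM2l ?exprn_gt0 ?ltr0n //.
rewrite /nsqv mulr_suml enumT; apply: ler_sum => j _.
rewrite nsqM nsq_conj ler_wpM2l ?nsq_ge0 // (bigD1 j) //= lerDl.
by apply: sumr_ge0 => i _; exact: nsq_ge0.
Qed.

Lemma dot_mx_bound n (A : 'M[C]_n) :
  exists2 M : R, 0 <= M & forall v : 'cV[C]_n, `|complex.Re (dot v (A *m v))| <= M * nsqv v.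
Proof.
pose N := \sum_i (2 ^+ n * \sum_j nsq (A i j)).
have N0 : 0 <= N.
  apply: sumr_ge0 => i _; rewrite mulr_ge0 ?exprn_ge0 //.
  by apply: sumr_ge0 => j _; exact: nsq_ge0.
exists (1 + N); first by rewrite addr_ge0.
move=> v.
have hA : nsqv (A *m v) <= N * nsqv v.
  rewrite {1}/nsqv /N mulr_suml; apply: ler_sum => i _.
  have -> : (A *m v) i 0 = dot (\col_j (A i j)^*) v.
    by rewrite mxE dotE; apply: eq_bigr => j _; rewrite mxE conjCK.
  apply: le_trans (nsq_dot_le _ _) _.
  rewrite le_eqVlt; apply/orP; left; apply/eqP; congr (_ * _ * _).
  by apply: eq_bigr => j _; rewrite mxE nsq_conj.
have key (u w : 'cV[C]_n) : `|complex.Re (dot u w)| <= nsqv u + nsqv w.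
  rewrite dotE /nsqv -big_split /=.
  elim/big_ind2 : _ => [|x a y b|j _]; first by rewrite normr0.
    move=> h1 h2; rewrite raddfD /=; apply: le_trans (ler_normD _ _) _; exact: lerD.
  case: (u j 0) (w j 0) => [a b] [c d]; rewrite !nsq_def /= ler_norml.
  have := sqr_ge0 (a - c); have := sqr_ge0 (a + c).
  have := sqr_ge0 (b - d); have := sqr_ge0 (b + d).
  by move=> *; apply/andP; split; nra.
apply: le_trans (key _ _) _; rewrite mulrDl mul1r; exact: lerD.
Qed.

Definition mccont m n (M : C -> 'M[C]_(m, n)) z := forall i j, ccont (fun y => M y i j) z.

Lemma mccont_cst m n (A : 'M[C]_(m, n)) z : mccont (fun=> A) z.
Proof. by move=> i j; exact: ccont_cst. Qed.

Lemma mccontM m n p (M : C -> 'M[C]_(m, n)) (N : C -> 'M[C]_(n, p)) z :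
  mccont M z -> mccont N z -> mccont (fun y => M y *m N y) z.
Proof.
move=> hM hN i j.
rewrite (_ : (fun y => _) = fun y => \sum_k M y i k * N y k j).
  by apply: ccont_sum => k; apply: ccontM.
by apply/funext => y; rewrite mxE.
Qed.

Lemma mccontB m n (M N : C -> 'M[C]_(m, n)) z :
  mccont M z -> mccont N z -> mccont (fun y => M y - N y) z.
Proof.
move=> hM hN i j.
rewrite (_ : (fun y => _) = fun y => M y i j - N y i j); first exact: ccontB.
by apply/funext => y; rewrite !mxE.
Qed.

Lemma mccontZ m n (f : C -> C) (M : C -> 'M[C]_(m, n)) z :
  ccont f z -> mccont M z -> mccont (fun y => f y *: M y) z.
Proof.
move=> hf hM i j.
rewrite (_ : (fun y => _) = fun y => f y * M y i j); first exact: ccontM.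
by apply/funext => y; rewrite !mxE.
Qed.

Lemma mccont_eq_lim m n (M N : C -> 'M[C]_(m, n)) z : mccont M z -> mccont N z ->
  (forall d : R, 0 < d -> exists2 y, nsq (y - z) < d & M y = N y) -> M z = N z.
Proof.
move=> hM hN h; apply/matrixP => i j; apply: ccont_eq_lim (hM i j) (hN i j) _.
by move=> d /h[y yd e]; exists y => //; rewrite e.
Qed.

Lemma mccont_eq_near m n (M N : C -> 'M[C]_(m, n)) z : mccont M z ->
  (\forall y \near (z : C^o), M y = N y) -> mccont N z.
Proof.
move=> hM h i j; apply: ccont_eq_near (hM i j) _.
by apply: filterS h => y ->.
Qed.

Lemma avoid_list (s : seq R) (e : R) : 0 < e -> exists t, [/\ 0 < t, t < e & t \notin s].
Proof.
move=> e0.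
have [t [t0 te ht]] : exists t, [/\ 0 < t, t <= e & forall x, x \in s -> 0 < x -> t <= x].
  elim: s => [|x s [t [t0 te ht]]]; first by exists e.
  have [x0|x0] := ltrP 0 x; last first.
    exists t; split=> // y; rewrite inE => /orP[/eqP ->|]; last exact: ht.
    by move=> /(le_lt_trans x0); rewrite ltxx.
  exists (Num.min t x); split; first by rewrite lt_min t0.
    by rewrite ge_min te.
  move=> y; rewrite inE => /orP[/eqP -> _|ys y0]; first by rewrite ge_min lexx orbT.
  by rewrite ge_min ht.
have t2 : t / 2 < t by rewrite ltr_pdivrMr // ltr_pMr // ltr1n.
exists (t / 2); split; first by rewrite divr_gt0.
  exact: lt_le_trans te.
apply/negP => /ht h; have := h (divr_gt0 t0 (ltr0Sn _ _)).
by rewrite leNgt t2.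
Qed.

Lemma near_generic (B : set C) (a x y : C) (d : R) :
  (\forall z \near (a : C^o), B z) -> 0 < d ->
  exists z, [/\ B z, nsq (z - a) < d, complex.Im z != 0, z != x & z != y].
Proof.
move=> /nbhs_nsq[e e0 he] d0.
have m0 : 0 < Num.min 1 (Num.min d e) by rewrite !lt_min ltr01 d0 e0.
have [t [t0 tm ht]] := avoid_list
  [:: - complex.Im a; complex.Im x - complex.Im a; complex.Im y - complex.Im a] m0.
move: tm; rewrite !lt_min => /andP[t1 /andP[td te]].
have tt : t ^+ 2 <= t by rewrite expr2 ger_pMr // ltW.
have na : nsq (a + Complex 0 t - a) = t ^+ 2.
  by rewrite addrC addKr nsq_def /= expr0n add0r.
move: ht; rewrite !inE !negb_or => /and3P[h1 h2 h3].
exists (a + Complex 0 t); split.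
- by apply: he; rewrite na (le_lt_trans tt).
- by rewrite na (le_lt_trans tt).
- apply: contra h1 => /eqP; case: (a) => u v /= h; apply/eqP; lra.
- apply: contra h2 => /eqP <-; case: (a) => u v /=; apply/eqP; lra.
- apply: contra h3 => /eqP <-; case: (a) => u v /=; apply/eqP; lra.
Qed.

End Adjoint.

(** * The transforms R_a on kernel functions *)

Lemma mulmx_sub_aux (K : fieldType) n (E A1 A2 A3 : 'M[K]_n) (c d : 'cV[K]_n) :
  E *m d = A3 *m c -> A1 *m d = A2 *m c ->
  (E - A1) *m d = (E - A2) *m c - (E - A3) *m c.
Proof. by move=> h4 h5; rewrite !mulmxBl h4 h5 opprB [RHS]addrC subrKA. Qed.

Lemma dot_mxBl (R : realType) n (A A' : 'M[R[i]]_n) (c v : 'cV[R[i]]_n) :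
  dot ((A - A') *m c) v = dot (A *m c) v - dot (A' *m c) v.
Proof. by rewrite mulmxBl /dot adjmxB mulmxBl !mxE. Qed.

(** The situation after the change of variable: H is a Pontryagin space whose
    vectors f have values ev z f at the points z of an open set B, depending
    differentiably on z, and whose kernel vectors k a c have the form
    prescribed by Th; b0 is a real point of B at which Th is continuous. *)
Record core_model (R : realType) (V : lmodType R[i]) (H : set V) (ip : V -> V -> R[i])
    (n : nat) (B : set R[i]) (ev : R[i] -> V -> 'cV[R[i]]_n) (X : 'M[R[i]]_n)
    (Th : R[i] -> 'M[R[i]]_n) (k : R[i] -> 'cV[R[i]]_n -> V) (b0 : R[i])
    (J : V -> V) (s : seq V) : Prop := {
  cm_sub : Defs.subspace H;
  cm_sesq : sesquilinear_on H ip;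
  cm_ph : pontryagin_hilbert H ip J s;
  cm_open : forall a, B a -> \forall z \near (a : R[i]^o), B z;
  cm_evlin : forall a c u v, B a -> H u -> H v -> ev a (c *: u + v) = c *: ev a u + ev a v;
  cm_evdiff : forall f a j, H f -> B a -> cdiff (fun z => ev z f j 0) a;
  cm_sep : forall f, H f -> (forall a, B a -> ev a f = 0) -> f = 0;
  cm_kH : forall a c, B a -> H (k a c);
  cm_kE : forall a c f, B a -> H f -> ip f (k a c) = dot c (ev a f);
  cm_XU : X \in unitmx;
  cm_Xh : adjmx X = X;
  cm_ker : forall l m c, B l -> B m -> l != m^* ->
     (- 'i * (l - m^*)) *: ev l (k m c) = (invmx X - Th l *m X *m adjmx (Th m)) *m c;
  cm_b0 : B b0;
  cm_b0R : complex.Im b0 = 0;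
  cm_Thb0 : mccont Th b0
}.

Section Core.
Variables (R : realType) (V : lmodType R[i]) (H : set V) (ip : V -> V -> R[i]).
Local Notation C := (R[i]).
Variables (n : nat) (B : set C) (ev : C -> V -> 'cV[C]_n) (X : 'M[C]_n)
  (Th : C -> 'M[C]_n) (k : C -> 'cV[C]_n -> V) (b0 : C) (J : V -> V) (s : seq V).
Hypothesis M : core_model H ip B ev X Th k b0 J s.
Let sH := cm_sub M.
Let sesq := cm_sesq M.
Let ph := cm_ph M.
Let Bopen := cm_open M.
Let evlin := cm_evlin M.
Let evdiff := cm_evdiff M.
Let sep := cm_sep M.
Let kH := cm_kH M.
Let kE := cm_kE M.
Let XU := cm_XU M.
Let Xh := cm_Xh M.
Let kerf0 := cm_ker M.
Let b0B := cm_b0 M.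
Let b0R := cm_b0R M.
Let Thb0 := cm_Thb0 M.

Lemma ev_D a u v : B a -> H u -> H v -> ev a (u + v) = ev a u + ev a v.
Proof. by move=> Ba hu hv; rewrite -{1}[u]scale1r evlin // scale1r. Qed.
Lemma ev_0 a : B a -> ev a 0 = 0.
Proof.
move=> Ba; have h0 := sub0 sH.
by apply: (@addrI _ (ev a 0)); rewrite -ev_D // !addr0.
Qed.
Lemma ev_Z a c u : B a -> H u -> ev a (c *: u) = c *: ev a u.
Proof.
move=> Ba hu; have h0 := sub0 sH.
by rewrite -[c *: u]addr0 evlin // ev_0 // addr0.
Qed.
Lemma ev_B a u v : B a -> H u -> H v -> ev a (u - v) = ev a u - ev a v.
Proof.
by move=> Ba hu hv; rewrite addrC -scaleN1r evlin // scaleN1r addrC.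
Qed.

Lemma ev_cont f a : H f -> B a -> mccont (fun z => ev z f) a.
Proof. by move=> hf Ba i j; rewrite ord1; exact: cdiff_ccont (evdiff i hf Ba). Qed.

Lemma ev_eq_generic f g a x y : H f -> H g -> B a ->
  (forall z, B z -> complex.Im z != 0 -> z != x -> z != y -> ev z f = ev z g) ->
  ev a f = ev a g.
Proof.
move=> hf hg Ba h; apply: (mccont_eq_lim (ev_cont hf Ba) (ev_cont hg Ba)) => d d0.
have [z [Bz zd zi zx zy]] := near_generic x y (Bopen Ba) d0.
by exists z => //; exact: h.
Qed.

Lemma sep_generic f x y : H f ->
  (forall z, B z -> complex.Im z != 0 -> z != x -> z != y -> ev z f = 0) -> f = 0.
Proof.
move=> hf h; apply: sep => // a Ba.
have h0 := sub0 sH; rewrite -(ev_0 Ba).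
by apply: (ev_eq_generic (x := x) (y := y)) => // z Bz zi zx zy; rewrite ev_0 // h.
Qed.

(** The graph of the transform R_a, which is not known beforehand to be defined
    everywhere. *)
Definition isR a f g := H g /\ forall z, B z -> (z - a) *: ev z g = ev z f - ev a f.

Lemma isR_H a f g : isR a f g -> H g. Proof. by case. Qed.

Lemma isR_off a f g : H g ->
  (forall z, B z -> z != a -> (z - a) *: ev z g = ev z f - ev a f) -> isR a f g.
Proof.
move=> hg h; split=> // z Bz; have [->|] := eqVneq z a; last exact: h.
by rewrite !subrr scale0r.
Qed.

Lemma isR_ev a f g z : isR a f g -> B z -> z != a -> ev z g = (z - a)^-1 *: (ev z f - ev a f).
Proof.
move=> [_ h] Bz za; rewrite -h // scalerA mulVf ?scale1r // subr_eq0 //.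
Qed.

Lemma isR_uniq a f g g' : isR a f g -> isR a f g' -> g = g'.
Proof.
move=> r r'; have [hg _] := r; have [hg' _] := r'.
apply/eqP; rewrite -subr_eq0; apply/eqP.
apply: (sep_generic (x := a) (y := a)); first exact: (subB sH).
by move=> z Bz _ za _; rewrite ev_B // (isR_ev r) // (isR_ev r') // subrr.
Qed.

Lemma isR_lin a c f f' g g' : B a -> H f -> H f' ->
  isR a f g -> isR a f' g' -> isR a (c *: f + f') (c *: g + g').
Proof.
move=> Ba hf hf' [hg rg] [hg' rg']; split; first exact: (subDZ sH).
move=> z Bz; rewrite !evlin // scalerDr scalerA mulrC -scalerA rg // rg' //.
by rewrite scalerBr opprD addrACA.
Qed.

Lemma isR0 a : B a -> isR a 0 0.
Proof.
move=> Ba; split; first exact: (sub0 sH).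
by move=> z Bz; rewrite !ev_0 // scaler0 subrr.
Qed.

Lemma isRB a f f' g g' : B a -> H f -> H f' ->
  isR a f g -> isR a f' g' -> isR a (f - f') (g - g').
Proof.
move=> Ba hf hf' rf rf'; rewrite ![_ - _ as X in isR _ X _]addrC.
rewrite -[- f']scaleN1r [g - g']addrC -[- g']scaleN1r; exact: isR_lin.
Qed.

(** The resolvent identity R_a R_b = (a - b)^-1 (R_a - R_b). *)
Lemma isR_comp a b f g h : B a -> B b -> a != b -> H f ->
  isR a f g -> isR b f h -> isR a h ((a - b)^-1 *: (g - h)).
Proof.
move=> Ba Bb ab hf rg rh; have hg := isR_H rg; have hh := isR_H rh.
have hgh : H (g - h) by exact: (subB sH).
have ab0 : a - b != 0 by rewrite subr_eq0.
apply: isR_off; first exact: (subZ sH).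
move=> z Bz za; have za0 : z - a != 0 by rewrite subr_eq0.
rewrite ev_Z // ev_B // (isR_ev rg) // (isR_ev rh Ba) //.
have [_ /(_ z Bz) ez] := rh.
have {ez} -> : ev z f = ev b f + (z - b) *: ev z h by rewrite ez addrC subrK.
set u := ev z h; set v := ev a f; set w := ev b f.
apply/matrixP => i j; rewrite !mxE; field; by rewrite za0 ab0.
Qed.

(** The limit of the kernel identity as its first point approaches b0. *)
Lemma Th0_id : Th b0 *m X *m adjmx (Th b0) = invmx X.
Proof.
have b0c : b0^* = b0 by apply/conj_fixP.
apply/matrixP => i j.
have e1 (Y : 'M[C]_n) : Y i j = (Y *m delta_mx j (0 : 'I_1)) i 0.
  by rewrite -colE mxE.
rewrite [LHS]e1 [RHS]e1; set c := delta_mx j 0.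
have hk := kH c b0B.
have hc : mccont (fun l => invmx X *m c - (- 'i * (l - b0)) *: ev l (k b0 c)) b0.
  apply: mccontB; first exact: mccont_cst.
  apply: mccontZ; last exact: ev_cont.
  apply: ccontM; first exact: ccont_cst.
  by apply: ccontB; [exact: ccont_id|exact: ccont_cst].
have hT : mccont (fun l => Th l *m X *m adjmx (Th b0) *m c) b0.
  by do 3![apply: mccontM; last exact: mccont_cst].
have h d : 0 < d -> exists2 y, nsq (y - b0) < d &
   invmx X *m c - (- 'i * (y - b0)) *: ev y (k b0 c) = Th y *m X *m adjmx (Th b0) *m c.
  move=> /(near_generic b0 b0 (Bopen b0B)) [z [Bz zd _ zb _]]; exists z => //.
  by have := @kerf0 z b0 c Bz b0B; rewrite b0c => -> //; rewrite mulmxBl opprB addrC subrK.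
have := mccont_eq_lim hc hT h.
by rewrite subrr mulr0 scale0r subr0 => <-.
Qed.

Lemma Thb0U : X *m adjmx (Th b0) \in unitmx.
Proof.
have h : Th b0 *m (X *m adjmx (Th b0)) = invmx X by rewrite mulmxA Th0_id.
have : Th b0 *m (X *m adjmx (Th b0)) \in unitmx by rewrite h unitmx_inv.
by rewrite unitmx_mul => /andP[].
Qed.

(** Solving the kernel identity with second point b0 for Th expresses it through
    evaluations, which are continuous. *)
Lemma ThC l : B l -> mccont Th l.
Proof.
move=> Bl; have [->|lb] := eqVneq l b0; first exact: Thb0.
have b0c : b0^* = b0 by apply/conj_fixP.
pose K z : 'M[C]_n := \matrix_(i, j) ev z (k b0 (delta_mx j 0)) i 0.
pose G z := (invmx X - (- 'i * (z - b0)) *: K z) *m invmx (X *m adjmx (Th b0)).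
have hG : mccont G l.
  apply: mccontM; last exact: mccont_cst.
  apply: mccontB; first exact: mccont_cst.
  apply: mccontZ.
    apply: ccontM; first exact: ccont_cst.
    by apply: ccontB; [exact: ccont_id|exact: ccont_cst].
  move=> i j; rewrite (_ : (fun y => _) = fun y => ev y (k b0 (delta_mx j 0)) i 0).
    exact: (ev_cont (kH _ b0B) Bl).
  by apply/funext => y; rewrite mxE.
apply: mccont_eq_near hG _.
apply: filterS2 (Bopen Bl) (near_neq lb) => z Bz zb.
rewrite /G; apply: (canLR (mulmxK Thb0U)); rewrite mulmxA.
apply/matrixP => i j.
have := @kerf0 z b0 (delta_mx j 0) Bz b0B; rewrite b0c => /(_ zb) /matrixP /(_ i 0).
rewrite -colE !mxE => ->; by rewrite opprB addrC subrK.
Qed.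

Lemma Th_id l : B l -> B l^* -> Th l *m X *m adjmx (Th l^*) = invmx X.
Proof.
move=> Bl Bl'; apply/matrixP => i j.
have e1 (Y : 'M[C]_n) : Y i j = (Y *m delta_mx j (0 : 'I_1)) i 0.
  by rewrite -colE mxE.
rewrite [LHS]e1 [RHS]e1; set c := delta_mx j 0.
have hk := kH c Bl'.
have hc : mccont (fun y => invmx X *m c - (- 'i * (y - l)) *: ev y (k l^* c)) l.
  apply: mccontB; first exact: mccont_cst.
  apply: mccontZ; last exact: ev_cont.
  apply: ccontM; first exact: ccont_cst.
  by apply: ccontB; [exact: ccont_id|exact: ccont_cst].
have hT : mccont (fun y => Th y *m X *m adjmx (Th l^*) *m c) l.
  by do 3![apply: mccontM; last exact: mccont_cst]; exact: ThC.
have h d : 0 < d -> exists2 y, nsq (y - l) < d &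
   invmx X *m c - (- 'i * (y - l)) *: ev y (k l^* c) = Th y *m X *m adjmx (Th l^*) *m c.
  move=> /(near_generic l l (Bopen Bl)) [z [Bz zd _ zb _]]; exists z => //.
  have := @kerf0 z l^* c Bz Bl'; rewrite conjCK => -> //.
  by rewrite mulmxBl opprB addrC subrK.
have := mccont_eq_lim hc hT h.
by rewrite subrr mulr0 scale0r subr0 => <-.
Qed.

Lemma kerf l m c : B l -> B m ->
  (- 'i * (l - m^*)) *: ev l (k m c) = (invmx X - Th l *m X *m adjmx (Th m)) *m c.
Proof.
move=> Bl Bm; have [e|] := eqVneq l m^*; last exact: kerf0.
have hm : m = l^* by rewrite e conjCK.
by rewrite -e subrr mulr0 scale0r {1}hm Th_id ?subrr ?mul0mx // -hm.
Qed.

Lemma Th_id' l : B l -> B l^* -> X *m adjmx (Th l^*) *m X *m Th l = 1%:M.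
Proof.
move=> Bl Bl'; apply: mulmx1C; rewrite !mulmxA Th_id // mulVmx //.
Qed.

(** R_a of a kernel vector is a combination of two kernel vectors: the one at
    a^* is chosen so that its contributions cancel by Th_id. *)
Definition Rk a m c := (a - m^*)^-1 *:
  (k a^* (X *m Th a *m X *m adjmx (Th m) *m c) - k m c).

Lemma isR_k a m c : B a -> B a^* -> B m -> a != m^* -> isR a (k m c) (Rk a m c).
Proof.
move=> Ba Ba' Bm am; have am0 : a - m^* != 0 by rewrite subr_eq0.
set d := X *m Th a *m X *m adjmx (Th m) *m c.
have hkm := kH c Bm; have hka := kH d Ba'.
have hB : H (k a^* d - k m c) by exact: (subB sH).
apply: isR_off; first exact: (subZ sH).
move=> z Bz za; rewrite ev_Z // ev_B // scalerA.
have h1 := kerf d Bz Ba'; have h2 := kerf c Bz Bm; have h3 := kerf c Ba Bm.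
rewrite conjCK in h1.
have i0 : - 'i != 0 :> C by rewrite oppr_eq0 neq0Ci.
have e : (invmx X - Th z *m X *m adjmx (Th a^*)) *m d =
   (invmx X - Th z *m X *m adjmx (Th m)) *m c - (invmx X - Th a *m X *m adjmx (Th m)) *m c.
  have h4 : invmx X *m d = Th a *m X *m adjmx (Th m) *m c.
    by rewrite /d -!mulmxA mulKmx.
  have h5 : Th z *m X *m adjmx (Th a^*) *m d = Th z *m X *m adjmx (Th m) *m c.
    transitivity (Th z *m (X *m adjmx (Th a^*) *m X *m Th a) *m (X *m (adjmx (Th m) *m c))).
      by rewrite /d -!mulmxA.
    by rewrite (Th_id' Ba Ba') mulmx1 -!mulmxA.
  exact: mulmx_sub_aux h4 h5.
have {h1 h2 h3} e' : (- 'i * (z - a)) *: ev z (k a^* d) =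
   (- 'i * (z - m^*)) *: ev z (k m c) - (- 'i * (a - m^*)) *: ev a (k m c).
  exact: (etrans h1 (etrans e (f_equal2 (fun x y => x - y) (esym h2) (esym h3)))).
move: e'; move: (ev z (k a^* d)) (ev z (k m c)) (ev a (k m c)) => u v w e'.
apply/matrixP => i j; move/matrixP: e' => /(_ i j); rewrite !mxE => e'.
apply: (mulfI i0); apply: (mulfI am0).
have -> : (a - m^*) * (- 'i * ((z - a) * (a - m^*)^-1 * (u i j - v i j))) =
  - 'i * (z - a) * u i j - - 'i * (z - a) * v i j by field.
by rewrite e'; ring.
Qed.

(** The identity of condition (1) at the pair (a, a), for f, g = R_a f, f' and
    g' = R_a f'. *)
Definition Rid a f g f' g' :=
  ip g f' - ip f g' - (a - a^*) * ip g g' = 'i * dot (ev a f') (X *m ev a f).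

Lemma Rid_k a m c f g : B a -> B a^* -> B m -> m != a^* -> H f -> isR a f g ->
  Rid a f g (k m c) (Rk a m c).
Proof.
move=> Ba Ba' Bm ma hf rg; have hg := isR_H rg.
have am : a != m^* by apply: contraNneq ma => ->; rewrite conjCK.
have am0 : a^* - m != 0.
  by rewrite subr_eq0; apply: contraNneq ma => <-.
rewrite /Rid /Rk; set d := X *m Th a *m X *m adjmx (Th m) *m c.
have hkm := kH c Bm; have hka := kH d Ba'.
have hB : H (k a^* d - k m c) by exact: (subB sH).
rewrite !(ipZr sH sesq) // !(ipBr sH sesq) // !kE //.
have -> : ((a - m^*)^-1)^* = (a^* - m)^-1 by rewrite fmorphV rmorphB /= conjCK.
apply: (mulfI am0).
have [_ rz] := rg.
have e1 : (m - a) * dot c (ev m g) = dot c (ev m f) - dot c (ev a f).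
  by rewrite -dotZr rz // dotBr.
have e2 : (a^* - a) * dot d (ev a^* g) = dot d (ev a^* f) - dot d (ev a f).
  by rewrite -dotZr rz // dotBr.
have e3 : (a^* - m) * ('i * dot (ev a (k m c)) (X *m ev a f)) =
    dot c (ev a f) - dot d (ev a f).
  have h := kerf c Ba Bm.
  have -> : (a^* - m) * ('i * dot (ev a (k m c)) (X *m ev a f)) =
      dot ((- 'i * (a - m^*)) *: ev a (k m c)) (X *m ev a f).
    by rewrite dotZl rmorphM rmorphN rmorphB /= conjCi opprK conjCK; ring.
  rewrite h dot_mxBl; congr (_ - _); rewrite /dot.
    by rewrite adjmxM (adjmx_inv XU) Xh -!mulmxA (mulKmx XU).
  by rewrite /d !adjmxM !adjmxK Xh !mulmxA.
rewrite e3.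
have -> : (a^* - m) * (dot c (ev m g) - (a^* - m)^-1 * (dot d (ev a^* f) - dot c (ev m f)) -
    (a - a^*) * ((a^* - m)^-1 * (dot d (ev a^* g) - dot c (ev m g)))) =
  - ((m - a) * dot c (ev m g)) + dot c (ev m f) - dot d (ev a^* f) + (a^* - a) * dot d (ev a^* g).
  by field.
rewrite e1 e2; ring.
Qed.

(** The linear span of the kernel vectors at the points of T, as the
    intersection of the subspaces containing them: applying a membership proof
    to a suitable subspace is induction over the span. *)
Definition kspan (T : set C) (u : V) := forall W : set V,
  Defs.subspace W -> (forall m c, T m -> W (k m c)) -> W u.

Lemma kspan_sub T : Defs.subspace (kspan T).
Proof.
split; first by move=> W sW _; exact: (sub0 sW).
by move=> c u v hu hv W sW hW; apply: (subDZ sW); [exact: hu|exact: hv].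
Qed.

Lemma kspan_k (T : set C) m c : T m -> kspan T (k m c).
Proof. by move=> Tm W _; exact. Qed.

Lemma kspanH T : T `<=` B -> kspan T `<=` H.
Proof. by move=> TB u; apply => // m c /TB; exact: kH. Qed.

Definition hip u v := ip u (J v).
Local Notation q := (qf hip).
Lemma hip_hilbert : hilbert H hip. Proof. exact: phhilb ph. Qed.
Let hilb := hip_hilbert.
Lemma hip_sesq : sesquilinear_on H hip. Proof. by case: hilb. Qed.
Let hsesq := hip_sesq.
Lemma J_H u : H u -> H (J u). Proof. exact: phJ ph _. Qed.

Lemma q_ge0 u : H u -> 0 <= q u. Proof. exact: (qf_ge0 hilb). Qed.

Lemma qJ u : H u -> q (J u) = q u.
Proof.
move=> hu; rewrite /qf /hip (phJK ph) // (phJsym ph) //.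
Qed.

Lemma ip_cs u v : H u -> H v -> nsq (ip u v) <= q u * q v.
Proof.
move=> hu hv; have hJ := J_H hv.
by rewrite -(qJ hv) -{1}(phJK ph hv); exact: (cauchy_schwarz hilb).
Qed.

(** The Hilbert norm is the indefinite form corrected on the negative part. *)
Lemma qE u : H u -> q u = complex.Re (ip u u) + 2 * \sum_(x <- s) nsq (ip u x).
Proof.
move=> hu; rewrite /qf /hip (phneg ph) //.
have hx x : x \in s -> H x by move=> /(phs ph) [].
have hS : H (\sum_(x <- s) ip u x *: x).
  by apply: (sub_sum sH) => x /hx hx'; exact: (subZ sH).
rewrite (ipDr sH sesq) //; last exact: (subZ sH).
rewrite (ipZr sH sesq) // (ip_sumr sH sesq) //; last first.
  by move=> x /hx hx'; exact: (subZ sH).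
have -> : \sum_(x <- s) ip u (ip u x *: x) = ((\sum_(x <- s) nsq (ip u x))%:C)%C.
  rewrite rmorph_sum big_seq [RHS]big_seq; apply: eq_bigr => x /hx hx'.
  by rewrite (ipZr sH sesq) // /= nsqE mulrC.
have -> : (2 : C)^* = (2%:C)%C by rewrite conjC_nat rmorph_nat.
by rewrite -rmorphM /= raddfD.
Qed.

(** A vector whose pairings with the kernel vectors vanish has zero values. *)
Lemma kspan_dense (T : set C) : T `<=` B ->
  (forall f, H f -> (forall a, T a -> ev a f = 0) -> f = 0) ->
  forall x e, H x -> 0 < e -> exists2 d, kspan T d & q (x - d) < e.
Proof.
move=> TB sepT; apply: (dense_of_orthogonal hilb); first exact: kspan_sub.
  exact: kspanH.
move=> v hv orth; have hJ := J_H hv.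
suff Jv : J v = 0.
  by apply: (qf_eq0 hilb hv); rewrite -qJ // Jv; exact: (qf0 sH hsesq).
apply: sepT => // a Ta; apply/matrixP => j i; rewrite ord1 [RHS]mxE.
have := orth _ (kspan_k (delta_mx j 0) Ta).
by rewrite /hip -(phJsym ph) ?kE ?dot_delta //; [exact: TB|exact: kH (TB _ Ta)].
Qed.

Lemma q_ev a u j : B a -> H u -> nsq (ev a u j 0) <= q u * q (k a (delta_mx j 0)).
Proof.
move=> Ba hu; rewrite -dot_delta -kE //; apply: ip_cs => //; exact: kH.
Qed.

End Core.

(** * A priori bounds *)

Section Bounds.
Variables (R : realType) (V : lmodType R[i]) (H : set V) (ip : V -> V -> R[i]).
Local Notation C := (R[i]).
Variables (n : nat) (B : set C) (ev : C -> V -> 'cV[C]_n) (X : 'M[C]_n)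
  (Th : C -> 'M[C]_n) (k : C -> 'cV[C]_n -> V) (b0 : C) (J : V -> V) (s : seq V).
Hypothesis M : core_model H ip B ev X Th k b0 J s.
Let sH := cm_sub M.
Let sesq := cm_sesq M.
Let kH := cm_kH M.
Let kE := cm_kE M.
Let ph := cm_ph M.
Let hsesq := hip_sesq M.
Let hilb := hip_hilbert M.
Local Notation q := (qf (hip ip J)).
Local Notation isR := (isR H B ev).
Local Notation Rid := (Rid ip ev X).
Local Notation kspan := (kspan k).

(** The identity is established for f arbitrary and f' in the kernel span: this
    is enough for the a priori bounds, which only use f = f' in that span. *)
Lemma kspan_R (T : set C) a f' : B a -> B a^* -> T `<=` B -> (forall m, T m -> m != a^*) ->
  kspan T f' -> exists2 g', isR a f' g' &
    forall f g, H f -> isR a f g -> Rid a f g f' g'.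
Proof.
move=> Ba Ba' TB Ta hf'.
pose W := [set f' | H f' /\ exists2 g', isR a f' g' &
    forall f g, H f -> isR a f g -> Rid a f g f' g'].
suff [] : W f' by [].
apply: hf' => [|m c Tm].
  split.
    split; first exact: sub0 sH.
    exists 0; first exact: isR0 M _ Ba.
    move=> f g hf rg; have hg := isR_H rg.
    by rewrite /Rid (ev_0 M Ba) !(ip0r sH sesq) // dotC dot0r conjC0; ring.
  move=> c u v [hu [gu ru iu]] [hv [gv rv iv]]; split; first exact: (subDZ sH).
  exists (c *: gu + gv); first exact: (isR_lin M c Ba hu hv ru rv).
  move=> f g hf rg; have hg := isR_H rg; have hgu := isR_H ru; have hgv := isR_H rv.
  have := iu f g hf rg; have := iv f g hf rg; rewrite /Rid => e1 e2.
  rewrite !(ipDZr sH sesq) // (cm_evlin M) // dotDl dotZl.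
  have -> : 'i * (c^* * dot (ev a u) (X *m ev a f) + dot (ev a v) (X *m ev a f)) =
    c^* * ('i * dot (ev a u) (X *m ev a f)) + 'i * dot (ev a v) (X *m ev a f) by ring.
  by rewrite -e1 -e2; ring.
have Bm := TB _ Tm; have am : a != m^*.
  by apply: contraNneq (Ta _ Tm) => ->; rewrite conjCK.
split; first exact: kH.
exists (Rk X Th k a m c); first exact: isR_k M _ _ _ Ba Ba' Bm am.
by move=> f g hf rg; apply: (Rid_k M) => //; exact: Ta.
Qed.

(** The pairing of R_a f with a kernel vector at m is a value of R_a f at m,
    that is, a difference quotient of f; it is under control as long as a stays
    away from m, whether or not R_a is bounded. *)
Lemma kspan_pairing (T : set C) u : T `<=` B -> kspan T u ->
  exists S : seq C, (forall x, x \in S -> T x) /\ forall N : R, 0 <= N ->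
    exists2 c : R, 0 <= c & forall a f g, B a -> H f -> isR a f g ->
      (forall x, x \in S -> x != a /\ nsq (x - a)^-1 <= N) ->
      nsq (ip g u) <= c * (q f + nsqv (ev a f)).
Proof.
move=> TB hu.
pose W := [set u | H u /\ exists S : seq C, (forall x, x \in S -> T x) /\ forall N : R, 0 <= N ->
    exists2 c : R, 0 <= c & forall a f g, B a -> H f -> isR a f g ->
      (forall x, x \in S -> x != a /\ nsq (x - a)^-1 <= N) ->
      nsq (ip g u) <= c * (q f + nsqv (ev a f))].
suff [] : W u by [].
apply: hu => [|m d Tm].
  split.
    split; first exact: sub0 sH.
    exists [::]; split => // N N0; exists 0 => // a f g Ba hf rg _.
    by rewrite (ip0r sH sesq) ?nsq0 ?mul0r //; exact: isR_H rg.
  move=> c u1 u2 [hu1 [S1 [hS1 b1]]] [hu2 [S2 [hS2 b2]]].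
  split; first exact: (subDZ sH).
  exists (S1 ++ S2); split.
    by move=> x; rewrite mem_cat => /orP[/hS1|/hS2].
  move=> N N0; have [c1 c10 h1] := b1 N N0; have [c2 c20 h2] := b2 N N0.
  exists (2 * (nsq c * c1 + c2)).
    by rewrite mulr_ge0 // addr_ge0 // mulr_ge0 ?nsq_ge0.
  move=> a f g Ba hf rg hx; have hg := isR_H rg.
  rewrite (ipDZr sH sesq) //; apply: le_trans (nsqD_le _ _) _.
  rewrite nsqM nsq_conj -mulrA ler_pM2l ?ltr0n // mulrDl; apply: lerD.
    rewrite -mulrA ler_wpM2l ?nsq_ge0 //; apply: h1 => // x xS.
    by apply: hx; rewrite mem_cat xS.
  by apply: h2 => // x xS; apply: hx; rewrite mem_cat xS orbT.
have Bm := TB _ Tm; have hk := kH d Bm.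
split => //; exists [:: m]; split; first by move=> x; rewrite inE => /eqP ->.
move=> N N0.
have qk0 := q_ge0 M hk; have nd0 := nsqv_ge0 d.
pose c := 2 * N * (q (k m d) + 2 ^+ n * nsqv d).
have p2 : 0 <= 2 ^+ n * nsqv d by rewrite mulr_ge0 ?exprn_ge0.
exists c; first by rewrite !mulr_ge0 // addr_ge0.
move=> a f g Ba hf rg hx; have hg := isR_H rg.
have [ma mN] := hx m (mem_head _ _).
rewrite kE // (isR_ev rg) // dotZr nsqM dotBr -kE //.
have h1 := ip_cs M hf hk; have h2 := nsq_dot_le d (ev a f).
have h3 := nsqD_le (ip f (k m d)) (- dot d (ev a f)); rewrite nsqN in h3.
have qf0 := q_ge0 M hf; have ne0 := nsqv_ge0 (ev a f).
apply: (@le_trans _ _ (N * (2 * (nsq (ip f (k m d)) + nsq (dot d (ev a f)))))).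
  by apply: ler_pM; rewrite ?nsq_ge0.
rewrite /c mulrCA -!mulrA ler_pM2l ?ltr0n // ler_wpM2l //.
move: h1 h2; set A := nsq _; set D := nsq (dot _ _); move=> h1 h2.
have : 0 <= q (k m d) * nsqv (ev a f) by rewrite mulr_ge0.
have : 0 <= 2 ^+ n * nsqv d * q f by rewrite mulr_ge0.
by nra.
Qed.

Section Estimate.
Variable G : set C.
Hypotheses (Gcomp : compact (G : set C^o)) (GB : forall a, G a -> B a)
  (GB' : forall a, G a -> B a^*).

Lemma im_bound : exists2 Y : R, 0 < Y & forall a, G a -> `|complex.Im a| <= Y.
Proof.
have [Y hY] := compact_nsq_bounded Gcomp (fun z _ => @ccont_id R z).
exists (1 + `|Y|); first by rewrite ltr_pwDl.
move=> a /hY h; have := Im_sqr_le a; have := ler_norm Y.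
move=> h1 h2; rewrite -ler_sqr ?nnegrE ?addr_ge0 // real_normK ?num_real //.
have := normr_ge0 Y; nra.
Qed.

Lemma mx_bound m p (F : C -> 'M[C]_(m, p)) : (forall a, G a -> mccont F a) ->
  exists2 c : R, 0 <= c & forall a i j, G a -> nsq (F a i j) <= c.
Proof.
move=> hF.
have hc i j : exists c : R, forall a, G a -> nsq (F a i j) <= c.
  by apply: compact_nsq_bounded => // z /hF; apply.
have /choice[c1 hc1] : forall ij : 'I_m * 'I_p, exists c : R, forall a, G a -> nsq (F a ij.1 ij.2) <= c.
  by move=> ij; exact: hc.
exists (\sum_ij `|c1 ij|); first by apply: sumr_ge0.
move=> a i j Ga; apply: le_trans (hc1 (i, j) a Ga) _.
apply: le_trans (ler_norm _) _; rewrite (bigD1 (i, j)) //= lerDl.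
exact: sumr_ge0.
Qed.

Lemma mccont_adj m p (F : C -> 'M[C]_(m, p)) z : mccont F z -> mccont (fun y => adjmx (F y)) z.
Proof.
move=> h i j; rewrite (_ : (fun y => _) = fun y => (F y j i)^*).
  by apply: (@ccont_comp _ _ Num.conj); [exact: h|exact: ccont_conj].
by apply/funext => y; rewrite adjmxE.
Qed.

(** On the diagonal the kernel identity carries the factor 2 Im a, so the norm of
    a kernel vector at a is O(|Im a|^(-1/2)). *)
Lemma ev_bound : exists2 c : R, 0 <= c & forall a f, G a -> complex.Im a != 0 -> H f ->
  nsqv (ev a f) <= c / `|complex.Im a| * q f.
Proof.
have [w w0 hw] : exists2 w : R, 0 <= w & forall a i j, G a ->
    nsq ((invmx X - Th a *m X *m adjmx (Th a)) i j) <= w.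
  apply: (@mx_bound _ _ (fun a => invmx X - Th a *m X *m adjmx (Th a))) => a Ga.
  have ca := ThC M (GB Ga).
  apply: mccontB; first exact: mccont_cst.
  apply: mccontM; last exact: mccont_adj.
  by apply: mccontM => //; exact: mccont_cst.
have [Y Y0 hY] := im_bound.
have hs x : x \in s -> H x by move=> /(phs ph) [].
have [e e0 he] : exists2 e : R, 0 <= e & forall a j, G a -> \sum_(x <- s) nsq (ev a x j 0) <= e.
  elim: (s) hs => [|x s' ih] hs'; first by exists 0 => // a j _; rewrite big_nil.
  have [|e1 e10 h1] := ih; first by move=> y ys; apply: hs'; rewrite inE ys orbT.
  have [|e2 e20 h2] := @mx_bound _ _ (fun a => ev a x).
    by move=> a Ga; apply: (ev_cont M) (GB Ga); apply: hs'; rewrite inE eqxx.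
  exists (e2 + e1); first exact: addr_ge0.
  by move=> a j Ga; rewrite big_cons; apply: lerD; [exact: h2|exact: h1].
pose c1 := (1 + w) / 2 + 2 * e * Y.
have c10 : 0 <= c1 by rewrite addr_ge0 ?divr_ge0 ?addr_ge0 ?mulr_ge0 // ltW.
have key a j : G a -> complex.Im a != 0 -> q (k a (delta_mx j 0)) <= c1 / `|complex.Im a|.
  move=> Ga ya; have Ba := GB Ga; have hk := kH (delta_mx j 0) Ba.
  have y0 : 0 < `|complex.Im a| by rewrite normr_gt0.
  rewrite ler_pdivlMr // (qE M) // mulrDl; apply: lerD.
    have h := hw a j j Ga; move: h.
    have hker := kerf M (delta_mx j 0) Ba Ba; rewrite -colE in hker.
    have := congr1 (fun u : 'cV[C]_n => u j 0) hker; rewrite !mxE => <-.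
    rewrite -(dot_delta j (ev a _)) -kE // (qfE sesq) // /qf.
    have -> : - 'i * (a - a^*) = (((2 * complex.Im a)%:C)%C) :> C.
      by case: (a) => u v; apply/eqP; rewrite eq_complex /=; apply/andP; split; apply/eqP; ring.
    rewrite -rmorphM /= nsq_real => h.
    set t := complex.Re _ in h *; set y := complex.Im a in h y0 *.
    have : (t * `|y|) ^+ 2 * 4 <= w by rewrite exprMn real_normK ?num_real //; move: h; lra.
    move=> {h} h; have := sqr_ge0 (t * `|y| - 1 / 2); move: h.
    by rewrite !expr2; lra.
  apply: le_trans (_ : 2 * e * `|complex.Im a| <= _).
    rewrite ler_wpM2r // ler_pM2l ?ltr0n //.
    apply: le_trans (he a j Ga); rewrite le_eqVlt; apply/orP; left; apply/eqP.
    rewrite big_seq [RHS]big_seq; apply: eq_bigr => x /hs hx.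
    by rewrite (ipC sesq hx hk) nsq_conj kE // dot_delta.
  by rewrite ler_wpM2l ?hY // mulr_ge0.
exists (n%:R * c1); first by rewrite mulr_ge0.
move=> a f Ga ya hf; rewrite /nsqv.
have -> : n%:R * c1 / `|complex.Im a| * q f = \sum_(j < n) c1 / `|complex.Im a| * q f.
  by rewrite sumr_const card_ord -[RHS]mulr_natl; ring.
apply: ler_sum => j _; apply: le_trans (q_ev M j (GB Ga) hf) _.
by rewrite mulrC ler_wpM2r ?(q_ge0 M) // key.
Qed.

(** The imaginary part of the identity at the pair (a, a) bounds the indefinite
    square of R_a f.  To reach the Hilbert norm, its pairings with the negative
    vectors x of s must be added: they are replaced by the pairings with vectors
    u x of the kernel span, so close to x that the difference is absorbed by a
    fraction of the norm of R_a f.  The constant is uniform over G. *)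
Lemma R_bound (u : V -> V) :
  (forall x, x \in s -> [/\ H (u x), 16 * (size s)%:R * q (x - u x) <= 1 &
     exists2 c : R, 0 <= c & forall a f g, G a -> H f -> isR a f g ->
       nsq (ip g (u x)) <= c * (q f + nsqv (ev a f))]) ->
  exists2 c : R, 0 <= c & forall a f g, G a -> complex.Im a != 0 -> H f -> isR a f g ->
    Rid a f g f g -> q g <= c / complex.Im a ^+ 2 * q f.
Proof.
move=> hu; have [Y Y0 hY] := im_bound; have [ce ce0 hev] := ev_bound.
have [cx cx0 hX] := dot_mx_bound X.
have hs x : x \in s -> H x by move=> /(phs ph) [].
have [cu cu0 hcu] : exists2 c : R, 0 <= c & forall a f g, G a -> H f -> isR a f g ->
       \sum_(x <- s) nsq (ip g (u x)) <= c * (q f + nsqv (ev a f)).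
  have : forall x, x \in s -> exists2 c : R, 0 <= c & forall a f g, G a -> H f -> isR a f g ->
       nsq (ip g (u x)) <= c * (q f + nsqv (ev a f)) by move=> x /hu[].
  elim: (s) => [|x s' ih] h; first by exists 0 => // a f g _ _ _; rewrite big_nil mul0r.
  have [c1 c10 h1] := h x (mem_head _ _).
  have [|c2 c20 h2] := ih; first by move=> y ys; apply: h; rewrite inE ys orbT.
  exists (c1 + c2); first exact: addr_ge0.
  by move=> a f g Ga hf rg; rewrite big_cons mulrDl; apply: lerD; [exact: h1 rg|exact: h2 rg].
pose c := 2 + cx * ce + 8 * cu * (Y ^+ 2 + ce * Y).
have Y20 : 0 <= Y ^+ 2 + ce * Y.
  by rewrite addr_ge0 ?sqr_ge0 // mulr_ge0 // ltW.
have c0 : 0 <= c by rewrite !addr_ge0 // !mulr_ge0.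
exists c => // a f g Ga ya hf rg rid; have hg := isR_H rg.
set y := complex.Im a in ya *.
have y0 : 0 < `|y| by rewrite normr_gt0.
have yY : `|y| <= Y by exact: hY.
have qf0 := q_ge0 M hf; have qg0 := q_ge0 M hg.
have he := hev a f Ga ya hf; have ev0 := nsqv_ge0 (ev a f); rewrite -/y in he.
(* 16 (size s) q (x - u x) <= 1 makes the total error at most q g / 4 *)
have neg : 2 * \sum_(x <- s) nsq (ip g x) <= 4 * \sum_(x <- s) nsq (ip g (u x)) + q g / 4.
  have : forall x, x \in s ->
      nsq (ip g x) <= 2 * nsq (ip g (u x)) + 2 * (q g * q (x - u x)).
    move=> x xs; have [hux hqx _] := hu x xs; have hx := hs x xs.
    have hxu : H (x - u x) by exact: (subB sH).
    have -> : ip g x = ip g (u x) + ip g (x - u x).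
      by rewrite (ipBr sH sesq) // addrC subrK.
    apply: le_trans (nsqD_le _ _) _; rewrite mulrDr; apply: lerD => //.
    by rewrite ler_pM2l ?ltr0n //; exact: (ip_cs M).
  move=> h1.
  have h2 x : x \in s -> nsq (ip g x) <= 2 * nsq (ip g (u x)) + q g / (8 * (size s)%:R).
    move=> xs; apply: le_trans (h1 x xs) _; apply: lerD => //.
    have [hux hqx _] := hu x xs.
    have s0 : 0 < (size s)%:R :> R by rewrite ltr0n; case: (s) xs.
    rewrite ler_pdivlMr ?mulr_gt0 //.
    have : q g * (16 * (size s)%:R * q (x - u x)) <= q g * 1 by rewrite ler_wpM2l.
    by lra.
  have : \sum_(x <- s) nsq (ip g x) <= \sum_(x <- s) (2 * nsq (ip g (u x)) + q g / (8 * (size s)%:R)).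
    by rewrite big_seq [X in _ <= X]big_seq; apply: ler_sum => x /h2.
  rewrite big_split /= -mulr_sumr big_const_seq count_predT iter_addr_0.
  have : (q g / (8 * (size s)%:R)) *+ size s <= q g / 8.
    case: (size s) => [|m]; first by rewrite mulr0n divr_ge0.
    have m0 : m.+1%:R != 0 :> R by rewrite pnatr_eq0.
    by rewrite -mulr_natr invfM mulrA divfK.
  set A := \sum_(x <- s) nsq (ip g x); set D := \sum_(x <- s) _.
  by set E := _ *+ _; lra.
have neg2 := hcu a f g Ga hf rg.
(* the rest of the weight q g / 4 goes to the mixed term, by AM-GM *)
have form : complex.Re (ip g g) <= q g / 4 + q f / y ^+ 2 + cx * nsqv (ev a f) / (2 * `|y|).
  move: rid; rewrite /Rid (ipC sesq hg hf) (qfE sesq hg) => rid.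
  have h1 : 2 * y * qf ip g = 2 * complex.Im (ip g f) - complex.Re (dot (ev a f) (X *m ev a f)).
    move: rid; rewrite /y; case: (a) (ip g f) (dot _ _) => a1 a2 [d1 d2] [e1 e2].
    rewrite -complexiE; move/eqP; rewrite eq_complex /= => /andP[/eqP h1 /eqP h2]; lra.
  have h2 := hX (ev a f); have h3 := ip_cs M hg hf.
  have h4 := le_trans (Im_sqr_le _) h3.
  set t := complex.Im _ in h1 h4; set D := complex.Re (dot _ _) in h1 h2.
  rewrite -[complex.Re (ip g g)]/(qf ip g); set p := qf ip g in h1 *.
  have h5 : p * `|y| <= `|t| + `|D| / 2.
    have : `|2 * y * p| <= `|2 * t| + `|D| by rewrite h1; exact: ler_normB.
    rewrite !normrM [`|2|]ger0_norm // => h5.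
    have : p * `|y| <= `|y| * `|p| by rewrite mulrC ler_wpM2l // ler_norm.
    by lra.
  have h6 : `|t| <= (q g / 4 + q f / y ^+ 2) * `|y|.
    rewrite -ler_sqr ?nnegrE ?mulr_ge0 ?addr_ge0 ?divr_ge0 ?sqr_ge0 //.
    rewrite real_normK ?num_real // exprMn [`|y| ^+ 2]real_normK ?num_real //.
    apply: le_trans h4 _.
    have yy : y ^+ 2 != 0 by rewrite sqrf_eq0.
    have -> : (q g / 4 + q f / y ^+ 2) ^+ 2 * y ^+ 2 =
       q g * q f + (q g / 4 - q f / y ^+ 2) ^+ 2 * y ^+ 2 by field.
    by rewrite lerDl mulr_ge0 ?sqr_ge0.
  rewrite -(ler_pM2r y0); apply: le_trans h5 _; rewrite mulrDl; apply: lerD => //.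
  have -> : cx * nsqv (ev a f) / (2 * `|y|) * `|y| = cx * nsqv (ev a f) / 2.
    by field; rewrite gt_eqF.
  by rewrite ler_pM2r // invr_gt0.
have yy : 0 < y ^+ 2 by rewrite exprn_even_gt0.
have y2 : `|y| ^+ 2 = y ^+ 2 by rewrite real_normK ?num_real.
rewrite mulrAC ler_pdivlMr //.
have key : q g <= 2 * (q f / y ^+ 2) + cx * nsqv (ev a f) / `|y| + 8 * (cu * (q f + nsqv (ev a f))).
  have := qE M hg.
  have e1 : cx * nsqv (ev a f) / (2 * `|y|) = cx * nsqv (ev a f) / `|y| / 2.
    by field; rewrite gt_eqF.
  by move: neg neg2 form; rewrite e1; lra.
have h1 : q f / y ^+ 2 * y ^+ 2 = q f by rewrite divfK // gt_eqF.
have h2 : nsqv (ev a f) * `|y| <= ce * q f.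
  have := he; rewrite mulrAC -(ler_pM2r y0) divfK ?gt_eqF //.
have h3 : nsqv (ev a f) / `|y| * y ^+ 2 = nsqv (ev a f) * `|y|.
  by rewrite -y2 expr2 mulrA divfK // gt_eqF.
have h4 : nsqv (ev a f) * y ^+ 2 <= ce * Y * q f.
  rewrite -y2 expr2 mulrA; apply: le_trans (ler_wpM2r _ h2) _; first exact: ltW.
  by rewrite [X in X <= _]mulrAC ler_wpM2r // ler_wpM2l.
have h5 : q f * y ^+ 2 <= Y ^+ 2 * q f.
  rewrite mulrC ler_wpM2r // -y2 ler_sqr ?nnegrE // ltW //.
apply: le_trans (ler_wpM2r (ltW yy) key) _.
have h6 : cx * (nsqv (ev a f) * `|y|) <= cx * (ce * q f) by rewrite ler_wpM2l.
have h7 : cu * (nsqv (ev a f) * y ^+ 2) <= cu * (ce * Y * q f) by rewrite ler_wpM2l.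
have h8 : cu * (q f * y ^+ 2) <= cu * (Y ^+ 2 * q f) by rewrite ler_wpM2l.
have -> : (2 * (q f / y ^+ 2) + cx * nsqv (ev a f) / `|y| + 8 * (cu * (q f + nsqv (ev a f)))) * y ^+ 2
  = 2 * (q f / y ^+ 2 * y ^+ 2) + cx * (nsqv (ev a f) / `|y| * y ^+ 2)
    + 8 * (cu * (q f * y ^+ 2) + cu * (nsqv (ev a f) * y ^+ 2)) by ring.
rewrite h1 h3 /c.
move: h6 h7 h8; lra.
Qed.

End Estimate.
End Bounds.

(** * The transforms R_a at real points *)

Section Extension.
Variables (R : realType) (V : lmodType R[i]) (H : set V) (ip : V -> V -> R[i]).
Local Notation C := (R[i]).
Variables (n : nat) (B : set C) (ev : C -> V -> 'cV[C]_n) (X : 'M[C]_n)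
  (Th : C -> 'M[C]_n) (k : C -> 'cV[C]_n -> V) (b0 : C) (J : V -> V) (s : seq V).
Hypothesis M : core_model H ip B ev X Th k b0 J s.
Let sH := cm_sub M.
Let sesq := cm_sesq M.
Let kH := cm_kH M.
Let kE := cm_kE M.
Let ph := cm_ph M.
Let hsesq := hip_sesq M.
Let hilb := hip_hilbert M.
Local Notation q := (qf (hip ip J)).
Local Notation isR := (isR H B ev).
Local Notation Rid := (Rid ip ev X).
Local Notation kspan := (kspan k).

Lemma q_sym u v : H u -> H v -> q (u - v) = q (v - u).
Proof. by move=> hu hv; rewrite -(qfN sH hsesq) ?opprB //; exact: (subB sH). Qed.

Lemma small_nsq0 (x : C) (K : R) : 0 <= K -> (forall d : R, 0 < d -> nsq x <= K * d) -> x = 0.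
Proof.
move=> K0 h; apply/eqP; rewrite -nsq_eq0; apply/eqP.
apply: small_eq0; first exact: nsq_ge0.
move=> e e0; have K1 : 0 < K + 1 by rewrite ltr_wpDl.
apply: le_trans (h (e / (K + 1)) (divr_gt0 e0 K1)) _.
rewrite mulrA ler_pdivrMr // mulrC ler_pM2l //; lra.
Qed.

(** A bounded transform extends from a dense subspace: limits in norm are
    pointwise limits. *)
Lemma R_extend a (D : set V) (N : R) : B a -> Defs.subspace D -> D `<=` H ->
  (forall x e, H x -> 0 < e -> exists2 d, D d & q (x - d) < e) -> 0 <= N ->
  (forall f, D f -> exists2 g, isR a f g & q g <= N * q f) ->
  forall f, H f -> exists2 g, isR a f g & q g <= 4 * N * q f.
Proof.
move=> Ba sD DH dense N0 hD f hf.
have eps_gt0 (m : nat) : 0 < m.+1%:R^-1 :> R by rewrite invr_gt0 ltr0n.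
have /choice[u hu] : forall m : nat, exists u : V * V,
    [/\ D u.1, q (f - u.1) < m.+1%:R^-1 & isR a u.1 u.2].
  move=> m; have [d Dd qd] := dense f _ hf (eps_gt0 m).
  by have [g rg _] := hD d Dd; exists (d, g).
pose fn m := (u m).1; pose gn m := (u m).2.
have Dfn m : D (fn m) by case: (hu m).
have hfn m : H (fn m) by exact: DH.
have qfn m : q (f - fn m) < m.+1%:R^-1 by case: (hu m).
have rgn m : isR a (fn m) (gn m) by case: (hu m).
have hgn m : H (gn m) by exact: isR_H (rgn m).
have hffn m : H (f - fn m) by exact: (subB sH).
have cau m p : q (gn m - gn p) <= N * (2 * (q (f - fn m) + q (f - fn p))).
  have [h rh qh] := hD (fn m - fn p) (subB sD (Dfn m) (Dfn p)).
  have e := isR_uniq M (isRB M Ba (hfn m) (hfn p) (rgn m) (rgn p)) rh.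
  rewrite e; apply: le_trans qh _; rewrite ler_wpM2l //.
  have -> : fn m - fn p = (f - fn p) - (f - fn m) by rewrite opprB [RHS]addrC subrKA.
  apply: le_trans (qfD_le hilb (hffn p) (subN sH (hffn m))) _.
  by rewrite (qfN sH hsesq) // addrC.
have [|g hg glim] := hilbert_complete hilb hgn.
  move=> e e0; have N1 : 0 < 5 * (N + 1) by rewrite mulr_gt0 // ltr_wpDl.
  have [n0 hn0] := inv_nat_small (divr_gt0 e0 N1).
  exists n0 => m p /hn0 hm /hn0 hp; apply: le_lt_trans (cau m p) _.
  have h1 := lt_trans (qfn m) hm; have h2 := lt_trans (qfn p) hp.
  have : N * (2 * (q (f - fn m) + q (f - fn p))) <= N * (4 * (e / (5 * (N + 1)))).
    by rewrite ler_wpM2l //; lra.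
  move/le_lt_trans; apply.
  have -> : N * (4 * (e / (5 * (N + 1)))) = (N / (N + 1)) * (e * 4 / 5).
    by field; rewrite gt_eqF // ltr_wpDl.
  have : N / (N + 1) <= 1 by rewrite ler_pdivrMr ?ltr_wpDl // mul1r lerDl ler01.
  move=> h3; apply: le_lt_trans (_ : 1 * (e * 4 / 5) < e); last by lra.
  by rewrite ler_wpM2r // !mulr_ge0 // ?ltW // invr_ge0.
have near d : 0 < d -> exists m, q (f - fn m) < d /\ q (g - gn m) < d.
  move=> d0; have [n1 h1] := inv_nat_small d0; have [n2 h2] := glim _ d0.
  exists (maxn n1 n2); split; first exact: lt_trans (qfn _) (h1 _ (leq_maxl _ _)).
  by rewrite q_sym //; exact: h2 (leq_maxr _ _).
exists g.
  split=> // z Bz; apply/matrixP => j i; rewrite ord1.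
  apply/eqP; rewrite -subr_eq0; apply/eqP.
  pose K := 4 * (nsq (z - a) * q (k z (delta_mx j 0)) + q (k z (delta_mx j 0)))
    + 2 * q (k a (delta_mx j 0)).
  have k1 := q_ge0 M (kH (delta_mx j 0) Bz); have k2 := q_ge0 M (kH (delta_mx j 0) Ba).
  have K0 : 0 <= K by rewrite addr_ge0 // mulr_ge0 // addr_ge0 // mulr_ge0 // nsq_ge0.
  apply: (small_nsq0 K0) => d d0; have [m [qm1 qm2]] := near d d0.
  have hggn : H (g - gn m) by exact: (subB sH).
  have e1 : ((z - a) *: ev z g) j 0 - (ev z f - ev a f) j 0 =
     (z - a) * ev z (g - gn m) j 0 - ev z (f - fn m) j 0 + ev a (f - fn m) j 0.
    have [_ /(_ z Bz) /matrixP /(_ j 0)] := rgn m.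
    rewrite !(ev_B M) // !mxE => e1; rewrite mulrBr e1; ring.
  rewrite e1; apply: le_trans (nsqD_le _ _) _.
  have h1 := nsqD_le ((z - a) * ev z (g - gn m) j 0) (- ev z (f - fn m) j 0).
  rewrite nsqN nsqM in h1.
  have h2 := q_ev M j Bz hggn; have h3 := q_ev M j Bz (hffn m).
  have h4 := q_ev M j Ba (hffn m).
  have qm1' := q_ge0 M (hffn m); have qm2' := q_ge0 M hggn.
  have h5 : nsq (z - a) * nsq (ev z (g - gn m) j 0) <= nsq (z - a) * (d * q (k z (delta_mx j 0))).
    rewrite ler_wpM2l ?nsq_ge0 //; apply: le_trans h2 _.
    by rewrite ler_wpM2r // ltW.
  have h6 : nsq (ev z (f - fn m) j 0) <= d * q (k z (delta_mx j 0)).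
    by apply: le_trans h3 _; rewrite ler_wpM2r // ltW.
  have h7 : nsq (ev a (f - fn m) j 0) <= d * q (k a (delta_mx j 0)).
    by apply: le_trans h4 _; rewrite ler_wpM2r // ltW.
  by rewrite /K; move: h1 h5 h6 h7; lra.
rewrite -subr_le0; apply/ler_addgt0Pr => e e0; rewrite add0r.
pose K := 2 + 4 * N.
have K0 : 0 < K by rewrite ltr_pwDl // mulr_ge0.
have [m [qm1 qm2]] := near (e / K) (divr_gt0 e0 K0).
have hggn : H (g - gn m) by exact: (subB sH).
have h1 : q g <= 2 * (q (g - gn m) + q (gn m)).
  have -> : q g = q ((g - gn m) + gn m) by rewrite subrK.
  exact: (qfD_le hilb hggn (hgn m)).
have h2 : q (gn m) <= N * q (fn m).
  have [h rh qh] := hD _ (Dfn m).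
  by rewrite (isR_uniq M (rgn m) rh).
have h3 : q (fn m) <= 2 * (q f + q (f - fn m)).
  have -> : q (fn m) = q (f - (f - fn m)) by rewrite opprB addrC subrK.
  apply: le_trans (qfD_le hilb hf (subN sH (hffn m))) _.
  by rewrite (qfN sH hsesq).
have h4 : N * q (fn m) <= N * (2 * (q f + q (f - fn m))) by rewrite ler_wpM2l.
have h5 : N * q (f - fn m) <= N * (e / K) by rewrite ler_wpM2l // ltW.
have h6 : e / K * K = e by rewrite divfK // gt_eqF.
by move: h6; rewrite /K; lra.
Qed.

(** The conclusion of kspan_pairing, for a fixed list S of points to avoid. *)
Definition paired (S : seq C) u := forall N : R, 0 <= N ->
    exists2 c : R, 0 <= c & forall a f g, B a -> H f -> isR a f g ->
      (forall x, x \in S -> x != a /\ nsq (x - a)^-1 <= N) ->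
      nsq (ip g u) <= c * (q f + nsqv (ev a f)).

Lemma approx_frame (T : set C) : T `<=` B ->
  (forall f, H f -> (forall a, T a -> ev a f = 0) -> f = 0) ->
  exists (u : V -> V) (S : seq C), (forall x, x \in S -> T x) /\
    forall x, x \in s -> [/\ H (u x), 16 * (size s)%:R * q (x - u x) <= 1 & paired S (u x)].
Proof.
move=> TB sepT.
have hs x : x \in s -> H x by move=> /(phs ph) [].
have dense := kspan_dense M TB sepT.
have /choice[u hu] : forall x, exists u, x \in s ->
    kspan T u /\ 16 * (size s)%:R * q (x - u) <= 1.
  move=> x; have [xs|] := boolP (x \in s); last by exists 0.
  have s0 : 0 < 16 * (size s)%:R :> R by rewrite mulr_gt0 // ltr0n; case: (s) xs.
  have [|u hu qu] := dense x (16 * (size s)%:R)^-1 (hs _ xs); first by rewrite invr_gt0.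
  by exists u => _; split => //; rewrite -ler_pdivlMl // mulr1 ltW.
have hS : exists S : seq C, (forall x, x \in S -> T x) /\ forall x, x \in s -> paired S (u x).
  have : forall x, x \in s -> exists S : seq C, (forall x, x \in S -> T x) /\ paired S (u x).
    move=> x /hu[hx _].
    by have [S [ST pS]] := kspan_pairing M TB hx; exists S.
  elim: (s) => [|x s' ih] h; first by exists [::].
  have [|S1 [T1 p1]] := ih; first by move=> y ys; apply: h; rewrite inE ys orbT.
  have [S2 [T2 p2]] := h x (mem_head _ _).
  exists (S1 ++ S2); split; first by move=> y; rewrite mem_cat => /orP[/T1|/T2].
  have mono S S' v : {subset S <= S'} -> paired S v -> paired S' v.
    move=> SS' p N N0; have [c c0 hc] := p N N0; exists c => // a f g Ba hf rg hx.
    by apply: hc => // y /SS'; exact: hx.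
  move=> y; rewrite inE => /orP[/eqP ->|/p1].
    by apply: mono p2 => z zs; rewrite mem_cat zs orbT.
  by apply: mono => z zs; rewrite mem_cat zs.
have [S [ST pS]] := hS; exists u, S; split => // x xs.
by have [h1 h2] := hu x xs; split => //; [exact: (kspanH M TB)|exact: pS].
Qed.

(** The a priori bound holds on the kernel vectors at the points other than a^*,
    which are dense. *)
Lemma R_nonreal_bound (G : set C) (u : V -> V) (S : seq C) :
  compact (G : set C^o) -> (forall a, G a -> B a) -> (forall a, G a -> B a^*) ->
  (forall x, x \in S -> ~ G x) ->
  (forall x, x \in s -> [/\ H (u x), 16 * (size s)%:R * q (x - u x) <= 1 & paired S (u x)]) ->
  exists2 c : R, 0 <= c & forall a f, G a -> complex.Im a != 0 -> H f ->
    exists2 g, isR a f g & q g <= c / complex.Im a ^+ 2 * q f.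
Proof.
move=> cG GB GB' SG hu.
have [N N0 hN] : exists2 N : R, 0 <= N & forall x a, x \in S -> G a -> nsq (x - a)^-1 <= N.
  elim: (S) SG => [|x S' ih] h; first by exists 0.
  have [|N1 N10 h1] := ih; first by move=> y ys; apply: h; rewrite inE ys orbT.
  have [|N2 h2] := compact_nsq_bounded (h := fun a => (x - a)^-1) cG.
    move=> z Gz; apply: ccontV; last by apply: ccontB; [exact: ccont_cst|exact: ccont_id].
    rewrite subr_eq0; apply: contra_notN (h x (mem_head _ _)) => /eqP ->; exact: Gz.
  exists (N1 + `|N2|); first exact: addr_ge0.
  move=> y a; rewrite inE => /orP[/eqP ->|ys] Ga.
    by apply: le_trans (h2 a Ga) _; apply: le_trans (ler_norm _) _; rewrite lerDr.
  by apply: le_trans (h1 y a ys Ga) _; rewrite lerDl.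
have [|c c0 hc] := R_bound M cG GB (u := u).
  move=> x xs; have [hux hqx px] := hu x xs; split => //.
  have [c c0 h] := px N N0; exists c => // a f g Ga hf rg.
  apply: (h a f g (GB _ Ga) hf rg) => y ys; split; last exact: hN.
  by apply: contra_notN (SG y ys) => /eqP ->.
exists (4 * c); first by rewrite mulr_ge0.
move=> a f Ga ya hf; have Ba := GB _ Ga; have Ba' := GB' _ Ga.
pose T := [set m | B m /\ m != a^*].
have TB : T `<=` B by move=> m [].
have Ta m : T m -> m != a^* by case.
have [||||g rg qg] := @R_extend a (kspan T) (c / complex.Im a ^+ 2) Ba (kspan_sub _ _) _ _ _ _ f hf.
- exact: (kspanH M TB).
- apply: (kspan_dense M TB) => g hg h0.
  apply: (sep_generic M (x := a^*) (y := a^*)) => // z Bz _ za _; exact: h0.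
- by rewrite divr_ge0 // sqr_ge0.
- move=> h hh; have [g' rg' idg] := kspan_R M Ba Ba' TB Ta hh.
  have hH := kspanH M TB hh.
  by exists g' => //; apply: hc => //; exact: idg.
by exists g => //; rewrite mulrA in qg.
Qed.

Lemma R_nonreal a f : B a -> B a^* -> complex.Im a != 0 -> H f -> exists g, isR a f g.
Proof.
move=> Ba Ba' ya hf.
pose T := [set m | B m /\ m != a].
have TB : T `<=` B by move=> m [].
have [|u [S [ST hu]]] := approx_frame TB.
  move=> g hg h0; apply: (sep_generic M (x := a) (y := a)) => // z Bz _ za _; exact: h0.
have [||||c c0 h] := @R_nonreal_bound [set a] u S _ _ _ _ hu.
- exact: (@compact_set1 C^o).
- by move=> _ ->.
- by move=> _ ->.
- by move=> x /ST[_ xa] /= e; rewrite e eqxx in xa.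
by have [g rg _] := h a f erefl ya hf; exists g.
Qed.

Let nonrealB := [set m : C | B m /\ complex.Im m != 0].

Lemma nonrealB_sub : nonrealB `<=` B. Proof. by move=> m []. Qed.

Lemma nonrealB_dense : forall x e, H x -> 0 < e -> exists2 d, kspan nonrealB d & q (x - d) < e.
Proof.
apply: (kspan_dense M nonrealB_sub) => f hf h0.
by apply: (sep_generic M (x := b0) (y := b0)) => // z Bz zi _ _; exact: h0.
Qed.

Lemma R_span a f : B a -> B a^* -> kspan nonrealB f -> exists g, isR a f g.
Proof.
move=> Ba Ba' hf; have [a0|a0] := eqVneq (complex.Im a) 0; last first.
  by apply: R_nonreal => //; exact: (kspanH M nonrealB_sub).
have ac : a^* = a by apply/conj_fixP.
have Ta m : nonrealB m -> m != a^*.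
  by move=> [_ mi]; apply: contraNneq mi => ->; rewrite ac a0.
by have [g rg _] := kspan_R M Ba Ba' nonrealB_sub Ta hf; exists g.
Qed.

Lemma ev_cderiv2 d f h a : B a -> H f -> isR a f h -> cderiv2 (fun z => dot d (ev z f)) a.
Proof.
move=> Ba hf rh; have hh := isR_H rh.
exists (fun z => dot d (ev z h)); split.
  rewrite (_ : (fun z => _) = fun z => \sum_j (d j 0)^* * ev z h j 0).
    apply: cdiff_sum => j; apply: cdiffM; first exact: cdiff_cst.
    exact: (cm_evdiff M).
  by apply/funext => z; rewrite dotE.
apply: filterS (cm_open M Ba) => z Bz; have [_ /(_ z Bz) e] := rh.
by rewrite -dotZr e dotBr addrC subrK.
Qed.

Section RealPoint.
Variables (b : C) (e : R).
Hypotheses (bR : complex.Im b = 0) (e0 : 0 < e) (discB : forall z, nsq (z - b) <= e -> B z).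
Let bc : b^* = b. Proof. exact/conj_fixP. Qed.
Let discB' z : nsq (z - b) <= e -> B z^*.
Proof. by move=> h; apply: discB; rewrite -nsq_conj rmorphB /= conjCK bc. Qed.
Let Bb : B b. Proof. by apply: discB; rewrite subrr nsq0 ltW. Qed.

(** For g a kernel vector at nu, the pairing of R_z f with g is the value at nu
    of R_z f, which is also, by symmetry of difference quotients, the value at z
    of R_nu f.  The second form is smooth in z, including at z = nu. *)
Lemma pairing_holomorphic f g : kspan nonrealB f -> kspan nonrealB g ->
  exists phi : C -> C,
    (forall z h, nsq (z - b) <= e -> isR z f h -> phi z = ip h g) /\
    (forall z, nsq (z - b) <= e -> cderiv2 phi z).
Proof.
move=> hf hg; have hfH := kspanH M nonrealB_sub hf.
pose W := [set g | H g /\ exists phi : C -> C,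
    (forall z h, nsq (z - b) <= e -> isR z f h -> phi z = ip h g) /\
    (forall z, nsq (z - b) <= e -> cderiv2 phi z)].
suff [] : W g by [].
apply: hg => [|nu d [Bnu nui]].
  split.
    split; first exact: (sub0 sH).
    exists (fun=> 0); split; last by move=> z _; exact: cderiv2_cst.
    by move=> z h _ rh; rewrite (ip0r sH sesq) //; exact: isR_H rh.
  move=> c u v [hu [p1 [v1 d1]]] [hv [p2 [v2 d2]]]; split; first exact: (subDZ sH).
  exists (fun z => c^* * p1 z + p2 z); split.
    move=> z h hz rh; rewrite (ipDZr sH sesq) //; last exact: isR_H rh.
    by rewrite (v1 z h) // (v2 z h).
  move=> z hz; apply: cderiv2D; last exact: d2.
  by apply: (@cderiv2M _ (fun=> c^*)); [exact: cderiv2_cst|exact: d1].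
split; first exact: kH.
have [nud|nud] := lerP (nsq (nu - b)) e.
  have Bnu' := discB' nud.
  have [h rh] := R_nonreal Bnu Bnu' nui hfH; have hh := isR_H rh.
  exists (fun z => dot d (ev z h)); split.
    move=> z h' hz rh'; have hh' := isR_H rh'; rewrite kE //.
    have [zn|zn] := eqVneq z nu; first by rewrite zn in rh' *; rewrite (isR_uniq M rh rh').
    have Bz := discB hz.
    rewrite (isR_ev rh) // (isR_ev rh') //; last by rewrite eq_sym.
    by rewrite -(opprB nu z) invrN -(opprB (ev nu f)) scalerN scaleNr opprK.
  move=> z hz; have Bz := discB hz; have Bz' := discB' hz.
  have [zn|zn] := eqVneq z nu.
    by rewrite zn; have [h2 rh2] := R_nonreal Bnu Bnu' nui hh; exact: ev_cderiv2 rh2.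
  have [h1 rh1] := R_span Bz Bz' hf.
  by have rh2 := isR_comp M Bz Bnu zn hfH rh1 rh; exact: ev_cderiv2 rh2.
have zn z : nsq (z - b) <= e -> z != nu.
  by move=> hz; apply: contraTneq nud => <-; rewrite -leNgt.
exists (fun z => (nu - z)^-1 * (dot d (ev nu f) + -1 * dot d (ev z f))); split.
  move=> z h hz rh; have hh := isR_H rh; have Bz := discB hz.
  by rewrite kE // (isR_ev rh) ?dotZr ?dotBr ?mulN1r // eq_sym zn.
move=> z hz; have Bz := discB hz; have Bz' := discB' hz.
have [h1 rh1] := R_span Bz Bz' hf.
apply: cderiv2M; first exact: cderiv2_inv_sub (zn z hz).
apply: (@cderiv2D _ (fun=> dot d (ev nu f))); first exact: cderiv2_cst.
apply: (@cderiv2M _ (fun=> -1)); first exact: cderiv2_cst.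
exact: ev_cderiv2 rh1.
Qed.

(** The growth 1/|Im z| of R_z near the real axis is absorbed by the factor
    (z - b)^2 - e: on the circle, e = |z - b|^2, and the factor is
    (z - b) (z - z^* ). *)
Lemma R_real_span (c : R) : 0 <= c ->
  (forall a f, nsq (a - b) = e -> complex.Im a != 0 -> H f ->
    exists2 g, isR a f g & q g <= c / complex.Im a ^+ 2 * q f) ->
  forall f, kspan nonrealB f -> exists2 g, isR b f g & q g <= 4 * c / e * q f.
Proof.
move=> c0 hc f hf; have hfH := kspanH M nonrealB_sub hf.
have Bb' : B b^* by rewrite bc.
have [h rh] := R_span Bb Bb' hf; have hh := isR_H rh.
exists h => //.
have qf0 := q_ge0 M hfH.
rewrite -(qJ M hh).
apply: (dense_ip_bound hilb (D := kspan nonrealB)).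
- exact: (kspanH M nonrealB_sub).
- exact: (phJ ph).
- by rewrite mulr_ge0 // divr_ge0 ?mulr_ge0 // ltW.
- exact: nonrealB_dense.
move=> g hg; have hgH := kspanH M nonrealB_sub hg.
have qg0 := q_ge0 M hgH.
have -> : hip ip J (J h) g = ip h g.
  by rewrite /hip (phJsym ph) ?(phJK ph) //; exact: (phJ ph).
have [phi [phiE phid]] := pairing_holomorphic hf hg.
pose psi z := ((z + - b) * (z + - b) + - (e%:C)%C) * phi z.
have := @max_principle R psi b e (4 * e * c * q f * q g) e0.
have nb : nsq (b - b) <= e by rewrite subrr nsq0 ltW.
rewrite {3}/psi subrr mulr0 add0r nsqM nsqN nsq_real (phiE b h nb rh) => hmax.
have {hmax} : e ^+ 2 * nsq (ip h g) <= 4 * e * c * q f * q g.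
  apply: hmax.
    move=> z hz; rewrite /psi; apply: cderiv2M; last exact: phid.
    apply: cderiv2D; last exact: cderiv2_cst.
    have hb : cderiv2 (fun z0 : C => z0 + - b) z.
      by apply: cderiv2D; [exact: cderiv2_id|exact: cderiv2_cst].
    exact: cderiv2M.
  move=> z hz; have hz' : nsq (z - b) <= e by rewrite hz.
  rewrite /psi nsqM.
  have -> : nsq ((z + - b) * (z + - b) + - (e%:C)%C) = e * (4 * complex.Im z ^+ 2).
    have -> : (e%:C)%C = (z - b) * (z - b)^* :> C by rewrite -nsqE hz.
    rewrite -mulrBr nsqM hz rmorphB /= bc; congr (_ * _).
    by rewrite !nsq_def; case: (z) (b) => [z1 z2] [x1 x2] /=; ring.
  have [z0|z0] := eqVneq (complex.Im z) 0.
    by rewrite z0 expr0n /= !mulr0 mul0r !mulr_ge0 // ltW.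
  have [h' rh' qh'] := hc z f hz z0 hfH; have hh' := isR_H rh'.
  rewrite (phiE z h' hz' rh').
  have y0 : 0 < complex.Im z ^+ 2 by rewrite exprn_even_gt0.
  have h1 := ip_cs M hh' hgH.
  have h2 : nsq (ip h' g) * complex.Im z ^+ 2 <= c * q f * q g.
    rewrite -ler_pdivlMr //; apply: le_trans h1 _.
    by rewrite mulrAC ler_wpM2r // mulrAC.
  have : e * 4 * (nsq (ip h' g) * complex.Im z ^+ 2) <= e * 4 * (c * q f * q g).
    by rewrite ler_pM2l // mulr_gt0.
  by lra.
have e20 : 0 < e ^+ 2 by rewrite exprn_gt0.
have -> : 4 * e * c * q f * q g = e ^+ 2 * (4 * c / e * q f * q g).
  by field; rewrite gt_eqF.
by rewrite ler_pM2l.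
Qed.

End RealPoint.

Lemma R_real b : B b -> complex.Im b = 0 ->
  exists2 N : R, 0 <= N & forall f, H f -> exists2 g, isR b f g & q g <= N * q f.
Proof.
move=> Bb bR; have bc : b^* = b by apply/conj_fixP.
have [|u [S [ST hu]]] := approx_frame nonrealB_sub.
  move=> f hf h0.
  by apply: (sep_generic M (x := b0) (y := b0)) => // z Bz zi _ _; exact: h0.
have [e1 e10 he1] := (nbhs_nsq b B).1 (cm_open M Bb).
have [e [e0 ee eS]] := avoid_list [seq nsq (x - b) | x <- S] e10.
have discB z : nsq (z - b) <= e -> B z by move=> h; apply: he1; exact: le_lt_trans ee.
have [||||c c0 hc] := @R_nonreal_bound [set z | nsq (z - b) = e] u S _ _ _ _ hu.
- exact: circle_compact.
- by move=> a /= ha; apply: discB; rewrite ha.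
- by move=> a /= ha; apply: discB; rewrite -nsq_conj rmorphB /= conjCK bc ha.
- by move=> x xS /= hx; move/negP: eS; apply; apply/mapP; exists x.
exists (4 * (4 * c / e)); first by rewrite !mulr_ge0 // invr_ge0 ltW.
apply: (R_extend Bb (kspan_sub _ nonrealB) (kspanH M nonrealB_sub) nonrealB_dense).
  by rewrite !mulr_ge0 // invr_ge0 ltW.
exact: (R_real_span bR e0 discB c0 hc).
Qed.

(** The identity of kspan_R passes to the limit in its second argument, since
    R_b is bounded. *)
Lemma Rid_real b f g f' g' : B b -> complex.Im b = 0 -> H f -> H f' ->
  isR b f g -> isR b f' g' -> Rid b f g f' g'.
Proof.
move=> Bb bR hf hf' rg rg'; have bc : b^* = b by apply/conj_fixP.
have [N N0 hN] := R_real Bb bR.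
have hg := isR_H rg; have hg' := isR_H rg'.
have Ta m : nonrealB m -> m != b^*.
  by move=> [_ mi]; apply: contraNneq mi => ->; rewrite bc bR.
rewrite /Rid bc subrr mul0r subr0; apply/eqP; rewrite -subr_eq0; apply/eqP.
pose w := X *m ev b f.
pose K := 4 * (q g + q f * N) + 2 * (2 ^+ n * nsqv w * \sum_(j < n) q (k b (delta_mx j 0))).
have qg0 := q_ge0 M hg; have qf0 := q_ge0 M hf.
have L0 : 0 <= 2 ^+ n * nsqv w * \sum_(j < n) q (k b (delta_mx j 0)).
  rewrite !mulr_ge0 ?exprn_ge0 ?nsqv_ge0 //; apply: sumr_ge0 => j _.
  by apply: (q_ge0 M); exact: kH.
have K0 : 0 <= K by rewrite addr_ge0 // mulr_ge0 // addr_ge0 // mulr_ge0.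
apply: (small_nsq0 K0) => d d0.
have [f1 hf1 qf1] := nonrealB_dense hf' d0.
have hf1H := kspanH M nonrealB_sub hf1.
have Bb' : B b^* by rewrite bc.
have [g1 rg1 id1] := kspan_R M Bb Bb' nonrealB_sub Ta hf1; have hg1 := isR_H rg1.
have := id1 f g hf rg; rewrite /Rid bc subrr mul0r subr0 => e1.
have hu : H (f' - f1) by exact: (subB sH).
have rv := isRB M Bb hf' hf1H rg' rg1.
have [v' rv' qv] := hN _ hu.
have hv : H (g' - g1) by exact: (subB sH).
rewrite -(isR_uniq M rv rv') in qv.
set x := _ - _ - _.
have -> : x = ip g (f' - f1) - ip f (g' - g1) - 'i * dot (ev b (f' - f1)) w.
  rewrite !(ipBr sH sesq) // (ev_B M) // dotBl /x /w.
  by rewrite mulrBr -e1; ring.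
apply: le_trans (nsqD_le _ _) _; rewrite nsqN nsqM.
have -> : nsq ('i : C) = 1 by rewrite -complexiE nsq_def /= expr0n expr1n add0r.
rewrite mul1r dotC nsq_conj.
have h1 := nsqD_le (ip g (f' - f1)) (- ip f (g' - g1)); rewrite nsqN in h1.
have h2 := ip_cs M hg hu; have h3 := ip_cs M hf hv.
have h4 := nsq_dot_le w (ev b (f' - f1)).
have h5 : nsqv (ev b (f' - f1)) <= q (f' - f1) * \sum_(j < n) q (k b (delta_mx j 0)).
  by rewrite /nsqv mulr_sumr; apply: ler_sum => j _; exact: (q_ev M j Bb hu).
have hu0 := q_ge0 M hu.
have l1 : q g * q (f' - f1) <= q g * d by rewrite ler_wpM2l // ltW.
have l2 : q f * q (g' - g1) <= q f * N * d.
  rewrite -mulrA ler_wpM2l //; apply: le_trans qv _.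
  by rewrite ler_wpM2l // ltW.
have l3 : nsq (dot w (ev b (f' - f1))) <= 2 ^+ n * nsqv w * (\sum_(j < n) q (k b (delta_mx j 0))) * d.
  apply: le_trans h4 _.
  have p0 : 0 <= 2 ^+ n * nsqv w by rewrite mulr_ge0 ?exprn_ge0 ?nsqv_ge0.
  have h6 := ler_wpM2l p0 h5; have h7 := ler_wpM2l L0 (ltW qf1).
  by apply: le_trans h6 _; rewrite [q (f' - f1) * _]mulrC mulrA.
move: L0 l3 h1 h2 h3 l1 l2; rewrite /K; set L := _ * \sum_(j < n) _.
by set P := nsq (ip g _ - _); lra.
Qed.

End Extension.

(** * The transforms R_a on the whole space *)

(** A finite-rank perturbation of a surjective operator is surjective as soon
    as it is injective: the question reduces to a square linear system. *)
Lemma fredholm_alternative (R : realType) (V : lmodType R[i]) (H : set V) (m : nat)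
    (W T : V -> V) (l : 'I_m -> V -> R[i]) (g : 'I_m -> V) :
  Defs.subspace H ->
  (forall c u v, H u -> H v -> W (c *: u + v) = c *: W u + W v) ->
  (forall j c u v, H u -> H v -> l j (c *: u + v) = c * l j u + l j v) ->
  (forall j, H (g j)) ->
  (forall y, H y -> exists2 x, H x & W x = y) ->
  (forall f, H f -> T f = W f + \sum_j l j f *: g j) ->
  (forall f, H f -> T f = 0 -> f = 0) ->
  forall y, H y -> exists2 x, H x & T x = y.
Proof.
move=> sH Wlin llin Hg Wsurj TE Tinj y hy.
have /choice[w hw] : forall j, exists w, H w /\ W w = g j.
  by move=> j; have [w hw e] := Wsurj _ (Hg j); exists w.
have Hw j : H (w j) by case: (hw j).
have Ww j : W (w j) = g j by case: (hw j).
have h0 := sub0 sH.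
have W0 : W 0 = 0.
  have := Wlin 1 0 0 h0 h0; rewrite scaler0 addr0 scale1r => e.
  by apply: (@addrI _ (W 0)); rewrite addr0 -e.
have l0 j : l j 0 = 0.
  have := llin j 1 0 0 h0 h0; rewrite scaler0 addr0 mul1r => e.
  by apply: (@addrI _ (l j 0)); rewrite addr0 -e.
have Wsum (t : 'I_m -> R[i]) : W (\sum_j t j *: w j) = \sum_j t j *: g j.
  have [] : W (\sum_j t j *: w j) = \sum_j t j *: g j /\ H (\sum_j t j *: w j); last by [].
  apply: (big_ind2 (fun a b => W a = b /\ H a)) => //.
    move=> a b c d [e1 h1] [e2 h2]; split; last exact: (subD sH).
    by rewrite -[a]scale1r Wlin // scale1r e1 e2.
  move=> j _; split; last exact: (subZ sH).
  by rewrite -[_ *: w j]addr0 Wlin // W0 addr0 Ww.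
have Hsum (t : 'I_m -> R[i]) : H (\sum_j t j *: w j).
  by apply: (sub_sum sH) => j _; exact: (subZ sH).
have lsum i (t : 'I_m -> R[i]) : l i (\sum_j t j *: w j) = \sum_j t j * l i (w j).
  have [] : l i (\sum_j t j *: w j) = \sum_j t j * l i (w j) /\ H (\sum_j t j *: w j); last by [].
  apply: (big_ind2 (fun a b => l i a = b /\ H a)) => //.
    move=> a b c d [e1 h1] [e2 h2]; split; last exact: (subD sH).
    by rewrite -[a]scale1r llin // mul1r e1 e2.
  move=> j _; split; last exact: (subZ sH).
  by rewrite -[_ *: w j]addr0 llin // l0 addr0.
pose A : 'M[R[i]]_m := \matrix_(j, i) ((i == j)%:R + l i (w j)).
have rowA (t : 'rV[R[i]]_m) i : (t *m A) 0 i = t 0 i + l i (\sum_j t 0 j *: w j).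
  rewrite mxE lsum.
  under eq_bigr do rewrite mxE mulrDr.
  rewrite big_split /=; congr (_ + _).
  rewrite (bigD1 i) //= eqxx mulr1 big1 ?addr0 // => j ji.
  by rewrite eq_sym (negPf ji) mulr0.
have AU : A \in unitmx.
  rewrite unitmxE unitfE; apply/negP => /det0P[v v0 vA].
  have hx := Hsum (fun j => v 0 j).
  have lx i : l i (\sum_j v 0 j *: w j) = - v 0 i.
    have := rowA v i; rewrite vA mxE => e; apply/eqP; rewrite -addr_eq0 addrC -e //.
  have x0 : \sum_j v 0 j *: w j = 0.
    apply: Tinj => //; rewrite TE // Wsum -big_split big1 //= => j _.
    by rewrite lx scaleNr subrr.
  apply/negP: v0; rewrite negbK; apply/eqP/matrixP => a i; rewrite ord1 mxE.
  by have := lx i; rewrite x0 l0 => /esym/eqP; rewrite oppr_eq0 => /eqP.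
have [y0 hy0 Wy0] := Wsurj _ hy.
pose t : 'rV[R[i]]_m := (\row_i l i y0) *m invmx A.
have tA i : t 0 i + l i (\sum_j t 0 j *: w j) = l i y0.
  by rewrite -rowA /t -mulmxA mulVmx // mulmx1 mxE.
have ht := Hsum (fun j => t 0 j).
exists (-1 *: (\sum_j t 0 j *: w j) + y0); first exact: (subDZ sH).
have hx : H (-1 *: (\sum_j t 0 j *: w j) + y0) by exact: (subDZ sH).
rewrite TE // Wlin // Wsum Wy0.
have -> : \sum_j l j (-1 *: (\sum_j t 0 j *: w j) + y0) *: g j = \sum_j t 0 j *: g j.
  apply: eq_bigr => j _.
  by rewrite llin // -(tA j) mulN1r [t 0 j + _]addrC addrA addNr add0r.
by rewrite scaleN1r addrAC addNr add0r.
Qed.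

Section CoreConclusion.
Variables (R : realType) (V : lmodType R[i]) (H : set V) (ip : V -> V -> R[i]).
Local Notation C := (R[i]).
Variables (n : nat) (B : set C) (ev : C -> V -> 'cV[C]_n) (X : 'M[C]_n)
  (Th : C -> 'M[C]_n) (k : C -> 'cV[C]_n -> V) (b0 : C) (J : V -> V) (s : seq V).
Hypothesis M : core_model H ip B ev X Th k b0 J s.
Let sH := cm_sub M.
Let sesq := cm_sesq M.
Let kH := cm_kH M.
Let kE := cm_kE M.
Let ph := cm_ph M.
Let hsesq := hip_sesq M.
Let hilb := hip_hilbert M.
Let Bb := cm_b0 M.
Let bR := cm_b0R M.
Let bc : b0^* = b0. Proof. by apply/conj_fixP. Qed.
Local Notation q := (qf (hip ip J)).
Local Notation isR := (isR H B ev).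
Local Notation Rid := (Rid ip ev X).

Lemma ip_nondeg u : H u -> (forall f, H f -> ip f u = 0) -> u = 0.
Proof.
move=> hu h; apply: (qf_eq0 hilb hu).
by rewrite /qf /hip -(phJsym ph) // h //; exact: (phJ ph).
Qed.

Lemma k_lin a c u v : B a -> k a (c *: u + v) = c *: k a u + k a v.
Proof.
move=> Ba; apply/eqP; rewrite -subr_eq0; apply/eqP.
have h1 := kH (c *: u + v) Ba; have h2 := kH u Ba; have h3 := kH v Ba.
have h4 : H (c *: k a u + k a v) by exact: (subDZ sH).
apply: ip_nondeg; first exact: (subB sH).
move=> f hf; rewrite (ipBr sH sesq) // (ipDZr sH sesq) // !kE // dotDl dotZl.
by rewrite subrr.
Qed.

Lemma k_sum a (c : 'cV[C]_n) : B a -> k a c = \sum_j c j 0 *: k a (delta_mx j 0).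
Proof.
move=> Ba.
have k0 : k a 0 = 0.
  have := k_lin 1 0 0 Ba; rewrite scaler0 addr0 scale1r => e.
  by apply: (@addrI _ (k a 0)); rewrite addr0 -e.
have -> : c = \sum_j c j 0 *: delta_mx j (0 : 'I_1).
  rewrite [LHS]matrix_sum_delta; apply: eq_bigr => j _; exact: big_ord1.
rewrite (big_morph (k a) (id1 := 0) (op1 := +%R)) //; last first.
  by move=> u v; rewrite -{1}[u]scale1r k_lin // scale1r.
apply: eq_bigr => j _; rewrite -[_ *: delta_mx _ _]addr0 k_lin // k0 addr0.
congr (_ *: _); rewrite summxE (bigD1 j) //= big1 ?addr0.
  by rewrite !mxE !eqxx mulr1.
by move=> i ij; rewrite !mxE eq_sym (negPf ij) mulr0.
Qed.

(** At a nonreal point a, possibly without a^* in B, R_a = - g (R_b0 - g)^-1 R_b0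
    with g = (a - b0)^-1, so that the surjectivity of R_b0 - g is enough.  The
    real identity makes R_b0 symmetric up to a finite-rank term for the
    indefinite form, hence also for the Hilbert form, whose symmetry J differs
    from the identity by finite rank. *)
Lemma R_nonreal_all a f : B a -> complex.Im a != 0 -> H f -> exists g, isR a f g.
Proof.
move=> Ba ai hf.
have ab : a != b0 by apply: contraNneq ai => ->; rewrite bR.
have ab0 : a - b0 != 0 by rewrite subr_eq0.
pose g := (a - b0)^-1.
have gi : complex.Im g != 0.
  rewrite /g; move: ai bR; case: (a) (b0) => a1 a2 [b1 b2] /= a20 ->.
  rewrite subr0 oppr_eq0 mulf_neq0 // invr_eq0 paddr_eq0 ?sqr_ge0 //.
  by rewrite sqrf_eq0 [a2 ^+ 2 == 0]sqrf_eq0 (negPf a20) andbF.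
have [N _ hN] := R_real M Bb bR.
have /choice[Rb hRb] : forall f, exists g, H f -> isR b0 f g.
  move=> u; have [hu|nu] := pselect (H u); last by exists 0.
  by have [v rv _] := hN u hu; exists v.
have HRb u : H u -> H (Rb u) by move=> /hRb /isR_H.
have Rblin c u v : H u -> H v -> Rb (c *: u + v) = c *: Rb u + Rb v.
  move=> hu hv; have huv : H (c *: u + v) by exact: (subDZ sH).
  exact: (isR_uniq M (hRb _ huv) (isR_lin M c Bb hu hv (hRb _ hu) (hRb _ hv))).
(* t - t^* = i: the correction removes the right-hand side of the identity *)
pose t : C := 'i / 2.
have tt : t - t^* = 'i.
  by rewrite /t rmorphM /= conjCi fmorphV /= (conjC_nat _ 2); field.
pose S u := Rb u - t *: k b0 (X *m ev b0 u).
have HS u : H u -> H (S u).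
  by move=> hu; apply: (subB sH); [exact: HRb|apply: (subZ sH); exact: kH].
have Slin c u v : H u -> H v -> S (c *: u + v) = c *: S u + S v.
  move=> hu hv; rewrite /S Rblin // (cm_evlin M) // mulmxDr -scalemxAr k_lin //.
  by rewrite scalerDr opprD addrACA !scalerBr !scalerA [t * c]mulrC.
have Ssym u v : H u -> H v -> ip (S u) v = ip u (S v).
  move=> hu hv; have hku := kH (X *m ev b0 u) Bb; have hkv := kH (X *m ev b0 v) Bb.
  have hRu := HRb _ hu; have hRv := HRb _ hv.
  have htu : H (t *: k b0 (X *m ev b0 u)) by exact: (subZ sH).
  have htv : H (t *: k b0 (X *m ev b0 v)) by exact: (subZ sH).
  have := Rid_real M Bb bR hu hv (hRb _ hu) (hRb _ hv).
  rewrite /Rid bc subrr mul0r subr0 => e.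
  rewrite /S (ipBl sH sesq) // (ipBr sH sesq) // (ipZl sH sesq) // (ipZr sH sesq) // kE //.
  rewrite (ipC sesq hv hku) kE // -dotC.
  rewrite [dot (X *m ev b0 v) _]/dot adjmxM (cm_Xh M) -mulmxA -[(adjmx (ev b0 v) *m _) 0 0]/(dot _ _).
  have -> : ip (Rb u) v = ip u (Rb v) + (t - t^*) * dot (ev b0 v) (X *m ev b0 u).
    by rewrite tt -e addrC subrK.
  ring.
have JSsym u v : H u -> H v -> hip ip J (J (S u)) v = hip ip J u (J (S v)).
  move=> hu hv; have hSu := HS _ hu; have hSv := HS _ hv.
  by rewrite /hip (phJsym ph) ?(phJK ph) ?Ssym //; exact: (phJ ph).
have JSlin c u v : H u -> H v -> J (S (c *: u + v)) = c *: J (S u) + J (S v).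
  by move=> hu hv; rewrite Slin // (phJlin ph) //; exact: HS.
have HJS u : H u -> H (J (S u)) by move=> /HS /(phJ ph).
have Wsurj := symmetric_resolvent hilb HJS JSlin JSsym gi.
pose W u := J (S u) - g *: u.
pose T u := Rb u - g *: u.
have evRb u z : H u -> B z -> (z - b0) *: ev z (Rb u) = ev z u - ev b0 u.
  by move=> /hRb[_ h]; exact: h.
(* the finite-rank difference: n evaluations at b0 and the negative part of S *)
pose l (i : 'I_(n + size s)) u : C := match fintype.split i with
  | inl j => t * (X *m ev b0 u) j 0
  | inr j => - 2 * ip (S u) (s`_j) end.
pose gv (i : 'I_(n + size s)) : V := match fintype.split i with
  | inl j => k b0 (delta_mx j 0)
  | inr j => s`_j end.
have hs x : x \in s -> H x by move=> /(phs ph) [].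
have hsj (j : 'I_(size s)) : H (s`_j) by apply: hs; exact: mem_nth.
have [||||||x hx Tx] := @fredholm_alternative _ _ H _ W T l gv sH _ _ _ Wsurj _ _ (- g *: Rb f).
- move=> c u v hu hv; rewrite /W JSlin // scalerDr opprD addrACA !scalerBr !scalerA.
  by rewrite [g * c]mulrC.
- move=> i c u v hu hv; rewrite /l; case: (fintype.split i) => j.
    by rewrite (cm_evlin M) // mulmxDr -scalemxAr !mxE mulrDr mulrCA.
  by rewrite Slin // (ipDZl sesq) ?mulrDr 1?mulrCA //; exact: HS.
- by move=> i; rewrite /gv; case: (fintype.split i) => j //; exact: kH.
- move=> u hu; have hSu := HS _ hu.
  rewrite big_split_ord /=.
  have -> : \sum_(i < n) l (lshift (size s) i) u *: gv (lshift (size s) i) =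
     t *: k b0 (X *m ev b0 u).
    rewrite [in RHS]k_sum // scaler_sumr; apply: eq_bigr => j _.
    by rewrite /l /gv (unsplitK (inl j)) scalerA.
  have -> : \sum_(i < size s) l (rshift n i) u *: gv (rshift n i) =
     - (2 *: \sum_(x <- s) ip (S u) x *: x).
    rewrite (big_nth 0) big_mkord scaler_sumr -sumrN; apply: eq_bigr => j _.
    by rewrite /l /gv (unsplitK (inr j)) mulNr scaleNr scalerA.
  rewrite /W (phneg ph hSu) /T; set p1 := 2 *: _; rewrite {1}/S; clearbody p1.
  move: (t *: _) (g *: _) (Rb u) => p2 p3 p4.
  by rewrite [p2 - p1]addrC addrA [_ - p3 - p1]addrAC addrK addrAC subrK.
- (* R_b0 u = g u gives (z - a) u(z) = 0 throughout *)
  move=> u hu /eqP; rewrite /T subr_eq0 => /eqP Tu.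
  have e z : B z -> (z - a) *: ev z u = - ((a - b0) *: ev b0 u).
    move=> Bz; have := evRb u z hu Bz; rewrite Tu (ev_Z M) // scalerA => e.
    have : (a - b0) *: ((z - b0) * g *: ev z u) = (a - b0) *: (ev z u - ev b0 u) by rewrite e.
    rewrite scalerA mulrCA divff // mulr1 scalerBr => e1.
    move: (ev z u) (ev b0 u) e1 => v1 v2 e1.
    apply/matrixP => i j; move/matrixP: e1 => /(_ i j); rewrite !mxE => e1.
    have -> : (z - a) * v1 i j = (z - b0) * v1 i j - (a - b0) * v1 i j by ring.
    by rewrite e1; ring.
  have eb : ev b0 u = 0.
    have := e a Ba; rewrite subrr scale0r => /esym/eqP; rewrite oppr_eq0 scaler_eq0 (negPf ab0) /=.
    by move/eqP.
  apply: (sep_generic M (x := a) (y := a) hu) => z Bz _ za _.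
  by have := e z Bz; rewrite eb scaler0 oppr0 => /eqP; rewrite scaler_eq0 subr_eq0 (negPf za) => /eqP.
- by apply: (subZ sH); exact: HRb.
exists x; split=> // z Bz.
have hRx := HRb _ hx; have hRf := HRb _ hf.
have e z' : B z' -> (z' - a) *: ev z' x = ev z' f - ev b0 f - (a - b0) *: ev b0 x.
  move=> Bz'; have hgx : H (g *: x) by exact: (subZ sH).
  have := congr1 (ev z') Tx; rewrite /T (ev_B M) // !(ev_Z M) //.
  have := evRb x z' hx Bz'; have := evRb f z' hf Bz'.
  move: (ev z' x) (ev b0 x) (ev z' f) (ev b0 f) (ev z' (Rb x)) (ev z' (Rb f)).
  move=> v1 v2 v3 v4 r1 r2 /matrixP er2 /matrixP er1 /matrixP er.
  apply/matrixP => i j; move: (er2 i j) (er1 i j) (er i j); rewrite !mxE => e2 e1 e0.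
  have {}e0 : r1 i j = g * (v1 i j - r2 i j).
    by apply/eqP; rewrite -subr_eq0 mulrBr opprB addrA addrAC e0 mulNr addNr.
  have -> : (z' - a) * v1 i j = (z' - b0) * v1 i j - (a - b0) * v1 i j by ring.
  have -> : (z' - b0) * v1 i j = (a - b0) * (v1 i j - v2 i j) + (v3 i j - v4 i j).
    by rewrite -e1 -e2 e0 /g; field.
  ring.
rewrite e //; have := e a Ba; rewrite subrr scale0r => /esym/eqP.
by rewrite subr_eq0 => /eqP <-; rewrite opprB addrA subrK.
Qed.

Theorem R_all a f : B a -> H f -> exists g, isR a f g.
Proof.
move=> Ba hf; have [a0|a0] := eqVneq (complex.Im a) 0; last exact: R_nonreal_all.
by have [N _ /(_ f hf)[g rg _]] := R_real M Ba a0; exists g.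
Qed.

(** With u = f + (a - b0) R_a f one has R_b0 u = R_a f and u(b0) = f(a), so the
    identity at b0 for two such vectors is the identity at the pair (a, c). *)
Theorem Rid_all a c f g f' g' : B a -> B c -> H f -> H f' -> isR a f g -> isR c f' g' ->
  ip g f' - ip f g' - (a - c^*) * ip g g' = 'i * dot (ev c f') (X *m ev a f).
Proof.
move=> Ba Bc hf hf' rg rg'.
have key d u v : B d -> H u -> isR d u v ->
    [/\ H ((d - b0) *: v + u), isR b0 ((d - b0) *: v + u) v & ev b0 ((d - b0) *: v + u) = ev d u].
  move=> Bd hu rv; have hv := isR_H rv; have [_ rz] := rv.
  have hd : H ((d - b0) *: v + u) by exact: (subDZ sH).
  have eb : ev b0 ((d - b0) *: v + u) = ev d u.
    rewrite (cm_evlin M) //; have := rz _ Bb.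
    by rewrite -[b0 - d]opprB scaleNr => /eqP; rewrite eqr_oppLR opprB => /eqP ->; rewrite subrK.
  split => //; split => // z Bz; rewrite eb (cm_evlin M) // -addrA -(rz z Bz) -scalerDl.
  by rewrite [d - b0 + _]addrC subrKA.
have [h1 r1 e1] := key a f g Ba hf rg; have [h2 r2 e2] := key c f' g' Bc hf' rg'.
have hg := isR_H rg; have hg' := isR_H rg'.
have := Rid_real M Bb bR h1 h2 r1 r2.
rewrite /Rid bc subrr mul0r subr0 e1 e2 => <-.
rewrite (ipDZr sH sesq) // (ipDZl sesq) // rmorphB /= bc; ring.
Qed.

End CoreConclusion.

(** * The roots of r(z) = a *)

Section Rational.
Variables (R : realType) (P Q : {poly R[i]}) (N : nat).
Local Notation C := (R[i]).
Hypotheses (coprimePQ : coprimep P Q) (degQP : (size Q <= size P)%N)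
  (N_gt0 : (0 < N)%N) (degP : size P = N.+1).
Local Notation r := (ratf P Q).

(** The numerator of the derivative of r. *)
Definition wronsk : {poly C} := P^`() * Q - P * Q^`().

Lemma r_has_cderiv z : Q.[z] != 0 -> has_cderiv r z (wronsk.[z] / Q.[z] ^+ 2).
Proof.
move=> Qz; have h := has_cderivM (has_cderiv_horner P z)
  (has_cderivV Qz (has_cderiv_horner Q z)).
have -> : wronsk.[z] / Q.[z] ^+ 2 =
  P^`().[z] * (Q.[z])^-1 + P.[z] * (- Q^`().[z] / Q.[z] ^+ 2).
  by rewrite /wronsk hornerD hornerN !hornerM; field.
exact: h.
Qed.

Lemma r_cderiv z : Q.[z] != 0 -> cderiv r z = wronsk.[z] / Q.[z] ^+ 2.
Proof. by move=> /r_has_cderiv /has_cderiv_cderiv. Qed.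

Lemma ratf_ccont (T : {poly C}) z : Q.[z] != 0 -> ccont (ratf T Q) z.
Proof.
move=> Qz; apply: (@ccontM _ (fun y => T.[y]) (fun y => (Q.[y])^-1)).
  exact: ccont_horner.
by apply: ccontV => //; exact: ccont_horner.
Qed.

Definition level a : {poly C} := P - a *: Q.

Lemma coprime_num_den z : Q.[z] = 0 -> P.[z] != 0.
Proof.
move=> Qz; apply: (coprimep_root (p := Q)); last by rewrite rootE Qz.
by rewrite coprimep_sym.
Qed.

Lemma level_horner a z : (level a).[z] = P.[z] - a * Q.[z].
Proof. by rewrite /level hornerD hornerN hornerZ. Qed.

Lemma level_ratf a z : Q.[z] != 0 -> (level a).[z] = Q.[z] * (r z - a).
Proof. by move=> Qz; rewrite level_horner /ratf; field. Qed.

Lemma solutionsP a z : solutions P Q a z <-> root (level a) z.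
Proof.
rewrite rootE; split=> [[Qz ra]|].
  by rewrite level_ratf // ra subrr mulr0.
rewrite level_horner subr_eq0 => /eqP e.
have Qz : Q.[z] != 0.
  apply/negP => /eqP Qz; have := coprime_num_den Qz.
  by rewrite e Qz mulr0 eqxx.
by split => //; rewrite /ratf e mulfK.
Qed.

Lemma level_size a : (size (level a) <= N.+1)%N.
Proof.
apply: leq_trans (size_polyD _ _) _; rewrite size_polyN geq_max -degP leqnn /=.
exact: leq_trans (size_scale_leq _ _) degQP.
Qed.

Lemma level_neq0 a : level a != 0.
Proof.
apply/negP => /eqP; rewrite /level => /eqP; rewrite subr_eq0 => /eqP e.
have dQ : Q %| P by rewrite e dvdpZr //; apply: contra_eq_neq degP => a0; rewrite e a0 scale0r size_poly0.
have Q1 : size Q == 1%N.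
  have /eqp_size -> : Q %= 1 by move/coprimepP: coprimePQ; apply.
  by rewrite size_poly1.
move: degP; rewrite e; have := leq_trans (size_scale_leq a Q) (eq_leq (eqP Q1)).
by move=> h1 h2; move: h1; rewrite h2 ltnS leqn0 eqn0Ngt N_gt0.
Qed.

Lemma Omega_sol a : Omega P Q a -> exists w : 'I_N -> C,
  [/\ injective w, (forall z, solutions P Q a z <-> exists m, z = w m)
    & forall (W : nmodType) (F : C -> W), \sum_(z \in solutions P Q a) F z = \sum_m F (w m)].
Proof.
rewrite /Omega /= degP /= => /card_set_bijP[f fbij].
have [ff fi fs] := fbij.
have /choice[g hg] : forall m : nat, exists z, (m < N)%N -> solutions P Q a z /\ f z = m.
  move=> m; have [mN|] := boolP (m < N)%N; last by exists 0.
  by have [z sz <-] := fs m mN; exists z.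
have gf : set_fun `I_N (solutions P Q a) g by move=> m /= /hg[].
have gi : set_inj `I_N g.
  move=> m m'; rewrite !inE /= => /hg[_ e] /hg[_ e'] gg.
  by rewrite -e -e' gg.
have gs : set_surj `I_N (solutions P Q a) g.
  move=> z sz /=; have fz : (f z < N)%N by exact: ff.
  exists (f z) => //; have [sg fg] := hg _ fz.
  by apply: fi; rewrite ?inE.
have gbij : set_bij `I_N (solutions P Q a) g by split.
exists (fun m : 'I_N => g m); split.
- move=> m m' e; apply/val_inj; apply: gi => //; rewrite inE /=; exact: ltn_ord.
- move=> z; split=> [/gs[m /= mN <-]|[m ->]]; first by exists (Ordinal mN).
  by apply: gf => /=.
- by move=> W F; rewrite (reindex_fsbig _ _ _ _ gbij) -fsbig_ord.
Qed.

Definition sol a : 'I_N -> C :=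
  if pselect (Omega P Q a) is left h then projT1 (cid (Omega_sol h)) else fun=> 0.

Lemma sol_spec a : Omega P Q a ->
  [/\ injective (sol a), (forall z, solutions P Q a z <-> exists m, z = sol a m)
    & forall (W : nmodType) (F : C -> W), \sum_(z \in solutions P Q a) F z = \sum_m F (sol a m)].
Proof.
rewrite /sol; case: pselect => // h _; by case: (cid _).
Qed.

Lemma sol_inj a : Omega P Q a -> injective (sol a). Proof. by case/sol_spec. Qed.
Lemma sol_sum a (W : nmodType) (F : C -> W) : Omega P Q a ->
  \sum_(z \in solutions P Q a) F z = \sum_m F (sol a m).
Proof. by case/sol_spec => _ _; apply. Qed.
Lemma sol_solutions a m : Omega P Q a -> solutions P Q a (sol a m).
Proof. by case/sol_spec => _ h _; apply/h; exists m. Qed.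
Lemma sol_Q a m : Omega P Q a -> Q.[sol a m] != 0.
Proof. by move=> /(sol_solutions m)[]. Qed.
Lemma sol_r a m : Omega P Q a -> r (sol a m) = a.
Proof. by move=> /(sol_solutions m)[]. Qed.

Lemma poly_sol_eq0 a (T : {poly C}) : Omega P Q a -> (size T <= N)%N ->
  (forall m, T.[sol a m] = 0) -> T = 0.
Proof.
move=> Oa sT h.
apply: (@roots_geq_poly_eq0 _ T [seq sol a m | m : 'I_N]).
- by apply/allP => _ /mapP[m _ ->]; rewrite rootE h.
- by rewrite map_inj_uniq ?enum_uniq //; exact: sol_inj.
- by rewrite size_map size_enum_ord.
Qed.

(** With N distinct roots, the level polynomial has degree N and simple roots. *)
Lemma level_deriv a m : Omega P Q a -> (level a)^`().[sol a m] != 0.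
Proof.
move=> Oa; apply/negP => /eqP d0.
have rt m' : root (level a) (sol a m') by apply/solutionsP; exact: sol_solutions.
have /factor_theorem[q hq] := rt m.
have q0 : q != 0 by apply: contraNneq (level_neq0 a) => q0; rewrite hq q0 mul0r.
have sq : (size q <= N)%N.
  have := level_size a; rewrite hq size_Mmonic ?monicXsubC // size_XsubC addn2 /= ltnS.
  by [].
have : q = 0; last by apply/eqP.
apply: (poly_sol_eq0 Oa sq) => m'.
have [<-|mm] := eqVneq m m'.
  move: d0; rewrite hq derivM derivXsubC mulr1 hornerD hornerM hornerXsubC subrr mulr0 add0r.
  by [].
have := rt m'; rewrite rootE hq hornerM hornerXsubC mulf_eq0 subr_eq0 => /orP[/eqP //|].
by move/eqP/(sol_inj Oa) => e; rewrite e eqxx in mm.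
Qed.

Lemma level_deriv_wronsk a z : Q.[z] != 0 -> r z = a ->
  (level a)^`().[z] = wronsk.[z] / Q.[z].
Proof.
move=> Qz <-; rewrite /level derivB derivZ /wronsk /ratf !(hornerD, hornerN, hornerM, hornerZ); field; exact: Qz.
Qed.

Lemma sol_cderiv a m : Omega P Q a ->
  cderiv r (sol a m) = (level a)^`().[sol a m] / Q.[sol a m].
Proof.
move=> Oa; have Qw := sol_Q m Oa.
by rewrite r_cderiv // (level_deriv_wronsk Qw (sol_r m Oa)); field.
Qed.

Lemma sol_cderiv_neq0 a m : Omega P Q a -> cderiv r (sol a m) != 0.
Proof.
by move=> Oa; rewrite sol_cderiv // mulf_neq0 ?level_deriv // invr_eq0 sol_Q.
Qed.

(** Lagrange interpolation of T at the roots of the level polynomial, divided by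
    that polynomial; r' is the derivative of the level polynomial over Q there. *)
Lemma lagrange a (T : {poly C}) z : Omega P Q a -> (size T <= N)%N ->
  Q.[z] != 0 -> r z != a ->
  \sum_m (cderiv r (sol a m) * (z - sol a m))^-1 * ratf T Q (sol a m) =
  (r z - a)^-1 * ratf T Q z.
Proof.
move=> Oa sT Qz za.
have rt m : root (level a) (sol a m) by apply/solutionsP; exact: sol_solutions.
have /choice[q hq] : forall m, exists q, level a = q * ('X - (sol a m)%:P).
  by move=> m; apply/factor_theorem.
have lz : (level a).[z] != 0 by rewrite level_ratf // mulf_neq0 // subr_eq0.
have zw m : z - sol a m != 0.
  by rewrite subr_eq0; apply: contraNneq za => ->; rewrite sol_r.
have qe m : (q m).[z] = (level a).[z] / (z - sol a m).
  by rewrite (hq m) hornerM hornerXsubC mulfK.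
have qm m : (q m).[sol a m] = (level a)^`().[sol a m].
  by rewrite [X in X^`()](hq m) derivM derivXsubC mulr1 hornerD hornerM hornerXsubC subrr mulr0 add0r.
have qm' m m' : m' != m -> (q m).[sol a m'] = 0.
  move=> mm; have := rt m'; rewrite rootE (hq m) hornerM hornerXsubC mulf_eq0 subr_eq0.
  by case/orP => [/eqP //|/eqP/(sol_inj Oa) e]; rewrite e eqxx in mm.
have sq m : (size (q m) <= N)%N.
  have q0 : q m != 0 by apply: contraNneq (level_neq0 a) => q0; rewrite (hq m) q0 mul0r.
  by have := level_size a; rewrite (hq m) size_Mmonic ?monicXsubC // size_XsubC addn2 /= ltnS.
have TE : T = \sum_m (T.[sol a m] / (level a)^`().[sol a m]) *: q m.
  apply/eqP; rewrite -subr_eq0; apply/eqP; apply: (poly_sol_eq0 Oa).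
    apply: leq_trans (size_polyD _ _) _; rewrite geq_max sT size_polyN /=.
    apply: leq_trans (size_sum _ _ _) _; apply/bigmax_leqP => m _.
    exact: leq_trans (size_scale_leq _ _) (sq m).
  move=> m; rewrite hornerD hornerN horner_sum (bigD1 m) //= big1 => [|m' mm].
    by rewrite addr0 hornerZ qm divfK ?subrr // level_deriv.
  by rewrite hornerZ qm' ?mulr0 // eq_sym.
have -> : (r z - a)^-1 * ratf T Q z = T.[z] / (level a).[z].
  by rewrite level_ratf // (_ : ratf T Q z = T.[z] / Q.[z]) // invfM mulrC mulrA.
rewrite [in RHS]TE horner_sum mulr_suml; apply: eq_bigr => m _.
rewrite hornerZ qe sol_cderiv // /ratf.
by field; rewrite !lz zw level_deriv // sol_Q.
Qed.

Lemma wronsk_neq0 : wronsk != 0.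
Proof.
apply/negP => /eqP /eqP; rewrite subr_eq0 => /eqP e.
have : P %| P^`() * Q by rewrite e dvdp_mulr.
rewrite Gauss_dvdpl // => dP.
have P0 : P != 0 by rewrite -size_poly_eq0 degP.
have d0 : P^`() != 0.
  apply/negP => /eqP d0; have := coef_deriv P N.-1.
  rewrite d0 coef0 prednK // => /esym/eqP; rewrite mulrn_eq0 eqn0Ngt N_gt0 /=.
  by rewrite -[P`_N]/(P`_(N.+1.-1)) -degP -lead_coefE lead_coef_eq0 (negPf P0).
by have := dvdp_leq d0 dP; rewrite leqNgt lt_size_deriv.
Qed.

(** All but finitely many values belong to Omega: critical values and the
    value at infinity are excluded. *)
Lemma Omega_cofinite : exists bad : seq C, forall a, a \notin bad -> Omega P Q a.
Proof.
have [rs hrs] := closed_field_poly_normal wronsk.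
have rsP z : root wronsk z -> z \in rs.
  rewrite {1}hrs rootZ ?lead_coef_eq0 ?wronsk_neq0 // root_prod_XsubC //.
exists (P`_N / Q`_N :: map r rs) => a; rewrite inE negb_or => /andP[ainf acrit].
have P_N : P`_N != 0.
  by rewrite -[P`_N]/(P`_(N.+1.-1)) -degP -lead_coefE lead_coef_eq0 -size_poly_eq0 degP.
have lN : (level a)`_N != 0.
  rewrite /level coefB coefZ subr_eq0; apply: contraNneq ainf => e.
  have QN : Q`_N != 0 by apply: contraNneq P_N => QN; rewrite e QN mulr0.
  by rewrite e mulfK.
have ls : size (level a) = N.+1.
  by apply/eqP; rewrite eqn_leq level_size /= ltnNge; apply: contraNN lN => h; rewrite nth_default.
have [ss hss] := closed_field_poly_normal (level a).
have lc0 : lead_coef (level a) != 0 by rewrite lead_coef_eq0 level_neq0.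
have ssP z : root (level a) z = (z \in ss).
  by rewrite {1}hss rootZ // root_prod_XsubC.
have sss : size ss = N.
  have := ls; rewrite {1}hss size_scale // size_prod_XsubC => -[].
  by [].
have uss : uniq ss.
  apply/negPn/negP => nu.
  have [z [zs mult]] : exists z, z \in ss /\ exists ss', perm_eq ss (z :: z :: ss').
    have /uniqPn := nu => /(_ 0) [i [j [ij js e]]].
    pose x := ss`_i; have xs : x \in ss by rewrite mem_nth // (ltn_trans ij).
    exists x; split => //; have p1 := perm_to_rem xs.
    have : x \in rem x ss.
      have : (1 < count_mem x ss)%N.
        rewrite -[ss](cat_take_drop j) count_cat.
        have h1 : x \in take j ss.
          by rewrite /x -(nth_take 0 ij) mem_nth // size_take js.
        have h2 : x \in drop j ss.
          by rewrite /x e -[j in ss`_j]addn0 -nth_drop mem_nth // size_drop subn_gt0.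
        rewrite -has_pred1 has_count in h1; rewrite -has_pred1 has_count in h2.
        by rewrite -[2%N]/(1 + 1)%N leq_add.
      move/permP: p1 => /(_ (pred1 x)) /= ->; rewrite eqxx add1n ltnS -has_count.
      by rewrite has_pred1.
    move=> /perm_to_rem p2; exists (rem x (rem x ss)).
    by apply: perm_trans p1 _; rewrite perm_cons.
  have [ss' pss] := mult.
  have [Qz rz] : solutions P Q a z by apply/solutionsP; rewrite ssP.
  have : root wronsk z.
    have d : (level a)^`().[z] = 0.
      rewrite hss derivZ hornerZ (perm_big _ pss) /= !big_cons !derivM !derivXsubC.
      by rewrite !(hornerXsubC, hornerC, hornerM, hornerD) subrr !(mul0r, mulr0, mulr1, mul1r, addr0, add0r).
    move: d; rewrite (level_deriv_wronsk Qz rz) => /eqP.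
    by rewrite mulf_eq0 invr_eq0 (negPf Qz) orbF rootE.
  by move/rsP => zrs; move/negP: acrit; apply; rewrite -rz; exact: map_f.
rewrite /Omega /= degP /=; apply/card_set_bijP; exists (fun z => index z ss); split.
- by move=> z /= /solutionsP; rewrite ssP -sss index_mem.
- move=> y z; rewrite !inE => /solutionsP + /solutionsP; rewrite !ssP => ys zs e.
  by rewrite -(nth_index 0 ys) e nth_index.
- move=> m /= mN; exists ss`_m; last by rewrite index_uniq // sss.
  by apply/solutionsP; rewrite ssP mem_nth // sss.
Qed.

End Rational.

(** * The space L(r) and the matrix X *)

Section Basis.
Variables (R : realType) (P Q : {poly R[i]}) (N : nat).
Local Notation C := (R[i]).
Hypotheses (coprimePQ : coprimep P Q) (degQP : (size Q <= size P)%N)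
  (N_gt0 : (0 < N)%N) (degP : size P = N.+1) (r_real : real_fun (ratf P Q)).
Local Notation r := (ratf P Q).
Local Notation sol := (sol Q degP).
Local Notation Omega := (Omega P Q).

Lemma diff_quot_ratf a : Q.[a] != 0 -> exists2 T : {poly C}, (size T <= N)%N &
  forall z, diff_quot P Q a z = ratf T Q z.
Proof.
move=> Qa; pose p := P - r a *: Q.
have pa : root p a by rewrite rootE hornerD hornerN hornerZ /ratf divfK // subrr.
have /factor_theorem[T pT] := pa.
exists T.
  have [->|T0] := eqVneq T 0; first by rewrite size_poly0.
  have := level_size degQP degP (r a); rewrite -/p -[level P Q (r a)]/p pT.
  by rewrite size_Mmonic ?monicXsubC // size_XsubC addn2 /= ltnS.
move=> z; rewrite /diff_quot /on_domain /patch.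
have [Qz|Qz] := eqVneq Q.[z] 0; last first.
  rewrite mem_set //; have [->|za] := eqVneq z a.
    rewrite (r_cderiv P Qa).
    have h : p^`().[a] = T.[a].
      by rewrite pT derivM derivXsubC mulr1 hornerD hornerM hornerXsubC subrr mulr0 add0r.
    have -> : ratf T Q a = p^`().[a] / Q.[a] by rewrite h.
    rewrite /p /wronsk /ratf !(hornerD, hornerN, hornerM, derivB, derivZ, hornerZ).
    by field.
  have h : p.[z] = T.[z] * (z - a) by rewrite pT hornerM hornerXsubC.
  have za0 : z - a != 0 by rewrite subr_eq0.
  have -> : r z - r a = p.[z] / Q.[z].
    by rewrite /p hornerD hornerN hornerZ [r z]/ratf mulrBl mulfK.
  by rewrite h /ratf; field; rewrite Qz za0.
rewrite memNset ?/ratf ?Qz ?invr0 ?mulr0 //.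
by rewrite /analytic_pts /= Qz eqxx.
Qed.

Lemma Lspace_ratf h : Defs.Lspace P Q h -> exists2 T : {poly C}, (size T <= N)%N &
  forall z, h z = ratf T Q z.
Proof.
move=> [m [a [c [Qa hE]]]].
have /choice[T hT] : forall k, exists T : {poly C}, (size T <= N)%N /\
  forall z, diff_quot P Q (a k) z = ratf T Q z.
  by move=> k; have [T sT eT] := diff_quot_ratf (Qa k); exists T.
exists (\sum_(k < m) c k *: T k).
  apply: leq_trans (size_sum _ _ _) _; apply/bigmax_leqP => k _.
  by apply: leq_trans (size_scale_leq _ _) _; case: (hT k).
move=> z; rewrite hE /ratf horner_sum mulr_suml; apply: eq_bigr => k _.
by have [_ ->] := hT k; rewrite hornerZ mulrA.
Qed.

Variables (e : 'I_N -> C -> C).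
Hypothesis (e_basis : real_basis P Q e).

Lemma e_ratf k : exists2 T : {poly C}, (size T <= N)%N & forall z, e k z = ratf T Q z.
Proof. by apply: Lspace_ratf; case: e_basis. Qed.

Lemma e_ccont k z : Q.[z] != 0 -> ccont (e k) z.
Proof.
move=> Qz; have [T _ eT] := e_ratf k.
have -> : e k = ratf T Q by apply/funext.
exact: ratf_ccont.
Qed.

Lemma e_lagrange k a z : Omega a -> Q.[z] != 0 -> r z != a ->
  \sum_m (cderiv r (sol a m) * (z - sol a m))^-1 * e k (sol a m) = (r z - a)^-1 * e k z.
Proof.
move=> Oa Qz za; have [T sT eT] := e_ratf k.
rewrite eT -(lagrange coprimePQ degQP N_gt0 degP Oa sT Qz za).
by apply: eq_bigr => m _; rewrite eT.
Qed.

Definition vdm a : 'M[C]_N := \matrix_(m, k) e k (sol a m).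

(** A combination of the basis functions vanishing at the N roots of r = a has a
    numerator of degree less than N with N roots. *)
Lemma vdm_unit a : Omega a -> vdm a \in unitmx.
Proof.
move=> Oa; rewrite -unitmx_tr unitmxE unitfE; apply/negP => /det0P[v v0 vA].
have /choice[T hT] : forall k, exists T : {poly C}, (size T <= N)%N /\
  forall z, e k z = ratf T Q z.
  by move=> k; have [T sT eT] := e_ratf k; exists T.
have [_ free _ _] := e_basis.
pose U := \sum_k v 0 k *: T k.
have UE z : \sum_k v 0 k * e k z = ratf U Q z.
  rewrite /ratf /U horner_sum mulr_suml; apply: eq_bigr => k _.
  by have [_ ->] := hT k; rewrite hornerZ mulrA.
have U0 : U = 0.
  apply: (poly_sol_eq0 (degP := degP) Oa).
    apply: leq_trans (size_sum _ _ _) _; apply/bigmax_leqP => k _.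
    by apply: leq_trans (size_scale_leq _ _) _; case: (hT k).
  move=> m; have := congr1 (fun w : 'rV[C]_N => w 0 m) vA; rewrite !mxE.
  under eq_bigr do rewrite !mxE.
  rewrite UE /ratf => /eqP; rewrite mulf_eq0 invr_eq0 (negPf (sol_Q degP m Oa)) orbF.
  by move/eqP.
have := free (fun k => v 0 k); have h z : \sum_k v 0 k * e k z = 0.
  by rewrite UE U0 /ratf horner0 mul0r.
move=> /(_ h) hv; move/negP: v0; apply; apply/eqP/matrixP => i k.
by rewrite ord1 hv mxE.
Qed.

Variable p : nat.
Local Notation ZI := (@ZI R N p e).

Lemma ZIE z i k j : ZI z i (mxtens_index (k, j)) = e k z * (i == j)%:R.
Proof.
rewrite /ZI castmxE /=.
have -> : cast_ord (esym (mul1n p)) i = mxtens_index (ord0 : 'I_1, i).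
  by apply: val_inj => /=; rewrite mul0n add0n.
by rewrite cast_ord_id tensmxE !mxE.
Qed.

Lemma sum_mxtens (W : nmodType) (F : 'I_(N * p) -> W) :
  \sum_i F i = \sum_k \sum_j F (mxtens_index (k, j)).
Proof.
rewrite pair_big /= (reindex (@mxtens_index N p)) /=.
  by apply: eq_bigr => -[k j] _.
exists (@mxtens_unindex N p) => x _; [exact: mxtens_indexK|exact: mxtens_unindexK].
Qed.

Lemma ZI_mulE m z (F : 'M[C]_(N * p, m)) i c :
  (ZI z *m F) i c = \sum_k e k z * F (mxtens_index (k, i)) c.
Proof.
rewrite mxE sum_mxtens; apply: eq_bigr => k _.
rewrite (bigD1 i) //= big1 ?addr0; first by rewrite ZIE eqxx mulr1.
by move=> j ji; rewrite ZIE eq_sym (negPf ji) mulr0 mul0r.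
Qed.

(** When f = (Z_r (x) I) F(r), this is F(a). *)
Definition evl a (f : C -> 'cV[C]_p) : 'cV[C]_(N * p) :=
  \col_i \sum_m invmx (vdm a) (mxtens_unindex i).1 m * f (sol a m) (mxtens_unindex i).2 0.

Lemma evl_spec a f m : Omega a -> ZI (sol a m) *m evl a f = f (sol a m).
Proof.
move=> Oa; apply/matrixP => i c; rewrite ord1 ZI_mulE.
under eq_bigr => k _ do rewrite mxE mxtens_indexK /= mulr_sumr.
rewrite exchange_big /=.
have h m' : \sum_k e k (sol a m) * (invmx (vdm a) k m' * f (sol a m') i 0)
    = (m == m')%:R * f (sol a m') i 0.
  have := congr1 (fun M : 'M[C]_N => M m m') (mulmxV (vdm_unit Oa)).
  rewrite !mxE => <-; rewrite mulr_suml; apply: eq_bigr => k _.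
  by rewrite !mxE mulrA.
under eq_bigr => m' _ do rewrite h.
rewrite (bigD1 m) //= eqxx mul1r big1 ?addr0 // => m' mm.
by rewrite eq_sym (negPf mm) mul0r.
Qed.

Lemma evl_uniq a f F : Omega a -> (forall m, ZI (sol a m) *m F = f (sol a m)) -> evl a f = F.
Proof.
move=> Oa hF; apply/matrixP => i c; rewrite ord1 mxE.
case: (mxtens_indexP i) => k j; rewrite mxtens_indexK /=.
under eq_bigr => m _ do rewrite -hF ZI_mulE mulr_sumr.
rewrite exchange_big /=.
have h k' : \sum_m invmx (vdm a) k m * (e k' (sol a m) * F (mxtens_index (k', j)) 0)
    = (k == k')%:R * F (mxtens_index (k', j)) 0.
  have := congr1 (fun M : 'M[C]_N => M k k') (mulVmx (vdm_unit Oa)).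
  rewrite !mxE => <-; rewrite mulr_suml; apply: eq_bigr => m _.
  by rewrite !mxE mulrA.
under eq_bigr => k' _ do rewrite h.
rewrite (bigD1 k) //= eqxx mul1r big1 ?addr0 // => k' kk.
by rewrite eq_sym (negPf kk) mul0r.
Qed.

Lemma evl_lin a c f g : evl a (c *: f + g) = c *: evl a f + evl a g.
Proof.
apply/matrixP => i j; rewrite !mxE mulr_sumr -big_split; apply: eq_bigr => m _ /=.
by rewrite !mxE; ring.
Qed.

Lemma ZI_lagrange a z : Omega a -> Q.[z] != 0 -> r z != a ->
  \sum_m (cderiv r (sol a m) * (z - sol a m))^-1 *: ZI (sol a m) = (r z - a)^-1 *: ZI z.
Proof.
move=> Oa Qz za; apply/matrixP => i c; case: (mxtens_indexP c) => k j.
rewrite summxE mxE ZIE mulrA -e_lagrange // mulr_suml; apply: eq_bigr => m _.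
by rewrite mxE ZIE mulrA.
Qed.

Lemma poly_eq0_everywhere (T : {poly C}) : (forall z, T.[z] = 0) -> T = 0.
Proof.
move=> h; apply: (@roots_geq_poly_eq0 _ T [seq n%:R | n <- iota 0 (size T)]).
- by apply/allP => _ /mapP[m _ ->]; rewrite rootE h.
- by rewrite map_inj_uniq ?iota_uniq // => m n /eqP; rewrite eqr_nat => /eqP.
- by rewrite size_map size_iota.
Qed.

(** The reality of r, as a function, does not make P and Q real, but P / Q and
    its reflection have the same poles because P and Q are coprime. *)
Lemma Q_conj z : Q.[z] != 0 -> Q.[z^*] != 0.
Proof.
pose Pc := map_poly Num.conj P; pose Qc := map_poly Num.conj Q.
have PcE y : Pc.[y] = (P.[y^*])^* by rewrite -{1}[y]conjCK /Pc horner_map.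
have QcE y : Qc.[y] = (Q.[y^*])^* by rewrite -{1}[y]conjCK /Qc horner_map.
have Q0 : Q != 0.
  apply/negP => /eqP Q0; move: coprimePQ; rewrite Q0 coprimep0 => /eqp_size.
  by rewrite degP size_poly1 => -[N0]; move: N_gt0; rewrite N0.
have Qc0 : Qc != 0 by rewrite /Qc map_poly_eq0.
have key : P * Qc = Pc * Q.
  apply/eqP; rewrite -subr_eq0; apply/eqP.
  have : (P * Qc - Pc * Q) * (Q * Qc) = 0.
    apply: poly_eq0_everywhere => y; rewrite hornerM.
    have [Qy|Qy] := eqVneq Q.[y] 0; first by rewrite [(Q * Qc).[y]]hornerM Qy mul0r mulr0.
    have [Qcy|Qcy] := eqVneq Qc.[y] 0; first by rewrite [(Q * Qc).[y]]hornerM Qcy !mulr0.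
    have Qy' : Q.[y^*] != 0 by move: Qcy; rewrite QcE fmorph_eq0.
    have e1 : P.[y] / Q.[y] = Pc.[y] / Qc.[y].
      by rewrite PcE QcE -fmorphV -rmorphM; exact: r_real.
    have : P.[y] * Qc.[y] = Pc.[y] * Q.[y].
      by rewrite -[P.[y]](divfK Qy) e1 mulrAC divfK.
    by rewrite hornerD hornerN !hornerM => ->; rewrite subrr mul0r.
  by move/eqP; rewrite mulf_eq0 [Q * Qc == 0]mulf_eq0 (negPf Q0) (negPf Qc0) !orbF => /eqP.
move=> Qz; apply/negP => /eqP Qz'.
have Qcz : Qc.[z] = 0 by rewrite QcE Qz' rmorph0.
have := congr1 (fun T : {poly C} => T.[z]) key; rewrite /= !hornerM Qcz mulr0.
move/esym/eqP; rewrite mulf_eq0 (negPf Qz) orbF PcE fmorph_eq0.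
by rewrite (negPf (coprime_num_den coprimePQ Qz')).
Qed.

Lemma r_conj z : r z^* = (r z)^*.
Proof. by rewrite [r z]r_real conjCK. Qed.

Lemma solutions_conj a z : solutions P Q a z -> solutions P Q a^* z^*.
Proof. by move=> [Qz rz]; split; [exact: Q_conj|rewrite r_conj rz]. Qed.

Lemma solutions_conj_bij a : set_bij (solutions P Q a) (solutions P Q a^*) Num.conj.
Proof.
split.
- by move=> z /solutions_conj.
- by move=> y z _ _ e1; rewrite -[y]conjCK e1 conjCK.
- move=> z /solutions_conj; rewrite conjCK => h; exists z^* => //; exact: conjCK.
Qed.

Lemma Omega_conj a : Omega a -> Omega a^*.
Proof.
rewrite /Defs.Omega /= => h; apply: card_eq_trans h.
have -> : solutions P Q a^* = Num.conj @` solutions P Q a.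
  apply/seteqP; split => [z hz|_ [z hz <-]]; last exact: solutions_conj.
  exists z^*; last exact: conjCK.
  by rewrite -[a]conjCK; exact: solutions_conj.
apply: inj_card_eq => x y _ _ e1; by rewrite -[x]conjCK e1 conjCK.
Qed.

Lemma r_cderiv_conj z : Q.[z] != 0 -> cderiv r z^* = (cderiv r z)^*.
Proof.
move=> Qz; apply: has_cderiv_cderiv; rewrite (r_cderiv P Qz).
have [q qc qz hq] := r_has_cderiv P Qz.
exists (fun y => (q y^*)^*).
- apply: (@ccont_comp _ (fun y => q y^*) Num.conj); last exact: ccont_conj.
  by apply: (@ccont_comp _ Num.conj q); [exact: ccont_conj|rewrite conjCK].
- by rewrite conjCK qz.
- by move=> y; rewrite -{1}[y]conjCK r_conj hq rmorphD r_conj (rmorphM _ (y^* - z)) rmorphB /= conjCK.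
Qed.

Lemma ZI_conj z : adjmx (ZI z) = (ZI z^*)^T.
Proof.
have [_ _ _ e_real] := e_basis.
apply/matrixP => c i; rewrite adjmxE mxE; case: (mxtens_indexP c) => k j.
by rewrite !ZIE rmorphM rmorph_nat e_real /= conjCK.
Qed.

Variable J : 'M[R]_p.
Hypothesis J_signature : signature_mx J.
Local Notation JC := (cmx J).

Lemma JC_tr : JC^T = JC.
Proof. by have [JT _ _] := J_signature; rewrite /cmx map_trmx -JT. Qed.

Lemma JC_adj : adjmx JC = JC.
Proof.
by rewrite /adjmx JC_tr; apply/matrixP => i j; rewrite !mxE conj_realC.
Qed.

Lemma JC_unit : JC \in unitmx.
Proof. by have [_ JU _] := J_signature; rewrite /cmx map_unitmx. Qed.

Local Notation Xa := (assoc_mx P Q e J).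

Lemma XaE a : Omega a -> Xa a =
  \sum_m (cderiv r (sol a m))^-1 *: ((ZI (sol a m))^T *m JC *m ZI (sol a m)).
Proof. by move=> Oa; rewrite /assoc_mx (sol_sum degP _ Oa). Qed.

(** This double sum can be evaluated by interpolation in either variable, whence
    double_sum_left and double_sum_right. *)
Definition double_sum a c := \sum_u \sum_v
  ((cderiv r (sol c v))^-1 * (cderiv r (sol a u))^-1 / (sol a u - sol c v)) *:
  ((ZI (sol c v))^T *m JC *m ZI (sol a u)).

Lemma trmxZ m n k (A : 'M[C]_(m, n)) : (k *: A)^T = k *: A^T.
Proof. by apply/matrixP => i j; rewrite !mxE. Qed.

Lemma double_sum_left a c : Omega a -> Omega c -> a != c -> double_sum a c = (a - c)^-1 *: Xa a.
Proof.
move=> Oa Oc ac; rewrite XaE // scaler_sumr; apply: eq_bigr => u _.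
have Qu := sol_Q degP u Oa.
have ru : r (sol a u) != c by rewrite sol_r.
have := ZI_lagrange Oc Qu ru; rewrite sol_r // => h.
have -> : (a - c)^-1 *: ((cderiv r (sol a u))^-1 *: ((ZI (sol a u))^T *m JC *m ZI (sol a u)))
    = (cderiv r (sol a u))^-1 *: (((a - c)^-1 *: ZI (sol a u))^T *m JC *m ZI (sol a u)).
  by rewrite trmxZ -!scalemxAl !scalerA mulrC.
rewrite -h.
rewrite (raddf_sum (@trmx C p (N * p)%N)) !mulmx_suml scaler_sumr; apply: eq_bigr => v _ /=.
rewrite trmxZ -!scalemxAl scalerA; congr (_ *: _).
move: (cderiv r _) (cderiv r _) (_ - _) => x y t.
by rewrite invfM mulrA [x^-1 * y^-1]mulrC.
Qed.

Lemma double_sum_right a c : Omega a -> Omega c -> a != c -> double_sum a c = (a - c)^-1 *: Xa c.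
Proof.
move=> Oa Oc ac; rewrite XaE // scaler_sumr /double_sum exchange_big /=; apply: eq_bigr => v _.
have Qv := sol_Q degP v Oc.
have rv : r (sol c v) != a by rewrite sol_r // eq_sym.
have := ZI_lagrange Oa Qv rv; rewrite sol_r // => h.
have -> : (a - c)^-1 *: ((cderiv r (sol c v))^-1 *: ((ZI (sol c v))^T *m JC *m ZI (sol c v)))
    = - (cderiv r (sol c v))^-1 *: ((ZI (sol c v))^T *m JC *m ((c - a)^-1 *: ZI (sol c v))).
  by rewrite -scalemxAr !scalerA -(opprB a c) invrN mulrNN mulrC.
rewrite -h mulmx_sumr scaler_sumr; apply: eq_bigr => u _.
rewrite -scalemxAr scalerA; congr (_ *: _).
rewrite -(opprB (sol a u)); move: (cderiv r _) (cderiv r _) (_ - _) => x y t.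
by rewrite mulrN invrN mulrNN invfM mulrA.
Qed.

(** Both are (a - c) times the same double sum. *)
Lemma X_indep a c : Omega a -> Omega c -> Xa a = Xa c.
Proof.
move=> Oa Oc; have [->//|ac] := eqVneq a c.
have ac0 : (a - c)^-1 != 0 by rewrite invr_eq0 subr_eq0.
by apply: (scalerI ac0); rewrite -double_sum_left // -double_sum_right.
Qed.

(** The reflections of the roots for a are the roots for a^*, and X does not
    depend on the level. *)
Lemma X_adj a : Omega a -> adjmx (Xa a) = Xa a.
Proof.
move=> Oa; have Oa' := Omega_conj Oa; rewrite -[RHS](X_indep Oa' Oa).
rewrite {2}/assoc_mx (reindex_fsbig _ _ _ _ (solutions_conj_bij a)) (sol_sum degP _ Oa) XaE //.
have -> (I : finType) (F : I -> 'M[C]_(N * p)) : adjmx (\sum_i F i) = \sum_i adjmx (F i).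
  by apply: big_morph => [A B|]; [exact: adjmxD|apply/matrixP => i j; rewrite adjmxE !mxE conjC0].
apply: eq_bigr => m _; rewrite adjmxZ !adjmxM JC_adj ZI_conj.
have -> : adjmx (ZI (sol a m))^T = ZI (sol a m)^*.
  by rewrite -[RHS]trmxK -ZI_conj /adjmx map_trmx.
by rewrite r_cderiv_conj ?sol_Q // fmorphV mulmxA.
Qed.

Lemma evl_0 a : evl a 0 = 0.
Proof.
apply/matrixP => i j; rewrite mxE big1 ?mxE // => m _.
have -> : (0 : C -> 'cV[C]_p) (sol a m) = 0 by [].
by rewrite [X in _ * X]mxE mulr0.
Qed.

Lemma X_unit a : Omega a -> Xa a \in unitmx.
Proof.
move=> Oa; rewrite -unitmx_tr unitmxE unitfE; apply/negP => /det0P[v v0 vA].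
have XF : Xa a *m v^T = 0 by rewrite -[LHS]trmxK trmx_mul trmxK vA trmx0.
have ZF m : ZI (sol a m) *m v^T = 0.
  apply: (can_inj (mulKmx JC_unit)); rewrite mulmx0.
  apply/matrixP => i c; rewrite [c]ord1.
  (* pair with the vector whose value is the i-th unit vector at the m-th root *)
  pose f z : 'cV[C]_p := if z == sol a m then delta_mx i 0 else 0.
  have fm m' : ZI (sol a m') *m evl a f = if m' == m then delta_mx i 0 else 0.
    by rewrite evl_spec // /f (inj_eq (sol_inj Oa)).
  have : (evl a f)^T *m (Xa a *m v^T) = 0 by rewrite XF mulmx0.
  move=> /(congr1 (fun M : 'M[C]_1 => M 0 0)); rewrite [RHS]mxE XaE //.
  have step (k : C) (Z : 'M[C]_(p, N * p)) : (evl a f)^T *m (k *: (Z^T *m JC *m Z) *m v^T)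
      = k *: ((Z *m evl a f)^T *m (JC *m (Z *m v^T))).
    by rewrite trmx_mul -scalemxAl -scalemxAr !mulmxA.
  rewrite mulmx_suml mulmx_sumr summxE (bigD1 m) //= big1 ?addr0; last first.
    by move=> m' mm; rewrite step fm (negPf mm) trmx0 mul0mx scaler0 mxE.
  rewrite step fm eqxx mxE trmx_delta -rowE [row _ _ _ _]mxE => /eqP.
  rewrite mulf_eq0 invr_eq0 (negPf (sol_cderiv_neq0 coprimePQ degQP N_gt0 degP m Oa)) /=.
  by move=> /eqP ->; rewrite mxE.
have v0' : v^T = 0.
  rewrite -(evl_0 a); apply/esym; apply: evl_uniq => // m; by rewrite ZF.
move/negP: v0; apply; apply/eqP; by rewrite -[v]trmxK v0' trmx0.
Qed.

(** In condition (1) the double sum couples the level a with the level b^*, whose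
    roots are the conjugates of the roots for b. *)
Lemma rhs_sum a b (f g : C -> 'cV[C]_p) : Omega a -> Omega b -> a != b^* ->
  \sum_(u \in solutions P Q a) \sum_(v \in solutions P Q b)
    ((((cderiv r v)^*)^-1 *: adjmx (g v)) *m JC *m ((cderiv r u)^-1 *: f u)) 0 0 / (u - v^*)
  = (a - b^*)^-1 * (adjmx (evl b g) *m Xa a *m evl a f) 0 0.
Proof.
move=> Oa Ob ab; have Ob' := Omega_conj Ob.
have -> : (a - b^*)^-1 * (adjmx (evl b g) *m Xa a *m evl a f) 0 0 =
    (adjmx (evl b g) *m double_sum a b^* *m evl a f) 0 0.
  by rewrite double_sum_left // -scalemxAr -scalemxAl [RHS]mxE.
rewrite (sol_sum degP _ Oa) /double_sum mulmx_sumr mulmx_suml summxE; apply: eq_bigr => u _.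
rewrite mulmx_sumr mulmx_suml summxE.
rewrite -(sol_sum degP (fun v => (adjmx (evl b g) *m
  (((cderiv r v)^-1 / cderiv r (sol a u) / (sol a u - v)) *: ((ZI v)^T *m JC *m ZI (sol a u)))
  *m evl a f) 0 0) Ob').
rewrite (reindex_fsbig _ _ _ _ (solutions_conj_bij b)) !(sol_sum degP _ Ob).
apply: eq_bigr => v _; have Qv := sol_Q degP v Ob.
rewrite r_cderiv_conj // -ZI_conj -(evl_spec f u Oa) -(evl_spec g v Ob) adjmxM.
have step (x y t : C) (G : 'rV[C]_(N * p)) Zv (Zu : 'M[C]_(p, N * p)) F :
    ((x *: (G *m Zv)) *m JC *m (y *: (Zu *m F))) 0 0 / t =
    (G *m ((x * y / t) *: (Zv *m JC *m Zu)) *m F) 0 0.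
  rewrite -!(scalemxAl, scalemxAr) !mulmxA !scalerA.
  by rewrite [LHS]mulrC [X in _ * X]mxE [RHS]mxE mulrA; congr (_ * _); ring.
exact: step.
Qed.

End Basis.

(** * The open set A *)

Section Disks.
Variables (R : realType) (P Q : {poly R[i]}) (N : nat).
Local Notation C := (R[i]).
Hypotheses (coprimePQ : coprimep P Q) (degQP : (size Q <= size P)%N)
  (N_gt0 : (0 < N)%N) (degP : size P = N.+1).
Variables (L : nat) (zeta : 'I_L -> C) (s : 'I_L -> R) (rho : R).
Hypothesis disks : zero_disks P Q zeta s rho.
Local Notation r := (ratf P Q).
Local Notation A := (Aset P Q zeta s).

Lemma circleE (c : C) (t : R) : 0 < t ->
  circle c t = [set z | nsq (z - c) = t ^+ 2].
Proof.
move=> t0; apply/seteqP; split => z; rewrite /circle /= normE.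
  by move=> [] <-; rewrite sqr_sqrtr ?nsq_ge0.
by move=> ->; rewrite sqrtr_sqr gtr0_norm.
Qed.

(** The images of the circles are compact, and there are finitely many. *)
Lemma Aset_open a : A a -> \forall z \near (a : C^o), A z.
Proof.
move=> Aa.
have step l : \forall z \near (a : C^o), ~ (r @` circle (zeta l) (s l)) (z : C).
  have cK : compact ((fun y : C^o => r (y : C) : C^o) @` (circle (zeta l) (s l) : set C^o)).
    apply: continuous_compact; last first.
      by rewrite circleE ?(zd_radius disks) //; exact: circle_compact.
    apply: continuous_in_subspaceT => z; rewrite inE => hz.
    have Qz : Q.[z] != 0 by apply: (zd_poles disks (l := l)); right.
    by have [h] := ratf_ccont P Qz.
  have := compact_closed (@norm_hausdorff _ C^o) cK.
  rewrite -openC openE => /(_ a); apply.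
  by move=> h; apply: Aa; exists l.
have h0 := filter_forall (nbhs_filter (a : C^o)) step.
apply: filterS h0 => z h [l _ hl].
exact: (h l).
Qed.

(** A zero of r on the boundary of a disk would be the centre of another disk,
    and that disk would meet the first one. *)
Lemma Aset_0 : A 0.
Proof.
move=> [l _ [z hz rz]].
have Qz : Q.[z] != 0 by apply: (zd_poles disks (l := l)); right.
have /(zd_zeros disks)[m zm] : root P z.
  rewrite rootE; move: rz => /eqP; rewrite /ratf mulf_eq0 invr_eq0 (negPf Qz) orbF.
  by [].
have sl := zd_radius disks l; have sm := zd_radius disks m.
move: hz; rewrite circleE //= => hz.
have t0 : 0 < s l + s m by rewrite addr_gt0.
pose t := s m / (s l + s m).
pose y := z + ((t%:C)%C) * (zeta l - z).
have yz : nsq (y - zeta m) = t ^+ 2 * s l ^+ 2.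
  rewrite -zm /y addrC addKr nsqM nsq_real; congr (_ * _).
  by rewrite -hz -nsqN opprB.
have yl : nsq (y - zeta l) = (1 - t) ^+ 2 * s l ^+ 2.
  have -> : y - zeta l = ((1 - t)%:C)%C * (z - zeta l).
    by rewrite rmorphB rmorph1 /y; ring.
  by rewrite nsqM nsq_real hz.
have tp : 0 < t by rewrite divr_gt0.
(* y lies on the segment from z to the centre of the first disk *)
have lm : l = m.
  apply: (zd_disjoint disks) => //; exists y; split; rewrite /disk /= norm_nsq_lt //.
    rewrite yl -subr_gt0 (_ : _ - _ = t * (2 - t) * s l ^+ 2); last by ring.
    have t1 : t < 1 by rewrite ltr_pdivrMr // mul1r ltrDr.
    have t2 : t < 2 by apply: lt_trans t1 _; rewrite ltr1n.
    by apply: mulr_gt0; rewrite ?exprn_gt0 //; apply: mulr_gt0; rewrite // subr_gt0.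
  rewrite yz -exprMn ltr_pXn2r ?nnegrE ?(mulr_ge0 (ltW tp)) ?ltW //.
  by rewrite /t mulrAC ltr_pdivrMr // mulrDr ltrDl mulr_gt0.
have : s l ^+ 2 = 0 by rewrite -hz zm -lm subrr nsq0.
by move/eqP; rewrite sqrf_eq0 gt_eqF.
Qed.

Definition Bset : set C := [set a | Omega P Q a /\ A a].

Lemma Omega_open_near a : (\forall z \near (a : C^o), Omega P Q z \/ z = a).
Proof.
have [bad hbad] := Omega_cofinite coprimePQ degQP N_gt0 degP.
have h (b : C) : \forall z \near (a : C^o), z != b \/ z = a.
  have [->|ab] := eqVneq a b.
    by apply/nbhs_nsq; exists 1 => // z _; have [|] := eqVneq z b; [right|left].
  by apply: filterS (near_neq ab) => z; left.
have : \forall z \near (a : C^o), z \notin bad \/ z = a.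
  elim: bad {hbad} => [|b bad ih]; first by apply/nbhs_nsq; exists 1 => // z _; left.
  apply: filterS2 (h b) ih => z [zb|->] [zbad|]; do ?by right.
  by left; rewrite inE negb_or zb.
by apply: filterS => z [/hbad|]; [left|right].
Qed.

Lemma Bset_open a : Bset a -> \forall z \near (a : C^o), Bset z.
Proof.
move=> [Oa Aa]; apply: filterS2 (Omega_open_near a) (Aset_open Aa) => z.
by move=> [Oz|->] Az; split.
Qed.

Lemma Bset_dense a (d : R) : A a -> 0 < d -> exists2 z, nsq (z - a) < d & Bset z /\ z != a.
Proof.
move=> Aa d0.
have [|z [Bz zd _ za _]] := @near_generic R (fun z => A z /\ (Omega P Q z \/ z = a)) a a a d _ d0.
  by apply: filterS2 (Aset_open Aa) (Omega_open_near a) => z.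
exists z => //; case: Bz => Az [Oz|zea]; first by [].
by rewrite zea eqxx in za.
Qed.

Lemma Bset_real (d : R) : 0 < d -> exists2 t : R, nsq ((t%:C)%C : C) < d & Bset (t%:C)%C.
Proof.
move=> d0.
have /nbhs_nsq[e e0 he] : \forall z \near (0 : C^o), A z /\ (Omega P Q z \/ z = 0).
  by apply: filterS2 (Aset_open Aset_0) (Omega_open_near 0) => z.
have m0 : 0 < Num.min 1 (Num.min d e) by rewrite !lt_min ltr01 d0 e0.
have [t [t0 tm _]] := avoid_list [::] m0.
move: tm; rewrite !lt_min => /and3P[t1 td te].
have tt : t ^+ 2 < t by rewrite expr2 -[X in _ < X]mulr1 ltr_pM2l.
exists t; first by rewrite nsq_real; exact: lt_trans td.
have [|At [Ot|]] := he (t%:C)%C; first by rewrite subr0 nsq_real; exact: lt_trans te.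
  by [].
by case=> t00; rewrite t00 ltxx in t0.
Qed.

Lemma preimA_open z : preimA P Q A z -> \forall y \near (z : C^o), preimA P Q A y.
Proof.
move=> [Qz Az]; have [rc] := ratf_ccont P Qz.
have h1 := rc _ (Aset_open Az).
apply: filterS2 (ccont_neq (ccont_horner Q z) Qz) h1 => y Qy Ay; split => //.
Qed.

End Disks.

(** * Functions on the preimage of A *)

Lemma clim_eq (R : realType) (h h' : R[i] -> R[i]) z : ccont h' z ->
  (\forall y \near (z : R[i]^o), y != z -> h y = h' y) -> clim h z = h' z.
Proof.
move=> [hc] hh; apply: (@cvg_lim R[i]^o); first exact: norm_hausdorff.
apply: (@cvg_trans _ ((h' : R[i]^o -> R[i]^o) y @[y --> (z : R[i]^o)^'])).
  apply: near_eq_cvg; rewrite /= /dnbhs /within /=.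
  by apply: filterS hh => y e yz; rewrite e.
by apply: cvg_within_filter; exact: hc.
Qed.

(** The algebra behind kernel_of_resolvent: k stands for a column of the kernel
    at (z, w), g for the value at z of its image under R_b, which is eliminated,
    and x and y for r(z) - b and r(w)^* - b. *)
Lemma kernel_elimination (K : fieldType) p n (Z : 'M[K]_(p, n)) (X Mz Mw : 'M[K]_n)
    (i x y : K) (d : 'cV[K]_n) (k g : 'cV[K]_p) :
  k - y *: (g - i *: (Z *m (Mz *m (X *m (Mw *m d))))) = Z *m (Mz *m d) ->
  x *: g = k - Z *m (Mw *m d) ->
  (- i * (x - y)) *: k =
    Z *m ((- (i * x) *: Mz - (- (i * y)) *: Mw - (i * x * - (i * y)) *: (Mz *m X *m Mw)) *m d).
Proof.
rewrite !mulmxBl !mulmxBr -!scalemxAl -!scalemxAr -!mulmxA.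
move: (Z *m (Mz *m d)) (Z *m (Mw *m d)) (Z *m (Mz *m _)) => v1 v2 v3 <- e2.
have {e2} -> : v2 = k - x *: g by rewrite e2 subKr.
apply/matrixP => a c; rewrite !mxE; ring.
Qed.

Section Model.
Variables (R : realType) (P Q : {poly R[i]}) (N : nat).
Local Notation C := (R[i]).
Hypotheses (coprimePQ : coprimep P Q) (degQP : (size Q <= size P)%N)
  (N_gt0 : (0 < N)%N) (degP : size P = N.+1).
Variables (e : 'I_N -> C -> C).
Hypothesis (e_basis : real_basis P Q e).
Variables (L : nat) (zeta : 'I_L -> C) (s : 'I_L -> R) (rho : R).
Hypothesis disks : zero_disks P Q zeta s rho.
Variable p : nat.
Local Notation r := (ratf P Q).
Local Notation A := (Aset P Q zeta s).
Local Notation B := (Bset P Q zeta s).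
Local Notation pA := (preimA P Q A).
Local Notation sol := (sol Q degP).
Local Notation ZI := (@ZI R N p e).
Local Notation V := (C -> 'cV[C]_p).
Local Notation evl := (@evl R P Q N degP e p).

Lemma sol_pA a m : B a -> pA (sol a m).
Proof. by move=> [Oa Aa]; split; [exact: sol_Q|rewrite sol_r]. Qed.

Lemma ZI_mccont z : Q.[z] != 0 -> mccont ZI z.
Proof.
move=> Qz i j; case: (mxtens_indexP j) => k l.
rewrite (_ : (fun y => _) = fun y => e k y * (i == l)%:R).
  by apply: ccontM; [exact: (e_ccont degQP degP e_basis)|exact: ccont_cst].
by apply/funext => y; rewrite ZIE.
Qed.

Lemma resolvent_formulaE a (f : V) z : Omega P Q a -> Q.[z] != 0 -> r z != a ->
  resolvent_formula P Q a f z = (r z - a)^-1 *: (f z - ZI z *m evl a f).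
Proof.
move=> Oa Qz za; rewrite /resolvent_formula (sol_sum degP _ Oa) scalerBr.
congr (_ - _); rewrite scalemxAl -(ZI_lagrange coprimePQ degQP N_gt0 degP e_basis p Oa Qz za).
rewrite mulmx_suml; apply: eq_bigr => m _.
by rewrite -scalemxAl (evl_spec degQP degP e_basis).
Qed.

Definition represents (f : V) (F : C -> 'cV[C]_(N * p)) :=
  analytic_on F A /\ f = on_domain pA (fun z => ZI z *m F (r z)).

Lemma repr_in f F z : represents f F -> pA z -> f z = ZI z *m F (r z).
Proof. by move=> [_ ->] hz; rewrite /on_domain patchT // inE. Qed.

Lemma repr_out f F z : represents f F -> ~ pA z -> f z = 0.
Proof. by move=> [_ ->] hz; rewrite /on_domain patchC // inE. Qed.

Lemma repr_cont f F a : represents f F -> A a -> mccont F a.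
Proof. by move=> [hF _] Aa i j; apply: cdiff_ccont; apply/cdiffP; exact: hF. Qed.

Lemma repr_evl f F a : represents f F -> B a -> evl a f = F a.
Proof.
move=> hf Ba; apply: (evl_uniq degQP e_basis); first by case: Ba.
by move=> m; rewrite (repr_in hf (sol_pA m Ba)) sol_r //; case: Ba.
Qed.

Lemma repr_diff f F a j : represents f F -> B a -> cdiff (fun z => evl z f j 0) a.
Proof.
move=> hf Ba; apply: (@cdiff_near _ (fun z => F z j 0)).
  by apply/cdiffP; apply: hf.1; case: Ba.
apply: filterS (Bset_open coprimePQ degQP N_gt0 degP disks Ba) => z Bz.
by rewrite (repr_evl hf Bz).
Qed.

(** B is dense in A, since Omega is cofinite. *)
Lemma A_dense m n (F G : C -> 'M[C]_(m, n)) a : A a -> mccont F a -> mccont G a ->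
  (forall z, B z -> F z = G z) -> F a = G a.
Proof.
move=> Aa Fc Gc h; apply: (mccont_eq_lim Fc Gc) => d d0.
have [z za [Bz _]] := Bset_dense coprimePQ degQP N_gt0 degP disks Aa d0.
by exists z => //; exact: h.
Qed.

Lemma repr_sep f F : represents f F -> (forall a, B a -> evl a f = 0) -> f = 0.
Proof.
move=> hf h; apply/funext => z; have [hz|hz] := pselect (pA z); last first.
  by rewrite (repr_out hf hz).
rewrite (repr_in hf hz) (_ : F (r z) = 0) ?mulmx0 //.
apply: (A_dense (F := F) (G := fun=> 0)); first by case: hz.
- by apply: (repr_cont hf); case: hz.
- exact: mccont_cst.
- by move=> y By; rewrite -(repr_evl hf By) h.
Qed.

Variables (H : set V) (ip : V -> V -> C) (K : C -> C -> 'M[C]_p).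
Hypotheses (H_pontryagin : pontryagin H ip)
  (H_analytic : forall f, H f -> admissible_fun P Q e A f)
  (H_kernel : reproducing_kernel pA H ip K).
Let sH : Defs.subspace H := let: And3 h _ _ := H_pontryagin in h.
Let sesq : sesquilinear_on H ip := let: And3 _ h _ := H_pontryagin in h.

Local Notation isR := (isR H B evl).

Lemma H_repr f : H f -> exists F, represents f F.
Proof. by move=> /H_analytic[F [hF fE]]; exists F. Qed.

(** The defining relation of isR, which concerns B, holds on the whole of A. *)
Lemma isR_repr a f g F G z : B a -> represents f F -> represents g G -> isR a f g -> A z ->
  (z - a) *: G z = F z - evl a f.
Proof.
move=> Ba hf hg [_ hR] Az.
apply: (A_dense (F := fun z => (z - a) *: G z) (G := fun z => F z - evl a f) Az).
- apply: mccontZ; last exact: repr_cont hg Az.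
  by apply: ccontB; [exact: ccont_id|exact: ccont_cst].
- by apply: mccontB; [exact: repr_cont hf Az|exact: mccont_cst].
- by move=> y By; rewrite -(repr_evl hg By) hR // (repr_evl hf By).
Qed.

(** This also holds at the roots of r = a, where it says that f and ZI F(a)
    agree; no limit is involved. *)
Lemma isR_value a f g z : B a -> H f -> isR a f g -> pA z ->
  (r z - a) *: g z = f z - ZI z *m evl a f.
Proof.
move=> Ba hf rg hz; have [F hF] := H_repr hf; have [G hG] := H_repr rg.1.
rewrite (repr_in hF hz) (repr_in hG hz) scalemxAr (isR_repr Ba hF hG rg) ?mulmxBr //.
by case: hz.
Qed.

Lemma Rop_isR a f : B a -> H f -> H (Rop P Q A a f) -> isR a f (Rop P Q A a f).
Proof.
move=> Ba hf hR; apply: isR_off => // z Bz za; have [Oa Aa] := Ba; have [Oz Az] := Bz.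
have za0 : z - a != 0 by rewrite subr_eq0.
have -> : evl z (Rop P Q A a f) = (z - a)^-1 *: (evl z f - evl a f).
  apply: (evl_uniq degQP e_basis) => // m; have hm := sol_pA m Bz.
  rewrite /Rop /on_domain patchT ?inE // sol_r // (negPf za) resolvent_formulaE //.
  - by rewrite sol_r // -scalemxAr mulmxBr (evl_spec degQP degP e_basis).
  - exact: sol_Q.
  - by rewrite sol_r.
by rewrite scalerA divff // scale1r.
Qed.

(** At a root z of r = a, the formula for R_a f agrees near z with
    (Z_r (x) I) G(r), which is continuous at z; this identifies the limit. *)
Lemma isR_Rop a f g : B a -> H f -> isR a f g -> Rop P Q A a f = g.
Proof.
move=> Ba hf rg; have [Oa Aa] := Ba; have [G hG] := H_repr rg.1.
apply/funext => z; have [hz|hz] := pselect (pA z); last first.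
  by rewrite (repr_out hG hz) /Rop /on_domain patchC // inE.
have off y : pA y -> r y != a -> resolvent_formula P Q a f y = g y.
  move=> hy ya; rewrite resolvent_formulaE //; last by case: hy.
  by rewrite -(isR_value Ba hf rg hy) scalerA mulVf ?scale1r // subr_eq0.
rewrite /Rop /on_domain patchT ?inE //; case: eqP => [rz|/eqP]; last exact: off.
apply/matrixP => k j; rewrite ord1 mxE (repr_in hG hz).
apply: (clim_eq (h' := fun y => (ZI y *m G (r y)) k 0)).
  have [Qz Az] := hz.
  have Zc := ZI_mccont Qz.
  apply: (mccontM Zc (N := fun y => G (r y))) => i l.
  by apply: (@ccont_comp _ r (fun y => G y i l)); [exact: ratf_ccont|exact: repr_cont hG Az i l].
have hn : \forall y \near (z : C^o), forall m, y != sol a m \/ y = z.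
  apply: (filter_forall (nbhs_filter (z : C^o))) => m; have [->|zm] := eqVneq z (sol a m).
    by apply/nbhs_nsq; exists 1 => // y _; have [->|] := eqVneq y (sol a m); [right|left].
  by apply: filterS (near_neq zm) => y; left.
apply: filterS2 hn (preimA_open disks hz) => y ym hy yz.
rewrite off //; first by rewrite (repr_in hG hy).
apply/negP => /eqP ry; have [_ hsol _] := sol_spec degP Oa.
have /hsol[m ye] : solutions P Q a y by split => //; case: hy.
by have [|yzE] := ym m; [rewrite ye eqxx|rewrite yzE eqxx in yz].
Qed.

Definition kerfun w (c : 'cV[C]_p) : V := on_domain pA (fun z => K z w *m c).

Lemma kerfun_H w c : pA w -> H (kerfun w c).
Proof. by move=> hw; have [] := H_kernel c hw. Qed.

Lemma kerfun_E w c f : pA w -> H f -> ip f (kerfun w c) = dot c (f w).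
Proof. by move=> hw hf; have [_ ->] := H_kernel c hw. Qed.

Lemma kerfun_in w c z : pA z -> kerfun w c z = K z w *m c.
Proof. by move=> hz; rewrite /kerfun /on_domain patchT // inE. Qed.

(** Coefficients expressing evl a f through the values of f at the roots. *)
Definition coef a m : 'M[C]_(N * p, p) :=
  \matrix_(i, j) (invmx (vdm Q degP e a) (mxtens_unindex i).1 m * ((mxtens_unindex i).2 == j)%:R).

Lemma evlE a f : evl a f = \sum_m coef a m *m f (sol a m).
Proof.
apply/matrixP => i c; rewrite ord1 mxE summxE; apply: eq_bigr => m _.
rewrite mxE (bigD1 (mxtens_unindex i).2) //= big1 ?addr0.
  by rewrite mxE eqxx mulr1.
by move=> j ji; rewrite mxE eq_sym (negPf ji) mulr0 mul0r.
Qed.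

Lemma coef_ZI a : Omega P Q a -> \sum_m coef a m *m ZI (sol a m) = 1%:M.
Proof.
move=> Oa; have key (v : 'cV[C]_(N * p)) : (\sum_m coef a m *m ZI (sol a m)) *m v = v.
  rewrite -[RHS](evl_uniq degQP e_basis (f := fun z => ZI z *m v) Oa (fun m => erefl)).
  rewrite evlE mulmx_suml; apply: eq_bigr => m _; exact: esym (mulmxA _ _ _).
apply/matrixP => i j; have := congr1 (fun v : 'cV[C]_(N * p) => v i 0) (key (delta_mx j 0)).
by rewrite -colE !mxE eqxx andbT.
Qed.

(** The vector representing the evaluation f |-> F(a), a combination of kernel
    functions at the roots of r = a. *)
Definition evkernel a (c : 'cV[C]_(N * p)) : V := \sum_m kerfun (sol a m) (adjmx (coef a m) *m c).

Lemma evkernel_H a c : B a -> H (evkernel a c).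
Proof. by move=> Ba; apply: (sub_sum sH) => m _; apply: kerfun_H; exact: sol_pA. Qed.

Lemma evkernel_E a c f : B a -> H f -> ip f (evkernel a c) = dot c (evl a f).
Proof.
move=> Ba hf; rewrite (ip_sumr sH sesq) //; last first.
  by move=> m _; apply: kerfun_H; exact: sol_pA.
rewrite evlE /dot mulmx_sumr summxE; apply: eq_bigr => m _.
by rewrite kerfun_E //; [rewrite /dot adjmxM adjmxK mulmxA|exact: sol_pA].
Qed.

Definition evkernel_mx a z := \sum_m K z (sol a m) *m adjmx (coef a m).

Lemma evkernel_in a c z : pA z -> evkernel a c z = evkernel_mx a z *m c.
Proof.
move=> hz; rewrite /evkernel fct_sumE /evkernel_mx mulmx_suml; apply: eq_bigr => m _.
by rewrite kerfun_in // mulmxA.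
Qed.

Lemma H_nondeg u : H u -> (forall f, H f -> ip f u = 0) -> u = 0.
Proof.
move=> hu h; apply/funext => w; have [hw|hw] := pselect (pA w); last first.
  by have [F hF] := H_repr hu; rewrite (repr_out hF hw).
apply/matrixP => i j; rewrite ord1 [RHS]mxE.
rewrite -(dot_delta i (u w)) -(kerfun_E _ hw hu) (ipC sesq) ?h ?conjC0 //; exact: kerfun_H.
Qed.


(** * The two implications *)

Variables (J : 'M[R]_p) (a0 : C).
Hypotheses (r_real : real_fun r) (J_signature : signature_mx J) (a0_Omega : Omega P Q a0).
Local Notation X := (assoc_mx P Q e J a0).

Let XU : X \in unitmx := X_unit coprimePQ degQP N_gt0 degP e_basis J_signature a0_Omega.
Let Xh : adjmx X = X := X_adj coprimePQ degQP N_gt0 degP r_real e_basis J_signature a0_Omega.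

Lemma rhs_dot a b f g : B a -> B b -> a != b^* ->
  'i * (a - b^*) * \sum_(u \in solutions P Q a) \sum_(v \in solutions P Q b)
    ((((cderiv r v)^*)^-1 *: adjmx (g v)) *m cmx J *m ((cderiv r u)^-1 *: f u)) 0 0 / (u - v^*)
  = 'i * dot (evl b g) (X *m evl a f).
Proof.
move=> [Oa _] [Ob _] ab.
rewrite (rhs_sum coprimePQ degQP N_gt0 degP r_real e_basis J f g Oa Ob ab).
rewrite (X_indep coprimePQ degQP N_gt0 degP e_basis J Oa a0_Omega) /dot !mulmxA.
by rewrite -mulrA mulVKf // subr_eq0.
Qed.

Definition kernel_form (Theta : C -> 'M[C]_(N * p)) := forall z w, pA z -> pA w -> r z != (r w)^* ->
  K z w = ZI z *m ((- 'i * (r z - (r w)^*))^-1 *: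
     (invmx X - Theta (r z) *m X *m adjmx (Theta (r w)))) *m adjmx (ZI w).

Definition resolvent_identity a b f g :=
  ip (Rop P Q A a f) g - ip f (Rop P Q A b g)
    - (a - b^*) * ip (Rop P Q A a f) (Rop P Q A b g)
  = 'i * dot (evl b g) (X *m evl a f).

(** Condition (2) in terms of the vectors evkernel: the factors Z_r (x) I are
    removed by interpolation at the roots, on both sides. *)
Lemma kernel_evl Theta l m c : kernel_form Theta -> B l -> B m -> l != m^* ->
  (- 'i * (l - m^*)) *: evl l (evkernel m c) = (invmx X - Theta l *m X *m adjmx (Theta m)) *m c.
Proof.
move=> hK Bl Bm lm; have [Ol Al] := Bl; have [Om Am] := Bm.
set S := invmx X - _; set t := - 'i * (l - m^*).
have t0 : t != 0 by rewrite mulf_neq0 ?oppr_eq0 ?neq0Ci // subr_eq0.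
suff -> : evl l (evkernel m c) = t^-1 *: (S *m c) by rewrite scalerA divff // scale1r.
apply: (evl_uniq degQP e_basis) => // j; have hj := sol_pA j Bl.
rewrite evkernel_in // /evkernel_mx.
have -> : \sum_n K (sol l j) (sol m n) *m adjmx (coef m n) =
    ZI (sol l j) *m (t^-1 *: S) *m \sum_n adjmx (ZI (sol m n)) *m adjmx (coef m n).
  rewrite mulmx_sumr; apply: eq_bigr => n _; rewrite mulmxA; congr (_ *m _).
  by rewrite (hK _ _ hj (sol_pA n Bm)) !sol_r.
have -> : \sum_n adjmx (ZI (sol m n)) *m adjmx (coef m n) = 1%:M.
  rewrite -[RHS]adjmx1 -(coef_ZI Om).
  apply/matrixP => i k; rewrite adjmxE !summxE rmorph_sum; apply: eq_bigr => n _.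
  by rewrite -adjmxM adjmxE.
by rewrite mulmx1 -mulmxA -scalemxAl.
Qed.

(** The real point must be close to 0, where Theta is continuous. *)
Lemma resolvent_of_kernel Theta : analytic_near Theta 0 -> kernel_form Theta ->
  forall a b, B a -> B b -> 
     (forall f, H f -> H (Rop P Q A a f) /\ H (Rop P Q A b f)) /\
     (forall f g, H f -> H g -> resolvent_identity a b f g).
Proof.
move=> hT hK.
have /nbhs_nsq[d d0 hd] := hT.
have [t td Bt] := Bset_real coprimePQ degQP N_gt0 degP disks d0.
have [JJ [ss ph]] := pontryagin_hilbertP H_pontryagin.
have M : core_model H ip B evl X Theta evkernel ((t%:C)%C) JJ ss.
  constructor => //.
  - exact: (Bset_open coprimePQ degQP N_gt0 degP disks).
  - by move=> a c u v _ _ _; exact: evl_lin.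
  - by move=> f a j /H_repr[F hF] Ba; exact: repr_diff hF Ba.
  - by move=> f /H_repr[F hF] h; exact: repr_sep hF h.
  - by move=> a c Ba; exact: evkernel_H.
  - by move=> a c f Ba hf; exact: evkernel_E.
  - by move=> l m c Bl Bm lm; exact: kernel_evl.
  - by move=> i j; apply: cdiff_ccont; apply/cdiffP; apply: hd; rewrite subr0.
have hR a f : B a -> H f -> isR a f (Rop P Q A a f).
  by move=> Ba hf; have [g rg] := R_all M Ba hf; rewrite (isR_Rop Ba hf rg).
move=> a b Ba Bb; split.
  by move=> f hf; split; [have [] := hR a f Ba hf|have [] := hR b f Bb hf].
by move=> f g hf hg; exact: (Rid_all M Ba Bb hf hg (hR a f Ba hf) (hR b g Bb hg)).
Qed.

(** The case a = b^* = b of the identity, which condition (1) leaves out, follows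
    from the identity for a single pair (a, b): u = f - (a - b) R_b f satisfies
    R_a u = R_b f and has at a the value of f at b. *)
Lemma real_identity a b f g : B a -> B b -> a != b -> b^* = b ->
  (forall f, H f -> H (Rop P Q A a f) /\ H (Rop P Q A b f)) ->
  (forall f g, H f -> H g -> resolvent_identity a b f g) -> H f -> H g ->
  ip (Rop P Q A b f) g - ip f (Rop P Q A b g) = 'i * dot (evl b g) (X *m evl b f).
Proof.
move=> Ba Bb ab bR hR hI hf hg.
have [_ hf'] := hR f hf; have [_ hg'] := hR g hg.
have rf := Rop_isR Bb hf hf'.
move: hf' hg' rf; set f' := Rop P Q A b f => hf' hg' rf.
have hz : H ((a - b) *: f') := subZ sH _ hf'.
have hu : H (f - (a - b) *: f') := subB sH hf hz.
have evu z : B z -> evl z (f - (a - b) *: f') = evl z f - (a - b) *: evl z f'.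
  by move=> Bz; rewrite addrC -scaleNr evl_lin scaleNr addrC.
have ua : evl a (f - (a - b) *: f') = evl b f.
  by rewrite evu // (rf.2 a Ba) opprB addrC subrK.
have ru : isR a (f - (a - b) *: f') f'.
  split=> // z Bz; rewrite ua evu // addrAC -(rf.2 z Bz) -scalerBl; congr (_ *: _).
  by rewrite opprB addrA subrK.
have := hI _ _ hu hg; rewrite /resolvent_identity (isR_Rop Ba hu ru) ua bR => <-.
rewrite (ipBl sH sesq hf hz hg') (ipZl sH sesq _ hf' hg').
by rewrite opprB -addrA [X in _ = _ + X]addrAC subrr add0r.
Qed.

(** Both sides have the same inner product with every f: after moving R_b to
    the other side by the real identity, this is the value at w of
    f - (r - b) R_b f = (Z_r (x) I) F(b). *)
Lemma kernel_vector b w c : B b -> b^* = b ->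
  (forall f, H f -> H (Rop P Q A b f)) ->
  (forall f g, H f -> H g ->
    ip (Rop P Q A b f) g - ip f (Rop P Q A b g) = 'i * dot (evl b g) (X *m evl b f)) ->
  pA w ->
  kerfun w c - ((r w)^* - b) *: (Rop P Q A b (kerfun w c) - 'i *: evkernel b (X *m evl b (kerfun w c)))
  = evkernel b (adjmx (ZI w) *m c).
Proof.
move=> Bb bR hR hI hw.
have hk := kerfun_H c hw; have hRk := hR _ hk.
have hkb d : H (evkernel b d) by exact: evkernel_H.
have hik d : H ('i *: evkernel b d) by exact: (subZ sH).
have hd d : H (Rop P Q A b (kerfun w c) - 'i *: evkernel b d) by exact: (subB sH).
have hs d : H (((r w)^* - b) *: (Rop P Q A b (kerfun w c) - 'i *: evkernel b d)) by exact: (subZ sH).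
apply/eqP; rewrite -subr_eq0; apply/eqP; apply: H_nondeg.
  by apply: (subB sH) => //; exact: (subB sH).
move=> f hf; have hRf := hR _ hf.
rewrite (ipBr sH sesq) //; last exact: (subB sH).
rewrite (ipBr sH sesq) // (ipZr sH sesq) // (ipBr sH sesq) // (ipZr sH sesq) //.
rewrite !evkernel_E // kerfun_E //.
have -> : ip f (Rop P Q A b (kerfun w c)) =
    dot c (Rop P Q A b f w) - 'i * dot (evl b (kerfun w c)) (X *m evl b f).
  by rewrite -(hI _ _ hf hk) kerfun_E // opprB addrC subrK.
have -> : dot (X *m evl b (kerfun w c)) (evl b f) = dot (evl b (kerfun w c)) (X *m evl b f).
  by rewrite dot_mxr Xh.
rewrite conjCi mulNr opprK subrK rmorphB /= conjCK bR.
rewrite -dotZr (isR_value Bb hf (Rop_isR Bb hf hRf) hw) dotBr subKr.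
by rewrite /dot adjmxM adjmxK mulmxA subrr.
Qed.

Lemma evl_kerfun b w c : B b -> pA w -> evl b (kerfun w c) = adjmx (evkernel_mx b w) *m c.
Proof.
move=> Bb hw; apply/matrixP => i j; rewrite ord1 -!dot_delta.
have hk := evkernel_H (delta_mx i 0) Bb; have hv := kerfun_H c hw.
rewrite -(evkernel_E _ Bb hv) (ipC sesq hk hv) kerfun_E // evkernel_in // -dotC.
by rewrite /dot adjmxM mulmxA.
Qed.

Lemma evkernel_mx_repr b : B b -> exists M : C -> 'M[C]_(N * p),
  analytic_on M A /\ forall z, pA z -> evkernel_mx b z = ZI z *m M (r z).
Proof.
move=> Bb; have /choice[F hF] : forall j : 'I_(N * p), exists F, represents (evkernel b (delta_mx j 0)) F.
  by move=> j; apply: H_repr; exact: evkernel_H.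
exists (fun z => \matrix_(i, j) F j z i 0); split.
  move=> z Az i j; rewrite (_ : (fun y => _) = fun y => F j y i 0); first exact: (hF j).1.
  by apply/funext => y; rewrite mxE.
move=> z hz; apply/matrixP => i j.
have := congr1 (fun v : 'cV[C]_p => v i 0) (evkernel_in b (delta_mx j 0) hz).
rewrite (repr_in (hF j) hz) -colE [col _ _ _ _]mxE => <-.
by rewrite !mxE; apply: eq_bigr => l _; rewrite mxE.
Qed.

Lemma Theta_expand x y (M1 M2 : 'M[C]_(N * p)) :
  invmx X - (invmx X + x *: M1) *m X *m (invmx X + y *: M2) =
  - x *: M1 - y *: M2 - (x * y) *: (M1 *m X *m M2).
Proof.
have -> : (invmx X + x *: M1) *m X = 1%:M + x *: (M1 *m X).
  by rewrite mulmxDl mulVmx // scalemxAl.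
rewrite mulmxDl mul1mx mulmxDr -!scalemxAr -!scalemxAl mulmxK // scalerA [y * x]mulrC.
by rewrite scaleNr !opprD !addrA subrr add0r [- (y *: M2) - _]addrC.
Qed.

(** The value at z of kernel_vector involves K z w and the value at z of
    R_b applied to the kernel function, and isR_value is a second equation for
    the latter.  Eliminating it leaves K z w in terms of M, where
    (Z_r (x) I) M(r) is the matrix of evkernel b. *)
Lemma kernel_of_resolvent :
  (forall a b, B a -> B b -> a != b^* ->
     (forall f, H f -> H (Rop P Q A a f) /\ H (Rop P Q A b f)) /\
     (forall f g, H f -> H g -> resolvent_identity a b f g)) ->
  exists Theta, analytic_near Theta 0 /\ kernel_form Theta.
Proof.
move=> h1.
have [x _ Bt] := Bset_real coprimePQ degQP N_gt0 degP disks (@ltr01 R).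
have bR : ((x%:C)%C : C)^* = (x%:C)%C by exact: conj_realC.
move: ((x%:C)%C) Bt bR => b Bt bR.
have [a _ [Ba ab]] := Bset_dense coprimePQ degQP N_gt0 degP disks Bt.2 (@ltr01 R).
have [|hR hI] := h1 a b Ba Bt; first by rewrite bR.
have hRb f : H f -> H (Rop P Q A b f) by move=> /hR[].
have hIb f g := @real_identity a b f g Ba Bt ab bR hR hI.
have [M [Ma hM]] := evkernel_mx_repr Bt.
exists (fun l => invmx X + ('i * (l - b)) *: M l); split.
  apply: filterS (Aset_open disks (Aset_0 disks)) => z Az i j; apply/cdiffP.
  rewrite (_ : (fun y => _) = fun y => invmx X i j + 'i * (y - b) * M y i j); last first.
    by apply/funext => y; rewrite !mxE.
  apply: cdiffD; first exact: cdiff_cst.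
  apply: cdiffM; last by apply/cdiffP; exact: Ma.
  apply: cdiffM; first exact: cdiff_cst.
  by apply: cdiffB; [exact: cdiff_id|exact: cdiff_cst].
move=> z w hz hw zw; set t := - 'i * _.
have t0 : t != 0 by rewrite mulf_neq0 ?oppr_eq0 ?neq0Ci // subr_eq0.
set S := invmx X - _.
have SE : S = - ('i * (r z - b)) *: M (r z) - (- ('i * ((r w)^* - b))) *: adjmx (M (r w))
    - ('i * (r z - b) * - ('i * ((r w)^* - b))) *: (M (r z) *m X *m adjmx (M (r w))).
  rewrite -Theta_expand /S; congr (_ - _ *m _).
  rewrite adjmxD adjmxZ (adjmx_inv XU) Xh; congr (_ + _ *: _).
  by rewrite rmorphM rmorphB /= bR conjCi mulNr.
suff key (c : 'cV[C]_p) : t *: (K z w *m c) = ZI z *m (S *m (adjmx (ZI w) *m c)).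
  apply: (scalerI t0); rewrite -scalemxAr -scalemxAl scalerA divff // scale1r.
  apply/matrixP => i j; have := congr1 (fun v : 'cV[C]_p => v i 0) (key (delta_mx j 0)).
  by rewrite !mulmxA scalemxAl -!colE [col _ _ _ _]mxE [RHS]mxE.
have e1 := congr1 (fun u : V => u z) (kernel_vector c Bt bR hRb hIb hw).
have e2 := isR_value Bt (kerfun_H c hw) (Rop_isR Bt (kerfun_H c hw) (hRb _ (kerfun_H c hw))) hz.
have tE : t = - 'i * ((r z - b) - ((r w)^* - b)) by rewrite opprB addrA subrK.
rewrite tE SE; apply: (kernel_elimination (g := Rop P Q A b (kerfun w c) z)).
  move: e1; rewrite -[X in X = _ -> _]/(kerfun w c z - ((r w)^* - b) *:
     (Rop P Q A b (kerfun w c) z - 'i *: evkernel b (X *m evl b (kerfun w c)) z)).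
  rewrite kerfun_in // (evkernel_in _ _ hz) (evkernel_in _ _ hz) evl_kerfun // (hM z hz) (hM w hw).
  by rewrite adjmxM !mulmxA.
by move: e2; rewrite (kerfun_in _ _ hz) (evl_kerfun _ Bt hw) (hM w hw) adjmxM !mulmxA.
Qed.

End Model.

Theorem theorem8p1 (R : realType) (P Q : {poly R[i]}) (N : nat)
  (coprimePQ : coprimep P Q) (degQP : (size Q <= size P)%N)
  (N_gt0 : (0 < N)%N) (degP : size P = N.+1)
  (r_real : real_fun (ratf P Q))
  (e : 'I_N -> R[i] -> R[i]) (e_basis : real_basis P Q e)
  (L : nat) (zeta : 'I_L -> R[i]) (s : 'I_L -> R) (rho : R)
  (disks : zero_disks P Q zeta s rho)
  (p : nat) (J : 'M[R]_p) (J_signature : signature_mx J)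
  (H : set (R[i] -> 'cV[R[i]]_p))
  (ip : (R[i] -> 'cV[R[i]]_p) -> (R[i] -> 'cV[R[i]]_p) -> R[i])
  (K : R[i] -> R[i] -> 'M[R[i]]_p)
  (H_pontryagin : pontryagin H ip)
  (H_analytic : forall f, H f -> admissible_fun P Q e (Aset P Q zeta s) f)
  (H_kernel : reproducing_kernel (preimA P Q (Aset P Q zeta s)) H ip K)
  (a0 : R[i]) (a0_Omega : Omega P Q a0) :
  let r := ratf P Q in
  let A := Aset P Q zeta s in
  let X := assoc_mx P Q e J a0 in
  (forall a b : R[i], Omega P Q a -> A a -> Omega P Q b -> A b -> a != b^* ->
     (forall f, H f -> H (Rop P Q A a f) /\ H (Rop P Q A b f)) /\
     (forall f g, H f -> H g ->
        ip (Rop P Q A a f) g - ip f (Rop P Q A b g)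
          - (a - b^*) * ip (Rop P Q A a f) (Rop P Q A b g)
        = 'i * (a - b^*) *
          \sum_(u \in solutions P Q a) \sum_(v \in solutions P Q b)
            ((((cderiv r v)^*)^-1 *: adjmx (g v)) *m cmx J
               *m ((cderiv r u)^-1 *: f u)) 0 0 / (u - v^*)))
  <->
  (exists Theta : R[i] -> 'M[R[i]]_(N * p),
     analytic_near Theta 0 /\
     forall z w, preimA P Q A z -> preimA P Q A w -> r z != (r w)^* ->
       K z w =
         ZI p e z
         *m ((- 'i * (r z - (r w)^*))^-1 *:
               (invmx X - Theta (r z) *m X *m adjmx (Theta (r w))))
         *m adjmx (ZI p e w)).
Proof.
move=> r A X.
have rhs := rhs_dot coprimePQ degQP N_gt0 degP e_basis (zeta := zeta) (s := s) J r_real a0_Omega.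
split=> [h1|[Th [hT hK]] a b Oa Aa Ob Ab ab].
  apply: (kernel_of_resolvent coprimePQ degQP N_gt0 (degP := degP) e_basis disks H_pontryagin
    H_analytic H_kernel r_real J_signature a0_Omega).
  move=> a b Ba Bb ab; have [Oa Aa] := Ba; have [Ob Ab] := Bb.
  have [hR hI] := h1 a b Oa Aa Ob Ab ab; split=> // f g hf hg.
  by rewrite /resolvent_identity hI // rhs.
have [hR hI] := resolvent_of_kernel coprimePQ degQP N_gt0 degP e_basis disks H_pontryagin
  H_analytic H_kernel r_real J_signature a0_Omega hT hK (conj Oa Aa) (conj Ob Ab).
by split=> // f g hf hg; rewrite rhs //; exact: hI.
Qed.
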